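(* Let $m\ge1$ and consider $(\mathfrak{E}_m)$ restricted to $\underline a'=0$, i.e. $x^2\Phi''=(x^m+a_m)\Phi$. Then $$\mathfrak{S}_0(0,a_m)=\begin{pmatrix}2e^{-\frac{i\pi}m}\cos\big(\pi\frac pm\big)&-e^{-\frac{2i\pi}m}\\ 1&0\end{pmatrix},\qquad p=(1+4a_m)^{1/2}.$$ Furthermore, for $\frac pm\notin\mathbb{Z}$, the $0\infty$ connection matrix $M_0$ is given by $$M_0(0,p)=\begin{pmatrix}e^{\beta_m(-p)}\frac{\omega^{-\frac12}}{\sqrt{m\pi}}\Gamma\big(-\frac pm\big)&e^{\beta_m(p)}\frac{\omega^{-\frac12}}{\sqrt{m\pi}}\Gamma\big(\frac pm\big)\\ \omega^{s(p)}e^{\beta_m(-p)}\frac{\omega^{-\frac12}}{\sqrt{m\pi}}\Gamma\big(-\frac pm\big)&\omega^{s(-p)}e^{\beta_m(p)}\frac{\omega^{-\frac12}}{\sqrt{m\pi}}\Gamma\big(\frac pm\big)\end{pmatrix},$$ where $s(p)=\frac{1+p}2$, while $\beta_m(p)$ is an odd function, entire in $p$, such that for all $k\in\mathbb{N}^\star$, $e^{\beta_m(km)}=\pm m^k$.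
   Context: $(\mathfrak{E}_m)$ is the equation $\Phi''(x)=\frac{P_m(x,\underline a)}{x^2}\Phi(x)$, $P_m(x,\underline a)=x^m+a_1x^{m-1}+\cdots+a_m$, $\underline a\in\mathbb{C}^m$, $\underline a'=(a_1,\dots,a_{m-1})$; $x$ lies on the universal covering of $\mathbb{C}^\star$. $\omega=e^{2i\pi/m}$, $\omega^c:=e^{2i\pi c/m}$, $\tau.\underline a:=(\tau a_1,\dots,\tau^ma_m)$. Solutions at infinity: define $b_{\frac m2-k}(\underline a)$ by $\frac{\sqrt{P_m(x,\underline a)}}{x}=x^{\frac m2-1}+\sum_{k\ge1}b_{\frac m2-k}(\underline a)x^{\frac m2-k-1}$ at infinity; $r(\underline a)=\frac12-\frac m4$ ($m$ odd), $r(\underline a)=\frac12-\frac m4-b_0(\underline a)$ ($m$ even); $S(x,\underline a)=\frac2mx^{\frac m2}+\sum_{1\le k<m/2}\frac{b_{\frac m2-k}(\underline a)}{\frac m2-k}x^{\frac m2-k}$. $\Phi_0(x,\underline a)$ is the unique solution of $(\mathfrak{E}_m)$ asymptotic at infinity to $x^{r(\underline a)}e^{-S(x,\underline a)}\phi_0$ ($\phi_0$ a formal series in $x^{-1/2}$, resp. $x^{-1}$ for $m$ even, with constant term $1$) in every strict sub-sector of $\{|\arg x|<3\pi/m\}$, locally uniformly in $\underline a$; it extends analytically to the universal covering of $\mathbb{C}^\star$ and is entire in $\underline a$. $\Phi_k(x,\underline a)=\Phi_0(\omega^kx,\omega^k.\underline a)$, and $\mathfrak{S}_0(\underline a)$ is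 defined by $\begin{pmatrix}\Phi_{-1}\\ \Phi_0\end{pmatrix}=\mathfrak{S}_0(\underline a)\begin{pmatrix}\Phi_0\\ \Phi_1\end{pmatrix}$; $\mathfrak{S}_0(0,a_m)$ is its value at $\underline a=(0,\dots,0,a_m)$. Solutions at the origin: for $\underline a'=0$ and $\frac pm\notin\mathbb{Z}$, with $a_m=\frac{p^2-1}{4}$, $f_1(x,0,p)=x^{s(p)}g_1(x,0,p)$ and $f_2(x,0,p)=x^{s(-p)}g_1(x,0,-p)$, where $g_1(x,0,p)=1+\sum_{k\ge1}A_k(0,p)x^k$ is the entire function of $x$ such that $f_1$ is a solution (it is a power series in $x^m$, meromorphic in $p$ with at most simple poles at $-p\in m\mathbb{N}^\star$). The $0\infty$-connection matrix $M_0(0,p)$ is defined by $\begin{pmatrix}\Phi_{-1}\\ \Phi_0\end{pmatrix}(x,\underline a)=M_0(0,p)\begin{pmatrix}f_1\\ f_2\end{pmatrix}(x,0,p)$. *)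

(* Defs.v *)
From Stdlib Require Export Reals.
From Coquelicot Require Export Coquelicot.

Open Scope R_scope.
Open Scope C_scope.

(** * Complex functions *)

Definition Cexp (z : C) : C := (exp (Re z) * cos (Im z), exp (Re z) * sin (Im z))%R.

Definition Ccos (z : C) : C := (Cexp (Ci * z) + Cexp (- (Ci * z))) / 2.

Definition C_differentiable (f : C -> C) (z : C) : Prop :=
  @ex_derive C_AbsRing C_NormedModule f z.

Definition is_C_derive (f : C -> C) (z l : C) : Prop :=
  @is_derive C_AbsRing C_NormedModule f z l.

Definition Csum (f : nat -> C) (i j : nat) : C := @sum_n_m C_AbelianMonoid f i j.

(** Euler's integral, meaningful for [0 < Re z]. *)
Definition Gamma_integral (z : C) : C :=
  @RInt_gen C_R_CompleteNormedModule
    (fun u : R => Cexp ((z - 1) * ln u) * exp (- u)%R)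
    (at_right 0) (Rbar_locally p_infty).

Fixpoint Gamma_shift (n : nat) (z : C) : C :=
  match n with
  | O => Gamma_integral z
  | S n' => Gamma_shift n' (z + 1) / z
  end.

(** The Gamma function on [C] minus the nonpositive integers: the functional
    equation [Gamma z = Gamma (z + 1) / z] is used [n] times, [n] being the least
    natural number with [0 < Re z + n]. *)
Definition Gamma (z : C) : C := Gamma_shift (Z.to_nat (up (- Re z)%R)) z.

(** * The space [C^m] of the parameters [a = (a_1, ..., a_m)] *)

Definition Cvec (m : nat) : Type := Tn m C.

(** [coord a j] is [a_j]; the coordinates are numbered from [1]. *)
Definition coord {m : nat} (a : Cvec m) (j : nat) : C := coeff_Tn (RtoC 0) a (j - 1).

Definition mk_Cvec (m : nat) (f : nat -> C) : Cvec m := mk_Tn m (fun i => f (S i)).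

Definition Cvec_dist {m : nat} (a b : Cvec m) : R :=
  sum_n_m (fun j => Cmod (coord a j - coord b j)) 1 m.

(** [(0, ..., 0, am)] *)
Definition last_only (m : nat) (am : C) : Cvec m :=
  mk_Cvec m (fun j => if Nat.eqb j m then am else RtoC 0).

(** [tau . a = (tau a_1, ..., tau^m a_m)] *)
Definition act {m : nat} (tau : C) (a : Cvec m) : Cvec m :=
  mk_Cvec m (fun j => tau ^ j * coord a j).

(** Holomorphy on the whole of [C^m], as complex Frechet differentiability at
    every point. *)
Definition entire_Cvec {m : nat} (f : Cvec m -> C) : Prop :=
  forall a : Cvec m, exists l : Cvec m,
  forall eps : R, (0 < eps)%R -> exists delta : R, (0 < delta)%R /\
  forall b : Cvec m, (Cvec_dist b a < delta)%R ->
  (Cmod (f b - f a - Csum (fun j => coord l j * (coord b j - coord a j)) 1 m)%C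
     <= eps * Cvec_dist b a)%R.

(** * The equation on the universal covering of [C^*]

    A point [x] of the universal covering of [C^*] is given by its logarithm
    [t : C], so that [Re t = ln |x|], [Im t = arg x], the complex power [x^c] is
    [Cexp (c * t)], and [d/dx] is [Cexp (- t)] times [d/dt]. *)

Definition Pm {m : nat} (a : Cvec m) (x : C) : C :=
  x ^ m + Csum (fun j => coord a j * x ^ (m - j)) 1 m.

(** [dF] is the derivative of [F] with respect to [x = Cexp t]. *)
Definition is_solution {m : nat} (a : Cvec m) (F : C -> C) : Prop :=
  exists dF : C -> C, forall t : C,
    is_C_derive F t (Cexp t * dF t) /\
    is_C_derive dF t (Cexp t * (Pm a (Cexp t) / (Cexp t) ^ 2 * F t)).

(** * Solutions at infinity *)

(** [b k] is the coefficient [b_{m/2-k}] (with leading coefficient [b 0 = 1]) of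
    the expansion of [sqrt (P_m(x,a)) / x] for [|x|] large. *)
Definition is_sqrt_expansion {m : nat} (a : Cvec m) (b : nat -> C) : Prop :=
  b 0%nat = RtoC 1 /\
  exists T : R, forall t : C, (T < Re t)%R ->
  exists w : C,
    w * w = Pm a (Cexp t) / (Cexp t) ^ 2 /\
    @is_series C_AbsRing C_NormedModule
      (fun k => b k * Cexp ((INR m / 2 - INR k - 1) * t)) w.

Definition r_exp (m : nat) (b : nat -> C) : C :=
  if Nat.even m then 1 / 2 - INR m / 4 - b (m / 2)%nat
  else 1 / 2 - INR m / 4.

(** The indices [1 <= k < m/2] are those with [1 <= k <= (m - 1) / 2], the last
    quotient being the Euclidean one. *)
Definition S_exp (m : nat) (b : nat -> C) (t : C) : C :=
  2 / INR m * Cexp (INR m / 2 * t) +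
  Csum (fun k => b k / (INR m / 2 - INR k) * Cexp ((INR m / 2 - INR k) * t))
    1 ((m - 1) / 2)%nat.

(** The formal series [phi_0] is in powers of [x^{-1}] for [m] even, of
    [x^{-1/2}] for [m] odd. *)
Definition phi_step (m : nat) : R := if Nat.even m then 1%R else (1 / 2)%R.

(** [Phi0 t a] is [Phi_0(x,a)]. *)
Definition is_Phi0 (m : nat) (Phi0 : C -> Cvec m -> C) : Prop :=
  (forall a : Cvec m, is_solution a (fun t => Phi0 t a)) /\
  (forall t : C, entire_Cvec (fun a => Phi0 t a)) /\
  exists b phi : Cvec m -> nat -> C,
    (forall a, is_sqrt_expansion a (b a)) /\
    (forall a, phi a 0%nat = RtoC 1) /\
    forall (N : nat) (alpha : R), (alpha < 3 * PI / INR m)%R ->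
    forall a0 : Cvec m, exists delta T K : R, (0 < delta)%R /\
    forall (a : Cvec m) (t : C),
      (Cvec_dist a a0 < delta)%R -> (Rabs (Im t) <= alpha)%R -> (T < Re t)%R ->
      (Cmod (Phi0 t a / (Cexp (r_exp m (b a) * t) * Cexp (- S_exp m (b a) t))
             - Csum (fun n => phi a n * Cexp (- (phi_step m * INR n * t))) 0 N)%C
         <= K * Cmod (Cexp (- (phi_step m * INR (S N) * t)))%C)%R.

(** [omega m c = e^{2 i pi c / m}] *)
Definition omega (m : nat) (c : C) : C := Cexp (2 * Ci * PI * c / INR m).

(** [Phi_k(x,a) = Phi_0(omega^k x, omega^k . a)], where [omega^k x] is the point
    of the universal covering with logarithm [t + 2 i pi k / m]. *)
Definition Phi {m : nat} (Phi0 : C -> Cvec m -> C) (k : Z) (t : C) (a : Cvec m) : C :=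
  Phi0 (t + 2 * Ci * PI * IZR k / INR m) (act (omega m (IZR k)) a).

(** * Solutions at the origin, for [a = (0, ..., 0, (p^2 - 1)/4)] *)

Definition s_exp (p : C) : C := (1 + p) / 2.

Definition a_of_p (m : nat) (p : C) : Cvec m := last_only m ((p ^ 2 - 1) / 4).

Definition integral_ratio (m : nat) (p : C) : Prop := exists n : Z, p / INR m = IZR n.

(** [f_1(x,0,p) = x^{s(p)} g_1(x,0,p)], where [g1 x p] is [g_1(x,0,p)]; then
    [f_2(x,0,p)] is [f_sol g1 t (- p)]. *)
Definition f_sol (g1 : C -> C -> C) (t p : C) : C :=
  Cexp (s_exp p * t) * g1 (Cexp t) p.

(** That [g_1] is a power series in [x^m] is needed for uniqueness when [p] is an
    integer outside [m Z]: then [f_1] may be altered by a multiple of [f_2]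
    without losing the other conditions. *)
Definition is_g1 (m : nat) (g1 : C -> C -> C) : Prop :=
  forall p : C, ~ integral_ratio m p ->
    (exists A : nat -> C,
       A 0%nat = RtoC 1 /\
       (forall k : nat, ~ Nat.divide m k -> A k = RtoC 0) /\
       (forall x : C, @is_pseries C_AbsRing C_NormedModule A x (g1 x p))) /\
    is_solution (a_of_p m p) (fun t => f_sol g1 t p).

(** * Connection matrices *)

Definition mat2 (a b c d : C) : @matrix C 2 2 :=
  mk_matrix 2 2 (fun i j =>
    match i, j with
    | O, O => a
    | O, _ => b
    | _, O => c
    | _, _ => d
    end).

Definition col2 (u v : C) : @matrix C 2 1 :=
  mk_matrix 2 1 (fun i _ => match i with O => u | _ => v end).

Definition is_S0 {m : nat} (Phi0 : C -> Cvec m -> C) (a : Cvec m)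
    (M : @matrix C 2 2) : Prop :=
  forall t : C,
    col2 (Phi Phi0 (-1) t a) (Phi Phi0 0 t a) =
    @Mmult C_Ring 2 2 1 M (col2 (Phi Phi0 0 t a) (Phi Phi0 1 t a)).

Definition is_M0 {m : nat} (Phi0 : C -> Cvec m -> C) (g1 : C -> C -> C) (p : C)
    (M : @matrix C 2 2) : Prop :=
  forall t : C,
    col2 (Phi Phi0 (-1) t (a_of_p m p)) (Phi Phi0 0 t (a_of_p m p)) =
    @Mmult C_Ring 2 2 1 M (col2 (f_sol g1 t p) (f_sol g1 t (- p))).

(* Main.v *)
Require Import Defs.
From Stdlib Require Import Lra Lia Psatz Factorial ZArith.
From mathcomp Require Import ssreflect.

(** With [nu = p / m] and [y = x^m / m^2], the functions [x^(s(p)) u(y)] satisfy the equation for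
    [a' = 0] exactly when [y u'' + (nu + 1) u' = u]. This is Bessel's equation in disguise:
    [f_1] and [f_2] correspond to [I_nu] and [I_{-nu}], and [Phi_0] is a multiple of
    [x^(1/2) K_nu((2/m) x^(m/2))].

    The matrix [S_0]. The rotation [x -> omega x] acts linearly on the plane of solutions. The
    equation has no first-order term, so that Wronskians are constant and the rotation has
    determinant [omega]. When [Re p >= 0] the solution [f_1] exists even for integral [p / m], and
    it is an eigenvector with eigenvalue [omega^(s(p))]. The characteristic polynomial is therefore
    known, and by the Cayley-Hamilton identity ([rotation_cayley_hamilton]) it relates [Phi_{-1}],
    [Phi_0] and [Phi_1]; the cosine comes from the sum of the two eigenvalues. The matrix is unique
    because on the real axis [Phi_0] decays and [Phi_1] grows ([rotated_independent]).

    The matrix [M_0]. The Macdonald function is represented by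
    [J_nu(y) = int e^{nu v - e^v - y e^{-v}} dv] over the real line ([macdonald]), which satisfies
    [J_nu' = - J_{nu - 1}] and, by parts, [J_{nu + 1} = nu J_nu + y J_{nu - 1}]; these two relations
    contain the differential equation. For [Re nu > 0], [J_nu(y)] tends to [Gamma(nu)] as [y] tends
    to [0], which is the coefficient of the solution regular at the origin; the first relation propagates
    this value to all nonintegral [nu], exactly as [Gamma] is defined, and the symmetry
    [J_nu = y^nu J_{-nu}] gives the other coefficient ([macdonald_connection]). At infinity,
    Laplace's method and the Gaussian integral give the factor [sqrt PI] and the decay
    ([macdonald_asymptotic]). A solution on the real axis with the asymptotics of [Phi_0] is
    [Phi_0], since no multiple of the growing solution can be added ([recessive_unique]). Hence
    [Phi_0] is known in terms of [f_1] and [f_2], and [Phi_{-1}] follows since the rotation is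
    diagonal in this basis. Comparison with the announced matrix gives
    [beta_m(p) = (p / m) (ln m + i pi)].

    The exponent [S] reduces to [(2/m) x^(m/2)], and [b_0] vanishes, because the expansion of
    [sqrt (1 + a_m x^{-m})] has no term between [1] and [x^{-m}] ([sqrt_expansion_gap]). *)

(** * Complex differentiation *)

Lemma is_C_derive_eps (f : C -> C) (z l : C) :
  is_C_derive f z l <->
  forall eps, (0 < eps)%R -> exists d, (0 < d)%R /\
    forall w, (Cmod (w - z) < d)%R ->
      (Cmod (f w - f z - (w - z) * l)%C <= eps * Cmod (w - z))%R.
Proof.
split.
- move=> [_ H] eps He; case: (H z (fun P HP => HP) (mkposreal eps He)) => d Hd.
  exists d; split; first exact: cond_pos.
  by move=> w Hw; apply: (Hd w).
- move=> H; split; first exact: is_linear_scal_l.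
  move=> x Hx.
  apply (is_filter_lim_locally_unique (V := AbsRing_NormedModule C_AbsRing)) in Hx.
  subst x; case=> eps He.
  case: (H eps He) => d [Hd H1]; exists (mkposreal d Hd) => w Hw; exact: H1.
Qed.

(** The general rules for products and composites concern functions into the field seen as a
    module over itself, whose uniform structure is not the product structure of [C]; both
    notions of derivative only see the modulus. *)
Lemma is_C_derive_ring (f : C -> C) (z l : C) :
  is_C_derive f z l <-> @is_derive C_AbsRing (AbsRing_NormedModule C_AbsRing) f z l.
Proof.
split.
- move=> [_ H]; split; first exact: is_linear_scal_l.
  exact: H.
- move=> [_ H]; split; first exact: is_linear_scal_l.
  exact: H.
Qed.

Lemma is_C_derive_eq (f : C -> C) (z l l' : C) :
  is_C_derive f z l -> l = l' -> is_C_derive f z l'.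
Proof. by move=> H <-. Qed.

Lemma is_C_derive_ext (f g : C -> C) (z l : C) :
  (forall w, f w = g w) -> is_C_derive f z l -> is_C_derive g z l.
Proof. move=> H; exact: is_derive_ext. Qed.

Lemma is_C_derive_const (c z : C) : is_C_derive (fun _ => c) z 0.
Proof. exact: is_derive_const. Qed.

Lemma is_C_derive_id (z : C) : is_C_derive (fun w => w) z 1.
Proof. apply/is_C_derive_ring; exact: is_derive_id. Qed.

Lemma is_C_derive_plus (f g : C -> C) (z df dg : C) :
  is_C_derive f z df -> is_C_derive g z dg ->
  is_C_derive (fun w => f w + g w) z (df + dg).
Proof. exact: is_derive_plus. Qed.

Lemma is_C_derive_opp (f : C -> C) (z df : C) :
  is_C_derive f z df -> is_C_derive (fun w => - f w) z (- df).
Proof. exact: is_derive_opp. Qed.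

Lemma is_C_derive_minus (f g : C -> C) (z df dg : C) :
  is_C_derive f z df -> is_C_derive g z dg ->
  is_C_derive (fun w => f w - g w) z (df - dg).
Proof. exact: is_derive_minus. Qed.

Lemma is_C_derive_mult (f g : C -> C) (z df dg : C) :
  is_C_derive f z df -> is_C_derive g z dg ->
  is_C_derive (fun w => f w * g w) z (df * g z + f z * dg).
Proof.
move/is_C_derive_ring => Hf /is_C_derive_ring Hg; apply/is_C_derive_ring.
exact: (is_derive_mult _ _ _ _ _ Hf Hg Cmult_comm).
Qed.

Lemma is_C_derive_scal (f : C -> C) (c z df : C) :
  is_C_derive f z df -> is_C_derive (fun w => c * f w) z (c * df).
Proof.
move=> H; apply: is_C_derive_eq.
  exact: is_C_derive_mult (is_C_derive_const _ _) H.
rewrite /=; ring.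
Qed.

Lemma is_C_derive_comp (f g : C -> C) (z df dg : C) :
  is_C_derive f (g z) df -> is_C_derive g z dg ->
  is_C_derive (fun w => f (g w)) z (df * dg).
Proof.
move=> Hf /is_C_derive_ring Hg; apply: is_C_derive_eq.
  exact: (is_derive_comp f g z _ _ Hf Hg).
exact: Cmult_comm.
Qed.

Lemma is_C_derive_continuous (f : C -> C) (z l : C) :
  is_C_derive f z l ->
  forall eps, (0 < eps)%R -> exists d, (0 < d)%R /\
    forall w, (Cmod (w - z) < d)%R -> (Cmod (f w - f z)%C < eps)%R.
Proof.
move/is_C_derive_eps => H eps He.
have Hl := Cmod_ge_0 l.
case: (H 1%R Rlt_0_1) => d [Hd H1].
have Hq : (0 < eps / (2 + Cmod l))%R by apply: Rdiv_lt_0_compat; lra.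
exists (Rmin d (eps / (2 + Cmod l))); split.
  exact: Rmin_pos.
move=> w Hw.
have Hw1 : (Cmod (w - z)%C < d)%R by apply: Rlt_le_trans Hw (Rmin_l _ _).
have Hw2 : (Cmod (w - z)%C < eps / (2 + Cmod l))%R by apply: Rlt_le_trans Hw (Rmin_r _ _).
have -> : f w - f z = (f w - f z - (w - z) * l) + (w - z) * l by ring.
apply: Rle_lt_trans (Cmod_triangle _ _) _.
rewrite Cmod_mult.
have := H1 w Hw1.
have Hc : (Cmod (w - z)%C * (2 + Cmod l) < eps)%R.
  apply: (Rmult_lt_reg_r (/ (2 + Cmod l))); first by apply: Rinv_0_lt_compat; lra.
  rewrite Rmult_assoc Rinv_r; lra.
have := Cmod_ge_0 (w - z); nra.
Qed.

(** * The complex exponential *)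

Lemma RtoC_neq_0 (x : R) : x <> 0%R -> RtoC x <> 0.
Proof. by move=> H /RtoC_inj. Qed.

Lemma C_eq (z w : C) : Re z = Re w -> Im z = Im w -> z = w.
Proof. by case: z => a b; case: w => c d /= -> ->. Qed.

Lemma Copp_involutive (z : C) : - - z = z.
Proof. ring. Qed.

Lemma Cexp_plus (z w : C) : Cexp (z + w) = Cexp z * Cexp w.
Proof.
case: z => a b; case: w => c d; rewrite /Cexp /Cmult /=.
rewrite exp_plus cos_plus sin_plus; f_equal; ring.
Qed.

Lemma Cexp_R (r : R) : Cexp (RtoC r) = RtoC (exp r).
Proof. by rewrite /Cexp /= cos_0 sin_0 /RtoC; f_equal; ring. Qed.

Lemma Cexp_0 : Cexp 0 = 1.
Proof. by rewrite Cexp_R exp_0. Qed.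

Lemma Cmod_Cexp (z : C) : Cmod (Cexp z) = exp (Re z).
Proof.
rewrite /Cmod /Cexp /=.
have -> : ((exp (Re z) * cos (Im z)) * ((exp (Re z) * cos (Im z)) * 1) +
   (exp (Re z) * sin (Im z)) * ((exp (Re z) * sin (Im z)) * 1)
   = (exp (Re z))²)%R.
  have := sin2_cos2 (Im z); rewrite /Rsqr => H.
  transitivity ((exp (Re z) * exp (Re z)) *
    (sin (Im z) * sin (Im z) + cos (Im z) * cos (Im z)))%R; first by ring.
  rewrite H; ring.
apply: sqrt_Rsqr; left; exact: exp_pos.
Qed.

Lemma Cexp_neq_0 (z : C) : Cexp z <> 0.
Proof. apply/Cmod_gt_0; rewrite Cmod_Cexp; exact: exp_pos. Qed.

Lemma Cexp_opp (z : C) : Cexp (- z) = / Cexp z.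
Proof.
have H : Cexp (- z) * Cexp z = 1.
  by rewrite -Cexp_plus -Cexp_0; f_equal; ring.
have Hz := Cexp_neq_0 z.
transitivity (Cexp (- z) * Cexp z * / Cexp z); first by field.
rewrite H; ring.
Qed.

Lemma Cexp_pow (z : C) (n : nat) : Cexp z ^ n = Cexp (INR n * z).
Proof.
elim: n => [|n IH].
  by rewrite /= -Cexp_0; f_equal; ring.
rewrite Cpow_S IH -Cexp_plus S_INR RtoC_plus; f_equal; ring.
Qed.

Lemma Cexp_PI : Cexp (Ci * PI) = - (1).
Proof.
have -> : Ci * PI = ((0%R, PI) : C) by apply: C_eq => /=; ring.
by rewrite /Cexp /= exp_0 cos_PI sin_PI; apply: C_eq => /=; ring.
Qed.

Lemma Cexp_2PI : Cexp (2 * Ci * PI) = 1.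
Proof.
have -> : 2 * Ci * PI = Ci * PI + Ci * PI by ring.
rewrite Cexp_plus Cexp_PI; ring.
Qed.

Lemma im_le_Cmod (z : C) : (Rabs (Im z) <= Cmod z)%R.
Proof. exact: Rle_trans (Rmax_r _ _) (Rmax_Cmod z). Qed.

Lemma Cmod_le_sum (z : C) : (Cmod z <= Rabs (Re z) + Rabs (Im z))%R.
Proof.
case: z => a b /=.
have -> : ((a, b) : C) = RtoC a + Ci * RtoC b by apply: C_eq => /=; ring.
apply: Rle_trans (Cmod_triangle _ _) _.
rewrite Cmod_mult Cmod_Ci !Cmod_R; lra.
Qed.

Lemma exp_ge_1 (x : R) : (0 <= x)%R -> (1 <= exp x)%R.
Proof. by move=> H; have := exp_ineq1_le x; lra. Qed.

Lemma exp_taylor0 (x : R) : (Rabs (exp x - 1) <= Rabs x * exp (Rabs x))%R.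
Proof.
have H1 := exp_ineq1_le x; have H2 := exp_ineq1_le (- x).
have Hx := exp_pos x.
have H3 : (exp x * exp (- x) = 1)%R by rewrite -exp_plus Rplus_opp_r exp_0.
case: (Rle_dec 0 x) => Hs.
- rewrite !Rabs_pos_eq; nra.
- have Hi : (exp x <= 1)%R by rewrite -exp_0; left; apply: exp_increasing; lra.
  rewrite (Rabs_left1 x); last lra.
  rewrite Rabs_left1; last lra.
  have := exp_ge_1 (- x); nra.
Qed.

Lemma exp_taylor1 (x : R) :
  (0 <= exp x - 1 - x <= x * x * exp (Rabs x))%R.
Proof.
have H1 := exp_ineq1_le x; have H2 := exp_ineq1_le (- x).
have Hx := exp_pos x.
have H3 : (exp x * exp (- x) = 1)%R by rewrite -exp_plus Rplus_opp_r exp_0.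
have H4 : (exp x - 1 - x <= x * (exp x - 1))%R by nra.
split; first lra.
apply: Rle_trans H4 _; apply: Rle_trans (Rle_abs _) _.
rewrite Rabs_mult.
have := exp_taylor0 x; have := Rabs_pos x => Hp H0.
have -> : (x * x = Rabs x * Rabs x)%R by rewrite -Rabs_mult Rabs_pos_eq; nra.
nra.
Qed.

Lemma sin_abs_le (y : R) : (Rabs (sin y) <= Rabs y)%R.
Proof.
suff H : forall x, (0 <= x)%R -> (Rabs (sin x) <= x)%R.
  case: (Rle_dec 0 y) => Hy; first by rewrite (Rabs_pos_eq y); [apply: H|].
  rewrite (Rabs_left1 y); last lra.
  rewrite -Rabs_Ropp -sin_neg; apply: H; lra.
move=> x Hx; case: (MVT_abs sin cos 0 x) => [c _|c [Hc _]].
  exact: derivable_pt_lim_sin.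
move: Hc; rewrite sin_0 !Rminus_0_r (Rabs_pos_eq x) // => ->.
have : (Rabs (cos c) <= 1)%R by apply: Rabs_le; exact: COS_bound.
nra.
Qed.

Lemma cos_half (y : R) : (1 - cos y = 2 * (sin (y / 2) * sin (y / 2)))%R.
Proof.
have {1}-> : (y = 2 * (y / 2))%R by field.
rewrite cos_2a_sin; ring.
Qed.

Lemma cos_taylor1 (y : R) : (Rabs (cos y - 1) <= y * y / 2)%R.
Proof.
rewrite Rabs_minus_sym cos_half.
have H := sin_abs_le (y / 2); have Hp := Rabs_pos (sin (y / 2)).
rewrite Rabs_mult Rabs_mult (Rabs_pos_eq 2); last lra.
have -> : (y * y / 2 = 2 * (Rabs (y / 2) * Rabs (y / 2)))%R.
  rewrite -Rabs_mult Rabs_pos_eq; nra.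
nra.
Qed.

Lemma sin_taylor1 (y : R) : (Rabs (sin y - y) <= y * y)%R.
Proof.
have Hd : forall c, derivable_pt_lim (fun x => sin x - x)%R c (cos c - 1)%R.
  move=> c; apply: derivable_pt_lim_minus.
    exact: derivable_pt_lim_sin.
  exact: derivable_pt_lim_id.
case: (MVT_abs (fun x => sin x - x)%R (fun x => cos x - 1)%R 0 y) => [c _|c [Hc Hb]].
  exact: Hd.
move: Hc; rewrite sin_0 !Rminus_0_r => ->.
have H1 : (Rabs (cos c - 1) <= Rabs y)%R.
  rewrite Rabs_minus_sym cos_half.
  rewrite Rabs_mult Rabs_mult (Rabs_pos_eq 2); last lra.
  have H := sin_abs_le (c / 2); have Hp := Rabs_pos (sin (c / 2)).
  have H2 : (Rabs (sin (c / 2)) <= 1)%R by apply: Rabs_le; exact: SIN_bound.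
  have H3 : (2 * Rabs (c / 2) <= Rabs y)%R.
    rewrite Rabs_div; last lra.
    rewrite (Rabs_pos_eq 2); last lra.
    have : (Rabs c <= Rabs y)%R.
      move: Hb; rewrite /Rmin /Rmax /Rabs.
      by case: Rle_dec => ? [? ?]; case: Rcase_abs => ?; case: Rcase_abs => ?; lra.
    lra.
  nra.
have -> : (y * y = Rabs y * Rabs y)%R by rewrite -Rabs_mult Rabs_pos_eq; nra.
have := Rabs_pos y; nra.
Qed.

Lemma Cexp_taylor1 (z : C) :
  (Cmod (Cexp z - 1 - z)%C <= 2 * (Cmod z * Cmod z) * exp (Cmod z))%R.
Proof.
have Hre := re_le_Cmod z.
have HE : (exp (Rabs (Re z)) <= exp (Cmod z))%R.
  case: Hre => [H| ->]; [left; exact: exp_increasing | by right].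
have Hsq : (Cmod z * Cmod z = Re z * Re z + Im z * Im z)%R.
  have := Cmod2_alt z; nra.
case: z Hre HE Hsq => x y /=; set n := Cmod _ => Hre HE Hsq.
apply: Rle_trans (Cmod_le_sum _) _.
rewrite /Cexp /=.
have Hx1 := exp_taylor1 x; have Hx0 := exp_taylor0 x.
have Hs := sin_taylor1 y; have Hc := cos_taylor1 y.
have HEx : (exp x <= exp (Rabs x))%R.
  have := Rle_abs x; case=> [H| {1}->]; [left; exact: exp_increasing | by right].
have Hxp := exp_pos x.
set E := exp (Rabs x) in Hx1 Hx0 HEx HE *.
have -> : (exp x * cos y + - (1) + - x = (exp x - 1 - x) + exp x * (cos y - 1))%R by ring.
have -> : (exp x * sin y + - 0 + - y = (exp x - 1) * y + exp x * (sin y - y))%R by ring.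
have B1 : (Rabs (exp x - 1 - x + exp x * (cos y - 1)) <= x * x * E + E * (y * y / 2))%R.
  apply: Rle_trans (Rabs_triang _ _) _.
  rewrite Rabs_mult (Rabs_pos_eq (exp x)); last lra.
  rewrite (Rabs_pos_eq (exp x - 1 - x)); last lra.
  have := Rabs_pos (cos y - 1); nra.
have B2 : (Rabs ((exp x - 1) * y + exp x * (sin y - y)) <= Rabs x * E * Rabs y + E * (y * y))%R.
  apply: Rle_trans (Rabs_triang _ _) _.
  rewrite !Rabs_mult (Rabs_pos_eq (exp x)); last lra.
  have := Rabs_pos (sin y - y); have := Rabs_pos y; nra.
have HxE : (0 < E)%R by exact: exp_pos.
have Hxy : (Rabs x * Rabs y <= (x * x + y * y) / 2)%R.
  have -> : (x * x = Rabs x * Rabs x)%R by rewrite -Rabs_mult Rabs_pos_eq; nra.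
  have -> : (y * y = Rabs y * Rabs y)%R by rewrite -Rabs_mult Rabs_pos_eq; nra.
  have := pow2_ge_0 (Rabs x - Rabs y); nra.
apply: Rle_trans (Rplus_le_compat _ _ _ _ B1 B2) _.
rewrite Hsq.
apply: (Rle_trans _ (2 * (x * x + y * y) * E)); nra.
Qed.

Lemma is_C_derive_Cexp (z : C) : is_C_derive Cexp z (Cexp z).
Proof.
apply/is_C_derive_eps => eps He.
have HM : (0 < Cmod (Cexp z))%R by rewrite Cmod_Cexp; exact: exp_pos.
set M := Cmod (Cexp z) in HM.
set k := (2 * exp 1 * M)%R.
have Hk : (0 < k)%R by rewrite /k; have := exp_pos 1; nra.
exists (Rmin 1 (eps / k)); split.
  apply: Rmin_pos; first lra.
  exact: Rdiv_lt_0_compat.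
move=> w Hw.
have H1 : (Cmod (w - z)%C < 1)%R by apply: Rlt_le_trans Hw (Rmin_l _ _).
have H2 : (Cmod (w - z)%C < eps / k)%R by apply: Rlt_le_trans Hw (Rmin_r _ _).
have -> : Cexp w - Cexp z - (w - z) * Cexp z = Cexp z * (Cexp (w - z) - 1 - (w - z)).
  have {1}-> : w = z + (w - z) by ring.
  rewrite Cexp_plus; ring.
rewrite Cmod_mult -/M.
have HT := Cexp_taylor1 (w - z).
set n := Cmod (w - z) in H1 H2 HT *.
have Hn : (0 <= n)%R by exact: Cmod_ge_0.
have HE : (exp n <= exp 1)%R by left; exact: exp_increasing.
have Hkn : (k * n <= eps)%R.
  apply: (Rmult_le_reg_r (/ k)); first exact: Rinv_0_lt_compat.
  have -> : (k * n * / k = n)%R by field; lra.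
  lra.
apply: (Rle_trans _ (k * n * n)); last nra.
rewrite /k.
apply: (Rle_trans _ (M * (2 * (n * n) * exp 1))); last by right; ring.
apply: Rmult_le_compat_l; first lra.
apply: Rle_trans HT _; apply: Rmult_le_compat_l; last lra.
nra.
Qed.

(** * Paths in the complex plane *)

Definition path_derive (g : R -> C) (r : R) (l : C) : Prop :=
  @is_derive R_AbsRing C_R_NormedModule g r l.

Lemma path_derive_eps (g : R -> C) (r : R) (l : C) :
  path_derive g r l <->
  forall eps, (0 < eps)%R -> exists d, (0 < d)%R /\
    forall q, (Rabs (q - r) < d)%R ->
      (Cmod (g q - g r - (q - r)%R * l)%C <= eps * Rabs (q - r))%R.
Proof.
have HS : forall q, minus (minus (g q) (g r)) (scal (minus q r : R_AbsRing) (l : C_R_NormedModule))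
    = g q - g r - (q - r)%R * l.
  move=> q; apply: C_eq; rewrite /= /scal /= /mult /= /minus /plus /opp /=; ring.
split.
- move=> [_ H] eps He; case: (H r (fun P HP => HP) (mkposreal eps He)) => d Hd.
  exists d; split; first exact: cond_pos.
  by move=> q Hq; rewrite -HS Cmod_norm; exact: (Hd q Hq).
- move=> H; split; first exact: is_linear_scal_l.
  move=> x Hx.
  apply (is_filter_lim_locally_unique (V := R_NormedModule)) in Hx.
  subst x; case=> eps He.
  case: (H eps He) => d [Hd H1]; exists (mkposreal d Hd) => q Hq.
  by have := H1 q Hq; rewrite -HS Cmod_norm.
Qed.

Lemma path_derive_comp (f : C -> C) (g : R -> C) (r : R) (df dg : C) :
  is_C_derive f (g r) df -> path_derive g r dg ->
  path_derive (fun q => f (g q)) r (df * dg).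
Proof.
move=> /is_C_derive_eps Hf /path_derive_eps Hg; apply/path_derive_eps => eps He.
have Hdf := Cmod_ge_0 df; have Hdg := Cmod_ge_0 dg.
(* the error is that of f along the increment of g, which is at most
   (|dg| + 1) |q - r|, plus |df| times the error of g *)
set e1 := (eps / (2 * (Cmod dg + 1)))%R.
set e2 := Rmin 1 (eps / (2 * (Cmod df + 1)))%R.
have He1 : (0 < e1)%R by apply: Rdiv_lt_0_compat; lra.
have He2 : (0 < e2)%R by apply: Rmin_pos; [lra | apply: Rdiv_lt_0_compat; lra].
case: (Hf e1 He1) => d1 [Hd1 H1]; case: (Hg e2 He2) => d2 [Hd2 H2].
have Hq0 : (0 < d1 / (Cmod dg + 1))%R by apply: Rdiv_lt_0_compat; lra.
exists (Rmin d2 (d1 / (Cmod dg + 1))); split; first exact: Rmin_pos.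
move=> q Hq.
have Hqa : (Rabs (q - r) < d2)%R by apply: Rlt_le_trans Hq (Rmin_l _ _).
have Hqb : (Rabs (q - r) < d1 / (Cmod dg + 1))%R by apply: Rlt_le_trans Hq (Rmin_r _ _).
have G := H2 q Hqa.
have Hn := Rabs_pos (q - r).
have He21 : (e2 <= 1)%R by exact: Rmin_l.
have He22 : (e2 * (2 * (Cmod df + 1)) <= eps)%R.
  apply: (Rmult_le_reg_r (/ (2 * (Cmod df + 1)))).
    by apply: Rinv_0_lt_compat; lra.
  rewrite Rmult_assoc Rinv_r; last lra.
  rewrite Rmult_1_r; exact: Rmin_r.
have Hinc : (Cmod (g q - g r)%C <= (Cmod dg + 1) * Rabs (q - r))%R.
  have -> : g q - g r = (g q - g r - (q - r)%R * dg) + (q - r)%R * dg by ring.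
  apply: Rle_trans (Cmod_triangle _ _) _.
  rewrite Cmod_mult Cmod_R; nra.
have Hinc2 : (Cmod (g q - g r)%C < d1)%R.
  apply: Rle_lt_trans Hinc _.
  apply: (Rmult_lt_reg_r (/ (Cmod dg + 1))); first by apply: Rinv_0_lt_compat; lra.
  have -> : ((Cmod dg + 1) * Rabs (q - r) * / (Cmod dg + 1) = Rabs (q - r))%R by field; lra.
  exact: Hqb.
have F := H1 _ Hinc2.
have -> : f (g q) - f (g r) - (q - r)%R * (df * dg) =
  (f (g q) - f (g r) - (g q - g r) * df) + (g q - g r - (q - r)%R * dg) * df by ring.
apply: Rle_trans (Cmod_triangle _ _) _.
rewrite (Cmod_mult _ df).
have He1' : (e1 * (Cmod dg + 1) = eps / 2)%R by rewrite /e1; field; lra.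
have F2 : (Cmod (f (g q) - f (g r) - (g q - g r) * df)%C <= eps / 2 * Rabs (q - r))%R.
  apply: Rle_trans F _; rewrite -He1' Rmult_assoc.
  by apply: Rmult_le_compat_l => //; lra.
have G2 : (Cmod (g q - g r - (q - r)%R * dg)%C * Cmod df <= e2 * Rabs (q - r) * Cmod df)%R.
  exact: Rmult_le_compat_r.
nra.
Qed.

Lemma path_derive_eq (g : R -> C) (r : R) (l l' : C) :
  path_derive g r l -> l = l' -> path_derive g r l'.
Proof. by move=> H <-. Qed.

Lemma path_derive_ext (f g : R -> C) (r : R) (l : C) :
  (forall q, f q = g q) -> path_derive f r l -> path_derive g r l.
Proof. move=> H; exact: is_derive_ext. Qed.

Lemma path_derive_minus (f g : R -> C) (r : R) (df dg : C) :
  path_derive f r df -> path_derive g r dg ->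
  path_derive (fun q => f q - g q) r (df - dg).
Proof. move=> H H'; exact: (is_derive_minus (V := C_R_NormedModule) f g r df dg H H'). Qed.

Lemma path_derive_RtoC (g : R -> R) (r l : R) :
  is_derive g r l -> path_derive (fun q => RtoC (g q)) r (RtoC l).
Proof.
move=> [_ H]; apply/path_derive_eps => eps He.
case: (H r (fun P HP => HP) (mkposreal eps He)) => d Hd.
exists d; split; first exact: cond_pos.
move=> q Hq; have := Hd q Hq.
rewrite -!RtoC_minus -RtoC_mult -RtoC_minus Cmod_R; exact.
Qed.

Lemma path_derive_line (a b : C) (r : R) : path_derive (fun q => a + RtoC q * b) r b.
Proof.
apply/path_derive_eps => eps He; exists 1%R; split; first lra.
move=> q _.
have -> : a + q * b - (a + r * b) - (q - r)%R * b = 0 by rewrite RtoC_minus; ring.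
rewrite Cmod_0; have := Rabs_pos (q - r); nra.
Qed.

(** The real mean value theorem, applied to each coordinate. *)
Lemma path_derive_zero (g : R -> C) (a b : R) :
  (forall r, (Rmin a b <= r <= Rmax a b)%R -> path_derive g r 0) -> g a = g b.
Proof.
move=> H.
have Hr : forall r, (Rmin a b <= r <= Rmax a b)%R -> is_derive (fun q => Re (g q)) r 0%R
                              /\ is_derive (fun q => Im (g q)) r 0%R.
  move=> r /H/path_derive_eps Hr.
  split; (split; [exact: is_linear_scal_l | ]) => x Hx;
  apply (is_filter_lim_locally_unique (V := R_NormedModule)) in Hx; subst x;
  case=> eps He; case: (Hr eps He) => d [Hd Hd']; exists (mkposreal d Hd) => q Hq;
  apply: Rle_trans (Hd' q Hq);
  have -> : g q - g r - (q - r)%R * 0 = g q - g r by ring.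
  - apply: Rle_trans (re_le_Cmod _); right.
    rewrite /norm /= /abs /=; congr Rabs.
    rewrite /minus /plus /opp /scal /= /mult /= /Re; ring.
  - apply: Rle_trans (im_le_Cmod _); right.
    rewrite /norm /= /abs /=; congr Rabs.
    rewrite /minus /plus /opp /scal /= /mult /= /Im; ring.
case: (MVT_gen (fun q => Re (g q)) a b (fun _ => 0%R)) => [x Hx|x Hx|x [_ Hx]].
- by apply Hr; lra.
- apply/continuity_pt_filterlim; apply: (ex_derive_continuous (fun q => Re (g q))).
  by exists 0%R; apply Hr.
case: (MVT_gen (fun q => Im (g q)) a b (fun _ => 0%R)) => [y Hy|y Hy|y [_ Hy]].
- by apply Hr; lra.
- apply/continuity_pt_filterlim; apply: (ex_derive_continuous (fun q => Im (g q))).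
  by exists 0%R; apply Hr.
apply: C_eq; lra.
Qed.

Lemma is_C_derive_path (f : C -> C) (r : R) (l : C) :
  is_C_derive f (RtoC r) l -> path_derive (fun q => f (RtoC q)) r l.
Proof.
move=> H; apply: path_derive_eq.
  apply: (path_derive_comp f RtoC r l 1 H).
  apply: (path_derive_RtoC (fun q => q)); exact: is_derive_id.
ring.
Qed.

Lemma is_C_derive_zero (f : C -> C) (a b : C) :
  (forall z, is_C_derive f z 0) -> f a = f b.
Proof.
move=> H.
have := path_derive_zero (fun q => f (a + RtoC q * (b - a))) 0 1.
have -> : a + RtoC 0 * (b - a) = a by ring.
have -> : a + RtoC 1 * (b - a) = b by ring.
apply=> r _; apply: path_derive_eq.
  apply: path_derive_comp; [exact: H | exact: path_derive_line].
ring.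
Qed.

(** * Complex power series *)

Notation Cseries := (@is_series C_AbsRing C_NormedModule).

Lemma Cseries_eps (f : nat -> C) (l : C) :
  Cseries f l <-> forall eps, (0 < eps)%R -> exists N, forall n, (N <= n)%nat ->
    (Cmod (@sum_n C_AbelianMonoid f n - l)%C < eps)%R.
Proof.
split.
- move=> H eps He.
  have := proj1 (filterlim_locally_ball_norm (U := C_NormedModule) _ _) H (mkposreal eps He).
  case=> N HN; exists N => n Hn; exact: (HN n Hn).
- move=> H; apply/(filterlim_locally_ball_norm (U := C_NormedModule)) => -[eps He].
  case: (H eps He) => N HN; exists N => n Hn; exact: (HN n Hn).
Qed.

Lemma Cseries_unique (f : nat -> C) (l l' : C) : Cseries f l -> Cseries f l' -> l = l'.
Proof.
move=> H H'; exact: (@filterlim_locally_unique _ _ C_NormedModule _ _ (sum_n f) l l' H H').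
Qed.

Lemma Cseries_ext (f g : nat -> C) (l : C) :
  (forall k, f k = g k) -> Cseries f l -> Cseries g l.
Proof. exact: (is_series_ext (V := C_NormedModule)). Qed.

Lemma Cseries_plus (f g : nat -> C) (l l' : C) :
  Cseries f l -> Cseries g l' -> Cseries (fun k => f k + g k) (l + l').
Proof. exact: (is_series_plus (V := C_NormedModule)). Qed.

Lemma Cseries_scal (c : C) (f : nat -> C) (l : C) :
  Cseries f l -> Cseries (fun k => c * f k) (c * l).
Proof. exact: (is_series_scal (V := C_NormedModule)). Qed.

Lemma Cseries_minus (f g : nat -> C) (l l' : C) :
  Cseries f l -> Cseries g l' -> Cseries (fun k => f k - g k) (l - l').
Proof. exact: (is_series_minus (V := C_NormedModule)). Qed.

Lemma Cseries_decr (f : nat -> C) (l : C) :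
  Cseries (fun k => f (S k)) l -> Cseries f (f 0%nat + l).
Proof.
move=> H; apply: (is_series_decr_1 (V := C_NormedModule)).
rewrite /plus /opp /=; have -> : f 0%nat + l + - f 0%nat = l by ring.
exact: H.
Qed.

Lemma Cseries_incr (f : nat -> C) (l : C) :
  Cseries f l -> Cseries (fun k => f (S k)) (l - f 0%nat).
Proof.
move=> H; apply: (is_series_incr_1 (V := C_NormedModule)).
rewrite /plus /=; have -> : l - f 0%nat + f 0%nat = l by ring.
exact: H.
Qed.

Lemma Cseries_norm_le (f : nat -> C) (b : nat -> R) (l : C) (L : R) :
  Cseries f l -> is_series b L -> (forall k, (Cmod (f k) <= b k)%R) -> (Cmod l <= L)%R.
Proof.
move=> /Cseries_eps Hf Hb Hle.
have Hfb : forall n, (Cmod (@sum_n C_AbelianMonoid f n) <= sum_n b n)%R.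
  elim=> [|n IH]; first by rewrite !sum_O; exact: Hle.
  rewrite !sum_Sn; apply: Rle_trans (Cmod_triangle _ _) _.
  apply: Rplus_le_compat => //; exact: Hle.
have Hb0 : forall k, (0 <= b k)%R.
  move=> k; apply: Rle_trans (Hle k); exact: Cmod_ge_0.
have Hbn : forall n, (sum_n b n <= L)%R.
  move=> n; apply: (is_lim_seq_incr_compare (sum_n b) L Hb) => k.
  rewrite sum_Sn /plus /=; have := Hb0 (S k); lra.
apply: le_epsilon => eps He.
case: (Hf eps He) => N HN.
have := HN N (Nat.le_refl N); have := Hfb N; have := Hbn N.
set s := @sum_n C_AbelianMonoid f N => H1 H2 H3.
have -> : l = s - (s - l) by ring.
apply: Rle_trans (Cmod_triangle _ _) _; rewrite Cmod_opp; lra.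
Qed.

(** ** Entire series with factorially small coefficients *)

Definition entire_coef (a : nat -> C) : Prop :=
  exists M, forall k, (Cmod (a k) <= M / INR (fact k))%R.

Definition Cpow_series (a : nat -> C) (y : C) : C :=
  (Series (fun k => Re (a k * y ^ k)%C), Series (fun k => Im (a k * y ^ k)%C)).

Lemma exp_series (x : R) : is_series (fun k => / INR (fact k) * x ^ k)%R (exp x).
Proof.
apply: is_series_ext (is_exp_Reals x) => k.
rewrite pow_n_pow /scal /= /mult /=; ring.
Qed.

Lemma sum_n_pair (f : nat -> C) (n : nat) :
  @sum_n C_AbelianMonoid f n = ((sum_n (fun k => Re (f k)) n, sum_n (fun k => Im (f k)) n) : C).
Proof.
elim: n => [|n IH].
  by rewrite !sum_O; case: (f 0%nat).
rewrite !sum_Sn IH; by apply: C_eq.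
Qed.

Lemma Cpow_series_is (a : nat -> C) (y : C) :
  entire_coef a -> Cseries (fun k => a k * y ^ k) (Cpow_series a y).
Proof.
move=> [M HM].
have Hb : ex_series (fun k => M * (/ INR (fact k) * Cmod y ^ k))%R.
  apply: (ex_series_scal M); exists (exp (Cmod y)); exact: exp_series.
have Hk : forall k, (Cmod (a k * y ^ k)%C <= M * (/ INR (fact k) * Cmod y ^ k))%R.
  move=> k; rewrite Cmod_mult Cmod_pow -Rmult_assoc.
  apply: Rmult_le_compat_r; [exact: pow_le (Cmod_ge_0 _) | exact: HM].
have Hre : is_series (fun k => Re (a k * y ^ k)%C) (Series (fun k => Re (a k * y ^ k)%C)).
  apply: Series_correct; apply: ex_series_le Hb => k.
  apply: Rle_trans (Hk k); exact: re_le_Cmod.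
have Him : is_series (fun k => Im (a k * y ^ k)%C) (Series (fun k => Im (a k * y ^ k)%C)).
  apply: Series_correct; apply: ex_series_le Hb => k.
  apply: Rle_trans (Hk k); exact: im_le_Cmod.
apply/Cseries_eps => eps He.
have He2 : (0 < eps / 2)%R by lra.
case: (proj1 (filterlim_locally (U := R_UniformSpace) _ _) Hre (mkposreal _ He2)) => N1 H1.
case: (proj1 (filterlim_locally (U := R_UniformSpace) _ _) Him (mkposreal _ He2)) => N2 H2.
exists (N1 + N2)%nat => n Hn.
apply: Rle_lt_trans (Cmod_le_sum _) _.
rewrite sum_n_pair.
have -> : eps = (eps / 2 + eps / 2)%R by field.
apply: Rplus_lt_compat; [apply: (H1 n) | apply: (H2 n)]; lia.
Qed.

(** The coefficient [k (k - 1)] is that of the second derivative, so that after division by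
    [k!] these bounds sum to an exponential. *)
Lemma pow_increment (y w : C) (rho : R) (n : nat) :
  (Cmod y <= rho)%R -> (Cmod w <= rho)%R ->
  (Cmod (w ^ S (S n) - y ^ S (S n) - (w - y) * (INR (S (S n)) * y ^ S n))%C
   <= Cmod (w - y) ^ 2 * (INR (S (S n)) * INR (S n) * rho ^ n))%R.
Proof.
move=> Hy Hw.
have Hr : (0 <= rho)%R by apply: Rle_trans Hy; exact: Cmod_ge_0.
elim: n => [|n IH].
  have -> : w ^ 2 - y ^ 2 - (w - y) * (INR 2 * y ^ 1) = (w - y) ^ 2.
    rewrite /= RtoC_plus; ring.
  rewrite Cmod_pow /=; have := pow2_ge_0 (Cmod (w - y)); rewrite /=; lra.
have -> : w ^ S (S (S n)) - y ^ S (S (S n)) - (w - y) * (INR (S (S (S n))) * y ^ S (S n)) =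
  w * (w ^ S (S n) - y ^ S (S n) - (w - y) * (INR (S (S n)) * y ^ S n))
  + (w - y) ^ 2 * (INR (S (S n)) * y ^ S n).
  rewrite !(S_INR (S (S n))) !RtoC_plus !Cpow_S; ring.
apply: Rle_trans (Cmod_triangle _ _) _.
rewrite (Cmod_mult w) (Cmod_mult ((w - y) ^ 2)) (Cmod_mult (INR _)) !Cmod_pow (Cmod_R (INR _)).
have HI : (0 <= INR (S (S n)))%R by exact: pos_INR.
rewrite (Rabs_pos_eq (INR _)) //.
set h := (Cmod (w - y) ^ 2)%R.
have Hh : (0 <= h)%R by exact: pow2_ge_0.
have Hrn : (0 <= rho ^ n)%R by exact: pow_le.
have B1 : (Cmod w * Cmod (w ^ S (S n) - y ^ S (S n) - (w - y) * (INR (S (S n)) * y ^ S n))%C <=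
   rho * (h * (INR (S (S n)) * INR (S n) * rho ^ n)))%R.
  by apply: Rmult_le_compat => //; exact: Cmod_ge_0.
have B2 : (Cmod y ^ S n <= rho ^ S n)%R.
  by apply: pow_incr; split => //; exact: Cmod_ge_0.
apply: Rle_trans (Rplus_le_compat _ _ _ _ B1 _) _.
  apply: Rmult_le_compat_l; first exact: Hh.
  apply: Rmult_le_compat_l; [exact: HI | exact: B2].
rewrite -/(pow rho (S n)) !(S_INR (S (S n))) !(S_INR (S n)) [pow rho (S n)]/= in HI *.
set q := (h * (rho * rho ^ n))%R.
have Hq : (0 <= q)%R by rewrite /q; apply: Rmult_le_pos => //; exact: Rmult_le_pos.
have Hnn := pos_INR n; rewrite S_INR.
apply: (Rle_trans _ (q * ((INR n + 1 + 1) * (INR n + 1 + 1)))); first by rewrite /q; right; ring.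
apply: (Rle_trans _ (q * ((INR n + 1 + 1 + 1) * (INR n + 1 + 1)))); last by rewrite /q; right; ring.
apply: Rmult_le_compat_l => //; nra.
Qed.

Lemma is_series_decr_0 (f : nat -> R) (l : R) :
  f 0%nat = 0%R -> is_series (fun k => f (S k)) l -> is_series f l.
Proof.
move=> H0 H; apply: is_series_decr_1.
by rewrite H0 /plus /opp /= Ropp_0 Rplus_0_r.
Qed.

Lemma entire_coef_deriv (a : nat -> C) :
  entire_coef a -> entire_coef (fun k => INR (S k) * a (S k)).
Proof.
move=> [M HM]; exists M => k.
rewrite Cmod_mult Cmod_R Rabs_pos_eq; last exact: pos_INR.
have HS : (0 < INR (S k))%R by apply: lt_0_INR; lia.
have Hf : (0 < INR (fact k))%R by exact: INR_fact_lt_0.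
have := HM (S k); rewrite fact_simpl mult_INR => H.
apply: Rle_trans (Rmult_le_compat_l _ _ _ (Rlt_le _ _ HS) H) _.
right; field; lra.
Qed.

(** The second-order remainders of the terms add up to at most [M * |w - y|^2 * exp rho]. *)
Lemma is_C_derive_Cpow_series (a : nat -> C) (y : C) :
  entire_coef a ->
  is_C_derive (Cpow_series a) y (Cpow_series (fun k => INR (S k) * a (S k)) y).
Proof.
move=> Ha; apply/is_C_derive_eps => eps He.
case: (Ha) => M HM.
have HM0 : (0 <= M)%R.
  have := HM 0%nat; rewrite /= Rdiv_1_r; have := Cmod_ge_0 (a 0%nat); lra.
set rho := (Cmod y + 1)%R.
have Hy := Cmod_ge_0 y.
set B := (M * exp rho)%R.
have HB : (0 <= B)%R by apply: Rmult_le_pos => //; left; exact: exp_pos.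
exists (Rmin 1 (eps / (B + 1))); split.
  apply: Rmin_pos; [lra | apply: Rdiv_lt_0_compat; lra].
move=> w Hw.
have H1 : (Cmod (w - y)%C < 1)%R by apply: Rlt_le_trans Hw (Rmin_l _ _).
have H2 : (Cmod (w - y)%C < eps / (B + 1))%R by apply: Rlt_le_trans Hw (Rmin_r _ _).
have Hh := Cmod_ge_0 (w - y).
have Hwr : (Cmod w <= rho)%R.
  have -> : w = (w - y) + y by ring.
  apply: Rle_trans (Cmod_triangle _ _) _; rewrite /rho; lra.
have Hyr : (Cmod y <= rho)%R by rewrite /rho; lra.
set D := Cpow_series (fun k => INR (S k) * a (S k)) y.
have HD : Cseries (fun k => a k * (INR k * y ^ pred k)) D.
  have -> : D = a 0%nat * (INR 0 * y ^ pred 0) + D by rewrite /=; ring.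
  apply: Cseries_decr.
  apply: Cseries_ext (Cpow_series_is _ y (entire_coef_deriv a Ha)) => k.
  rewrite /=; ring.
have HS := Cseries_minus _ _ _ _ (Cseries_minus _ _ _ _ (Cpow_series_is a w Ha) (Cpow_series_is a y Ha))
   (Cseries_scal (w - y) _ _ HD).
have Hb : is_series (fun k => match k with S (S n) =>
    Cmod (w - y) ^ 2 * M * (/ INR (fact n) * rho ^ n) | _ => 0 end)%R
    (Cmod (w - y)%C ^ 2 * M * exp rho)%R.
  apply: is_series_decr_0 => //; apply: is_series_decr_0 => //.
  exact: is_series_scal (exp_series rho).
have := Cseries_norm_le _ _ _ _ HS Hb.
have Hle : (Cmod (w - y) ^ 2 * M * exp rho <= eps * Cmod (w - y))%R.
  rewrite -/B Rmult_assoc -/B.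
  have : (Cmod (w - y) * (B + 1) <= eps)%R.
    apply: (Rmult_le_reg_r (/ (B + 1))); first by apply: Rinv_0_lt_compat; lra.
    rewrite Rmult_assoc Rinv_r; lra.
  nra.
move=> H; apply: Rle_trans (H _) Hle => -[|[|n]].
- have -> : a 0%nat * w ^ 0 - a 0%nat * y ^ 0 - (w - y) * (a 0%nat * (INR 0 * y ^ pred 0)) = 0.
    by rewrite /=; ring.
  rewrite Cmod_0; lra.
- have -> : a 1%nat * w ^ 1 - a 1%nat * y ^ 1 - (w - y) * (a 1%nat * (INR 1 * y ^ pred 1)) = 0.
    by rewrite /=; ring.
  rewrite Cmod_0; lra.
- have -> : a (S (S n)) * w ^ S (S n) - a (S (S n)) * y ^ S (S n)
     - (w - y) * (a (S (S n)) * (INR (S (S n)) * y ^ pred (S (S n))))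
     = a (S (S n)) * (w ^ S (S n) - y ^ S (S n) - (w - y) * (INR (S (S n)) * y ^ S n)).
    rewrite [pred _]/=; ring.
  rewrite Cmod_mult.
  apply: Rle_trans (Rmult_le_compat _ _ _ _ (Cmod_ge_0 _) (Cmod_ge_0 _) (HM _)
    (pow_increment y w rho n Hyr Hwr)) _.
  right; rewrite !fact_simpl !mult_INR; field.
  split; first exact: INR_fact_neq_0.
  by split; apply: not_0_INR.
Qed.

Lemma Cpow_series_0 (a : nat -> C) : entire_coef a -> Cpow_series a 0 = a 0%nat.
Proof.
move=> Ha; apply: (Cseries_unique (fun k => a k * 0 ^ k)); first exact: Cpow_series_is.
have -> : a 0%nat = a 0%nat * 0 ^ 0 + 0 * Cpow_series a 0 by rewrite /=; ring.
apply: (Cseries_decr (fun k => a k * 0 ^ k)).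
apply: Cseries_ext (Cseries_scal 0 _ _ (Cpow_series_is a 0 Ha)) => k.
rewrite Cpow_S; ring.
Qed.

(** The terms at [r] are bounded, hence those at [|x| <= r / 2] are dominated by a geometric
    series of ratio at most [1 / 2]. *)
Lemma pseries_remainder (a : nat -> C) (r : R) (l0 : C) :
  (0 < r)%R -> Cseries (fun k => a k * RtoC r ^ k) l0 ->
  exists M, (0 <= M)%R /\ forall (n : nat) (x l : C), (Cmod x <= r / 2)%R ->
    Cseries (fun k => a k * x ^ k) l ->
    (forall k, (1 <= k < n)%nat -> a k = 0) -> (1 <= n)%nat ->
    (Cmod (l - a 0%nat - a n * x ^ n)%C <= M * (Cmod x / r) ^ S n)%R.
Proof.
move=> Hr H0.
have [M0 HM0] : exists M0, forall k, (Cmod (a k * RtoC r ^ k)%C <= M0)%R.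
  case: (proj1 (Cseries_eps _ _) H0 (/ 2)%R ltac:(lra)) => N HN.
  have Hfin : forall N', exists M1, forall k, (k < N')%nat -> (Cmod (a k * RtoC r ^ k)%C <= M1)%R.
    elim=> [|N' [M1 HM1]]; first by exists 0%R => k; lia.
    exists (Rmax M1 (Cmod (a N' * RtoC r ^ N')%C)) => k Hk.
    case: (Nat.eq_dec k N') => [->|Hne]; first exact: Rmax_r.
    apply: Rle_trans (Rmax_l _ _); apply: HM1; lia.
  case: (Hfin (S N)) => M1 HM1; exists (Rmax M1 1) => k.
  case: (Nat.lt_ge_cases k (S N)) => Hk; first by apply: Rle_trans (Rmax_l _ _); exact: HM1.
  apply: Rle_trans (Rmax_r _ _).
  case: k Hk => [|k] Hk; first lia.
  have A1 := HN (S k) ltac:(lia); have A2 := HN k ltac:(lia).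
  move: A1; rewrite sum_Sn /plus /=; set s := sum_n _ k in A2 *; set u := a (S k) * _ => A1.
  have -> : u = (s + u - l0) - (s - l0) by ring.
  apply: Rle_trans (Cmod_triangle _ _) _; rewrite Cmod_opp; lra.
have HM00 : (0 <= M0)%R by apply: Rle_trans (HM0 0%nat); exact: Cmod_ge_0.
exists (2 * M0)%R; split; first lra.
move=> n x l Hx Hl Hz Hn.
have Hx0 := Cmod_ge_0 x.
set q := (Cmod x / r)%R.
have Hq : (0 <= q <= / 2)%R.
  split; first by apply: Rdiv_le_0_compat.
  apply: (Rmult_le_reg_r r) => //; rewrite /q; have -> : (Cmod x / r * r = Cmod x)%R by field; lra.
  lra.
have Hpart : forall N f l', Cseries f l' -> Cseries (fun k => f (S N + k)%nat)
    (l' - @sum_n C_AbelianMonoid f N).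
  move=> N f l' Hf.
  apply: (is_series_incr_n (V := C_NormedModule) f (S N)); first lia.
  rewrite /plus /=; have -> : l' - @sum_n C_AbelianMonoid f N + @sum_n C_AbelianMonoid f N = l' by ring.
  exact: Hf.
have Hsum : @sum_n C_AbelianMonoid (fun k => a k * x ^ k) n = a 0%nat + a n * x ^ n.
  have Hs : forall N, (N < n)%nat -> @sum_n C_AbelianMonoid (fun k => a k * x ^ k) N = a 0%nat.
    elim=> [|N IH] HN; first by rewrite sum_O /=; ring.
    rewrite sum_Sn IH; last lia.
    rewrite (Hz (S N)); last lia.
    rewrite /plus /=; ring.
  case: n Hn Hz Hs => [|n] Hn Hz Hs; first lia.
  by rewrite sum_Sn Hs; last lia.
have HT := Hpart n _ _ Hl; rewrite Hsum in HT.
have -> : l - a 0%nat - a n * x ^ n = l - (a 0%nat + a n * x ^ n) by ring.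
have -> : (2 * M0 * q ^ S n = M0 * q ^ S n * / (1 - / 2))%R by field.
apply: (Cseries_norm_le _ (fun k => M0 * q ^ S n * (/ 2) ^ k)%R _ _ HT).
  apply: is_series_scal; apply: is_series_geom; rewrite Rabs_pos_eq; lra.
move=> k.
have -> : a (S n + k)%nat * x ^ (S n + k) = a (S n + k)%nat * RtoC r ^ (S n + k) * (x / r) ^ (S n + k).
  rewrite /Cdiv Cpow_mult_l Cpow_inv; last by apply: RtoC_neq_0; lra.
  field; apply: Cpow_nz; apply: RtoC_neq_0; lra.
rewrite Cmod_mult Cmod_pow Cmod_div; last by apply: RtoC_neq_0; lra.
rewrite Cmod_R (Rabs_pos_eq r); last lra.
rewrite -/q Rmult_assoc.
apply: Rmult_le_compat; [exact: Cmod_ge_0 | exact: pow_le (proj1 Hq) | exact: HM0 |].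
rewrite pow_add; apply: Rmult_le_compat_l; first exact: pow_le (proj1 Hq).
by apply: pow_incr.
Qed.

(** * The regular solution at the origin *)

Fixpoint clifford_coef (nu : C) (k : nat) : C :=
  match k with
  | O => 1
  | S k' => clifford_coef nu k' * / (INR k' + 1) * / (nu + 1 + INR k')
  end.

(** The hypergeometric series [0F1(; nu + 1; y)], also called the Bessel-Clifford function
    up to a Gamma factor: [x^nu * clifford nu (x^2 / 4)] is a multiple of [I_nu(x)]. *)
Definition clifford (nu y : C) : C := Cpow_series (clifford_coef nu) y.

(** No divisor of [clifford_coef] vanishes. *)
Definition nonresonant (nu : C) : Prop := forall k : nat, nu + 1 + INR k <> 0.

Lemma nonresonant_S (nu : C) : nonresonant nu -> nonresonant (nu + 1).
Proof.
move=> H k; have := H (S k); rewrite S_INR RtoC_plus.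
by have -> : nu + 1 + (INR k + 1) = nu + 1 + 1 + INR k by ring.
Qed.

Lemma INR_C_neq_0 (k : nat) : INR k + 1 <> 0.
Proof.
rewrite -RtoC_plus; apply: RtoC_neq_0; have := pos_INR k; lra.
Qed.

Lemma clifford_entire (nu : C) : entire_coef (clifford_coef nu).
Proof.
have Hf := INR_fact_lt_0.
set d := fun k => (Cmod (clifford_coef nu k) * INR (fact k))%R.
have Hd : forall k, (0 <= d k)%R.
  move=> k; apply: Rmult_le_pos; [exact: Cmod_ge_0 | left; exact: Hf].
(* beyond rank N the divisors nu + 1 + k have modulus at least 1 *)
have [N HN] : exists N, forall k, (N <= k)%nat -> (1 <= Cmod (nu + 1 + INR k)%C)%R.
  case: (nfloor_ex (Cmod (nu + 1) + 1)%R); first by have := Cmod_ge_0 (nu + 1); lra.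
  move=> N [_ HN]; exists (S N) => k Hk.
  have Hk' : (INR (S N) <= INR k)%R by apply: le_INR.
  rewrite S_INR in Hk'.
  have := Cmod_triangle (nu + 1 + INR k) (- (nu + 1)).
  have -> : nu + 1 + INR k + - (nu + 1) = INR k by ring.
  rewrite Cmod_opp Cmod_R Rabs_pos_eq; last exact: pos_INR.
  lra.
have Hstep : forall k, (N <= k)%nat -> (d (S k) <= d k)%R.
  move=> k Hk; rewrite /d [clifford_coef _ (S k)]/= !Cmod_mult fact_simpl mult_INR.
  have H1 := HN k Hk.
  have Hne : nu + 1 + INR k <> 0 by apply/Cmod_gt_0; lra.
  rewrite !Cmod_inv //; last exact: INR_C_neq_0.
  rewrite -RtoC_plus Cmod_R Rabs_pos_eq; last by have := pos_INR k; lra.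
  rewrite S_INR.
  have Hk0 := pos_INR k.
  apply: (Rle_trans _ (d k * / Cmod (nu + 1 + INR k)%C)).
    by right; rewrite /d; field; lra.
  rewrite -/(d k) -[X in (_ <= X)%R](Rmult_1_r (d k)); apply: Rmult_le_compat_l => //.
  by have := Rinv_le_contravar 1 _ Rlt_0_1 H1; rewrite Rinv_1.
have Hfin : forall n, exists M, forall k, (k <= n)%nat -> (d k <= M)%R.
  elim=> [|n [M HM]]; first by exists (d 0%nat) => k Hk; (have -> : k = 0%nat by lia); right.
  exists (Rmax M (d (S n))) => k Hk.
  case: (Nat.eq_dec k (S n)) => [->|Hne]; first exact: Rmax_r.
  apply: Rle_trans (Rmax_l _ _); apply: HM; lia.
case: (Hfin N) => M HM; exists M => k.
suff H : (d k <= M)%R.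
  apply: (Rmult_le_reg_r (INR (fact k))) => //.
  have -> : (M / INR (fact k) * INR (fact k) = M)%R by field; have := Hf k; lra.
  exact: H.
case: (Nat.le_ge_cases k N) => Hk; first exact: HM.
elim: k Hk => [|k IH] Hk; first by apply: HM; lia.
case: (Nat.eq_dec (S k) N) => [He|Hne]; first by apply: HM; lia.
apply: Rle_trans (Hstep k _) (IH _); lia.
Qed.

Lemma clifford_coef_S (nu : C) (k : nat) :
  (INR k + 1) * clifford_coef nu (S k) = / (nu + 1) * clifford_coef (nu + 1) k.
Proof.
elim: k => [|k IH].
  have -> : clifford_coef nu 1 = 1 * / (INR 0 + 1) * / (nu + 1 + INR 0) by [].
  have -> : nu + 1 + INR 0 = nu + 1 by rewrite /=; ring.
  have -> : INR 0 + 1 = 1 by rewrite /=; ring.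
  rewrite [clifford_coef _ 0]/=; set u := / (nu + 1); field.
have -> : clifford_coef nu (S (S k)) =
  clifford_coef nu (S k) * / (INR (S k) + 1) * / (nu + 1 + INR (S k)) by [].
have -> : clifford_coef (nu + 1) (S k) =
  clifford_coef (nu + 1) k * / (INR k + 1) * / (nu + 1 + 1 + INR k) by [].
have Hk := INR_C_neq_0 k; have HSk := INR_C_neq_0 (S k).
transitivity ((INR k + 1) * clifford_coef nu (S k) * / (INR k + 1) * / (nu + 1 + INR (S k))).
  set u := / (nu + 1 + INR (S k)); field; by split.
rewrite IH S_INR RtoC_plus.
have -> : nu + 1 + (INR k + 1) = nu + 1 + 1 + INR k by ring.
ring.
Qed.

Lemma clifford_0 (nu : C) : clifford nu 0 = 1.
Proof. by rewrite /clifford Cpow_series_0 //; exact: clifford_entire. Qed.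

Lemma is_C_derive_clifford (nu y : C) :
  is_C_derive (clifford nu) y (/ (nu + 1) * clifford (nu + 1) y).
Proof.
apply: is_C_derive_eq.
  apply: is_C_derive_Cpow_series; exact: clifford_entire.
have H1 := Cpow_series_is _ y (entire_coef_deriv _ (clifford_entire nu)).
apply: (Cseries_unique _ _ _ H1).
apply: Cseries_ext (Cseries_scal (/ (nu + 1)) _ _ (Cpow_series_is _ y (clifford_entire (nu + 1)))) => k.
rewrite S_INR RtoC_plus clifford_coef_S; ring.
Qed.

(** The second derivative being given by [is_C_derive_clifford], this contiguity relation is
    the differential equation [y u'' + (nu + 1) u' = u]. *)
Lemma clifford_contiguity (nu y : C) :
  nonresonant nu ->
  clifford nu y = clifford (nu + 1) y
    + y * (/ (nu + 1) * / (nu + 1 + 1) * clifford (nu + 1 + 1) y).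
Proof.
move=> Hnu.
have S0 := Cpow_series_is _ y (clifford_entire nu).
have S1 := Cpow_series_is _ y (clifford_entire (nu + 1)).
have S2 := Cpow_series_is _ y (clifford_entire (nu + 1 + 1)).
apply: (Cseries_unique _ _ _ S0).
have -> : clifford (nu + 1) y + y * (/ (nu + 1) * / (nu + 1 + 1) * clifford (nu + 1 + 1) y)
  = clifford_coef nu 0 * y ^ 0 + ((clifford (nu + 1) y - clifford_coef (nu + 1) 0 * y ^ 0)
     + y * (/ (nu + 1) * / (nu + 1 + 1)) * clifford (nu + 1 + 1) y).
  rewrite /=; ring.
apply: (Cseries_decr (fun k => clifford_coef nu k * y ^ k)).
apply: Cseries_ext (Cseries_plus _ _ _ _ (Cseries_incr _ _ S1)
  (Cseries_scal (y * (/ (nu + 1) * / (nu + 1 + 1))) _ _ S2)) => k.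
rewrite Cpow_S.
have E1 := clifford_coef_S nu k; have E2 := clifford_coef_S (nu + 1) k.
have Hk := INR_C_neq_0 k.
have H1 : nu + 1 <> 0 by have := Hnu 0%nat; rewrite /= Cplus_0_r.
have H2 := nonresonant_S nu Hnu k; have H3 := Hnu k.
have H4 : nu + 1 + 1 <> 0 by have := nonresonant_S nu Hnu 0%nat; rewrite /= Cplus_0_r.
have E3 : clifford_coef (nu + 1) (S k)
    = clifford_coef (nu + 1) k * / (INR k + 1) * / (nu + 1 + 1 + INR k) by [].
have -> : clifford_coef (nu + 1 + 1) k = (nu + 1 + 1) * ((INR k + 1) * clifford_coef (nu + 1) (S k)).
  rewrite E2; field; exact: H4.
have -> : clifford_coef nu (S k) = / (INR k + 1) * (/ (nu + 1) * clifford_coef (nu + 1) k).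
  rewrite -E1; field; exact: Hk.
rewrite E3; field; by repeat split.
Qed.

(** * Solutions as functions of the logarithm, and their Wronskians *)

(** Here [dF] is the derivative with respect to [x = Cexp t] and not to [t]: in the variable [x]
    the equation has no first-order term, and Wronskians are constant. *)
Definition solves_at (m : nat) (am : C) (F dF : C -> C) (t : C) : Prop :=
  is_C_derive F t (Cexp t * dF t) /\
  is_C_derive dF t (Cexp t * ((Cexp t ^ m + am) / Cexp t ^ 2 * F t)).

Definition wronskian (F dF G dG : C -> C) (t : C) : C := F t * dG t - dF t * G t.

Lemma wronskian_derive (m : nat) (am : C) (F dF G dG : C -> C) (t : C) :
  solves_at m am F dF t -> solves_at m am G dG t ->
  is_C_derive (wronskian F dF G dG) t 0.
Proof.
move=> [F1 F2] [G1 G2]; apply: is_C_derive_eq.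
  apply: is_C_derive_minus.
    exact: is_C_derive_mult F1 G2.
  exact: is_C_derive_mult F2 G1.
rewrite /=; ring.
Qed.

Lemma wronskian_const (m : nat) (am : C) (F dF G dG : C -> C) (t t' : C) :
  (forall z, solves_at m am F dF z) -> (forall z, solves_at m am G dG z) ->
  wronskian F dF G dG t = wronskian F dF G dG t'.
Proof.
move=> HF HG; apply: is_C_derive_zero => z; exact: wronskian_derive.
Qed.

Lemma wronskian_const_R (m : nat) (am : C) (F dF G dG : C -> C) (t t' : R) :
  (forall r : R, solves_at m am F dF r) -> (forall r : R, solves_at m am G dG r) ->
  wronskian F dF G dG t = wronskian F dF G dG t'.
Proof.
move=> HF HG; apply: (path_derive_zero (fun r => wronskian F dF G dG r)) => r _.
apply: is_C_derive_path; exact: wronskian_derive.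
Qed.

(** Since Wronskians are constant, this expresses every solution in a fundamental system with
    coefficients that can be computed at any point. *)
Lemma cramer (F dF G dG H dH : C -> C) (t : C) :
  wronskian F dF G dG t * H t =
  wronskian H dH G dG t * F t + wronskian F dF H dH t * G t.
Proof. rewrite /wronskian; ring. Qed.

Lemma solves_at_lin (m : nat) (am c d : C) (F dF G dG : C -> C) (t : C) :
  solves_at m am F dF t -> solves_at m am G dG t ->
  solves_at m am (fun z => c * F z + d * G z) (fun z => c * dF z + d * dG z) t.
Proof.
move=> [F1 F2] [G1 G2]; split.
- apply: is_C_derive_eq.
    exact: is_C_derive_plus (is_C_derive_scal _ c _ _ F1) (is_C_derive_scal _ d _ _ G1).
  rewrite /=; ring.
- apply: is_C_derive_eq.
    exact: is_C_derive_plus (is_C_derive_scal _ c _ _ F2) (is_C_derive_scal _ d _ _ G2).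
  rewrite /=; rewrite /Cdiv; ring.
Qed.

(** ** Reduction to the Bessel-Clifford equation *)

(** The variable [y = x^m / m^2]. *)
Definition clifford_var (m : nat) (t : C) : C := Cexp (INR m * t) / INR m ^ 2.

Lemma INR_neq_0_C (m : nat) : (1 <= m)%nat -> RtoC (INR m) <> 0.
Proof. move=> H; apply: RtoC_neq_0; apply: not_0_INR; lia. Qed.

Lemma is_C_derive_Cexp_lin (c t : C) :
  is_C_derive (fun z => Cexp (c * z)) t (c * Cexp (c * t)).
Proof.
apply: is_C_derive_eq.
  apply: (is_C_derive_comp Cexp (fun z => c * z)); first exact: is_C_derive_Cexp.
  exact: is_C_derive_scal _ _ _ _ (is_C_derive_id t).
rewrite /=; ring.
Qed.

Lemma is_C_derive_clifford_var (m : nat) (t : C) :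
  is_C_derive (clifford_var m) t (INR m * clifford_var m t).
Proof.
apply: is_C_derive_eq.
  apply: (is_C_derive_ext (fun z => / INR m ^ 2 * Cexp (INR m * z))).
    by move=> w; rewrite /clifford_var /Cdiv Cmult_comm.
  exact: is_C_derive_scal _ _ _ _ (is_C_derive_Cexp_lin _ _).
rewrite /clifford_var /Cdiv; ring.
Qed.

(** The substitution [x^(s(p)) u(x^m / m^2)], which transforms [y u'' + (p/m + 1) u' = u] into the
    equation with [a_m = (p^2 - 1) / 4]. *)
Definition lift (m : nat) (p : C) (u : C -> C) (t : C) : C :=
  Cexp (s_exp p * t) * u (clifford_var m t).

(** The derivative of [lift m p u] with respect to [x], when [u1] is that of [u]. *)
Definition dlift (m : nat) (p : C) (u u1 : C -> C) (t : C) : C :=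
  Cexp ((s_exp p - 1) * t) *
  (s_exp p * u (clifford_var m t) + INR m * (clifford_var m t * u1 (clifford_var m t))).

Lemma lift_solves (m : nat) (p u2 : C) (u u1 : C -> C) (t : C) :
  (1 <= m)%nat ->
  is_C_derive u (clifford_var m t) (u1 (clifford_var m t)) ->
  is_C_derive u1 (clifford_var m t) u2 ->
  clifford_var m t * u2 + (p / INR m + 1) * u1 (clifford_var m t) = u (clifford_var m t) ->
  solves_at m ((p ^ 2 - 1) / 4) (lift m p u) (dlift m p u u1) t.
Proof.
move=> Hm D1 D2 HE.
have Hm0 := INR_neq_0_C m Hm.
have He := Cexp_neq_0 t.
have HS : Cexp (s_exp p * t) = Cexp ((s_exp p - 1) * t) * Cexp t.
  by rewrite -Cexp_plus; f_equal; ring.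
have Hy := is_C_derive_clifford_var m t.
have U := is_C_derive_comp _ _ _ _ _ D1 Hy.
have U1 := is_C_derive_comp _ _ _ _ _ D2 Hy.
split.
- apply: is_C_derive_eq.
    exact: is_C_derive_mult (is_C_derive_Cexp_lin _ _) U.
  rewrite /= /dlift HS; ring.
- apply: is_C_derive_eq.
    apply: is_C_derive_mult; first exact: is_C_derive_Cexp_lin.
    apply: is_C_derive_plus; first exact: is_C_derive_scal _ _ _ _ U.
    apply: is_C_derive_scal; exact: is_C_derive_mult Hy U1.
  rewrite /= /lift HS.
  have HX : Cexp t ^ m = INR m ^ 2 * clifford_var m t.
    rewrite Cexp_pow /clifford_var; field; exact: Hm0.
  rewrite -/(Cpow (Cexp t) m) HX.
  set y := clifford_var m t in HE *.
  set E := Cexp ((s_exp p - 1) * t); set e := Cexp t in He *.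
  have -> : u y = y * u2 + (p / INR m + 1) * u1 y by rewrite HE.
  rewrite /s_exp; field; by split.
Qed.

(** The Frobenius solution [f_1(x,0,p)]; [f_2] is obtained by [p -> -p]. *)
Definition frob (m : nat) (p : C) : C -> C := lift m p (clifford (p / INR m)).

Definition dfrob (m : nat) (p : C) : C -> C :=
  dlift m p (clifford (p / INR m)) (fun y => / (p / INR m + 1) * clifford (p / INR m + 1) y).

Lemma frob_solves (m : nat) (p t : C) :
  (1 <= m)%nat -> nonresonant (p / INR m) ->
  solves_at m ((p ^ 2 - 1) / 4) (frob m p) (dfrob m p) t.
Proof.
move=> Hm Hnu.
set nu := p / INR m in Hnu *.
have H1 : nu + 1 <> 0 by have := Hnu 0%nat; rewrite /= Cplus_0_r.
apply: lift_solves => //; first exact: is_C_derive_clifford.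
  apply: is_C_derive_scal; exact: is_C_derive_clifford.
rewrite -/nu (clifford_contiguity nu) //.
field; split => //.
by have := nonresonant_S nu Hnu 0%nat; rewrite /= Cplus_0_r.
Qed.

(** The Wronskian is a function of [y] with zero derivative on the whole plane, so that it can
    be evaluated at the origin. *)
Lemma frob_wronskian (m : nat) (p t : C) :
  (1 <= m)%nat -> nonresonant (p / INR m) -> nonresonant (- p / INR m) ->
  wronskian (frob m p) (dfrob m p) (frob m (- p)) (dfrob m (- p)) t = - p.
Proof.
move=> Hm Hp Hn.
have Hm0 := INR_neq_0_C m Hm.
set nu := p / INR m in Hp *.
have Hneg : - p / INR m = - nu by rewrite /nu; field; exact: Hm0.
have Hpm : p = INR m * nu by rewrite /nu; field; exact: Hm0.
rewrite Hneg in Hn.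
pose D y := INR m * (y * (clifford nu y * (/ (- nu + 1) * clifford (- nu + 1) y)
               - / (nu + 1) * clifford (nu + 1) y * clifford (- nu) y))
            - p * (clifford nu y * clifford (- nu) y).
transitivity (D (clifford_var m t)).
  rewrite /wronskian /frob /dfrob /lift /dlift Hneg -/nu /D.
  have HE : Cexp (s_exp p * t) * Cexp ((s_exp (- p) - 1) * t) = 1.
    rewrite -Cexp_plus -[RHS]Cexp_0; congr Cexp; rewrite /s_exp; field.
  have HE' : Cexp ((s_exp p - 1) * t) * Cexp (s_exp (- p) * t) = 1.
    rewrite -Cexp_plus -[RHS]Cexp_0; congr Cexp; rewrite /s_exp; field.
  set y := clifford_var m t.
  set a := clifford nu y; set b := clifford (- nu) y.
  set a' := _ * clifford (nu + 1) y; set b' := _ * clifford (- nu + 1) y.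
  transitivity (Cexp (s_exp p * t) * Cexp ((s_exp (- p) - 1) * t) * (a * (s_exp (- p) * b + INR m *
      (y * b')))
    - Cexp ((s_exp p - 1) * t) * Cexp (s_exp (- p) * t) * ((s_exp p * a + INR m * (y * a')) * b)).
    ring.
  rewrite HE HE' /s_exp; field.
have H1 : nu + 1 <> 0 by have := Hp 0%nat; rewrite /= Cplus_0_r.
have H2 : - nu + 1 <> 0 by have := Hn 0%nat; rewrite /= Cplus_0_r.
have H3 : nu + 1 + 1 <> 0 by have := nonresonant_S _ Hp 0%nat; rewrite /= Cplus_0_r.
have H4 : - nu + 1 + 1 <> 0 by have := nonresonant_S _ Hn 0%nat; rewrite /= Cplus_0_r.
have -> : D (clifford_var m t) = D 0.
  apply: is_C_derive_zero => y; apply: is_C_derive_eq.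
    apply: is_C_derive_minus.
      apply: is_C_derive_scal; apply: is_C_derive_mult; first exact: is_C_derive_id.
      apply: is_C_derive_minus; apply: is_C_derive_mult.
      - exact: is_C_derive_clifford.
      - apply: is_C_derive_scal; exact: is_C_derive_clifford.
      - apply: is_C_derive_scal; exact: is_C_derive_clifford.
      - exact: is_C_derive_clifford.
    apply: is_C_derive_scal; apply: is_C_derive_mult; exact: is_C_derive_clifford.
  rewrite /= (clifford_contiguity nu) // (clifford_contiguity (- nu)) // Hpm.
  field; repeat split => //.
rewrite /D !clifford_0; ring.
Qed.

(** * Integrals over the real line *)

Notation CRint := (@is_RInt C_R_NormedModule).
Notation Rcontinuous := (@continuous R_UniformSpace C_R_NormedModule).

Definition is_line_int (f : R -> C) (l : C) : Prop :=
  @is_RInt_gen C_R_NormedModule f (Rbar_locally m_infty) (Rbar_locally p_infty) l.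

Lemma path_derive_continuous (f : R -> C) (r : R) (l : C) :
  path_derive f r l -> Rcontinuous f r.
Proof.
move=> H; apply: (ex_derive_continuous (K := R_AbsRing) (V := C_R_NormedModule)).
by exists l.
Qed.

Lemma Rcontinuous_minus (f g : R -> C) (r : R) :
  Rcontinuous f r -> Rcontinuous g r -> Rcontinuous (fun q => f q - g q) r.
Proof. move=> H H'; exact: (continuous_minus (V := C_R_NormedModule) f g r H H'). Qed.

Lemma Rcontinuous_plus (f g : R -> C) (r : R) :
  Rcontinuous f r -> Rcontinuous g r -> Rcontinuous (fun q => f q + g q) r.
Proof. move=> H H'; exact: (continuous_plus (V := C_R_NormedModule) f g r H H'). Qed.

Lemma CRint_ex (f : R -> C) (a b : R) :
  (forall v, Rcontinuous f v) -> exists l, CRint f a b l.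
Proof.
move=> H; apply: (ex_RInt_continuous (V := C_R_CompleteNormedModule)) => z _; exact: H.
Qed.

Lemma CRint_unique (f : R -> C) (a b : R) (l l' : C) :
  CRint f a b l -> CRint f a b l' -> l = l'.
Proof.
move=> H H'.
by rewrite -(is_RInt_unique (V := C_R_CompleteNormedModule) f a b l H)
  -(is_RInt_unique (V := C_R_CompleteNormedModule) f a b l' H').
Qed.

Lemma is_line_int_eps (f : R -> C) (l : C) :
  (forall v, Rcontinuous f v) ->
  is_line_int f l <->
  forall eps, (0 < eps)%R -> exists N, forall a b k, (a < - N)%R -> (N < b)%R ->
    CRint f a b k -> (Cmod (k - l)%C < eps)%R.
Proof.
move=> Hc; split.
- move=> H eps He.
  have Hloc : locally (T := C_R_NormedModule) l (fun k => (Cmod (k - l)%C < eps)%R).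
    apply: (locally_le_locally_norm (V := C_R_NormedModule)).
    exists (mkposreal eps He) => k; rewrite /ball_norm -Cmod_norm; exact.
  case: (H _ Hloc) => Q1 Q2 [N1 H1] [N2 H2] HQ.
  exists (Rmax (- N1) N2) => a b k Ha Hb Hk.
  have Ha1 : (a < N1)%R by have := Rmax_l (- N1) N2; lra.
  have Hb1 : (N2 < b)%R by have := Rmax_r (- N1) N2; lra.
  case: (HQ a b (H1 a Ha1) (H2 b Hb1)) => k' [Hk' Hd].
  by rewrite (CRint_unique _ _ _ _ _ Hk Hk').
- move=> H Q HQ.
  case: (locally_norm_le_locally (V := C_R_NormedModule) l Q HQ) => -[e He] HeQ.
  case: (H e He) => N HN.
  apply: (Filter_prod _ _ _ (fun a => (a < - N)%R) (fun b => (N < b)%R)).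
  - by exists (- N)%R.
  - by exists N.
  move=> a b Ha Hb; case: (CRint_ex f a b Hc) => k Hk; exists k; split => //.
  apply: HeQ; rewrite /ball_norm -Cmod_norm; exact: (HN a b k).
Qed.

Lemma is_line_int_unique (f : R -> C) (l l' : C) :
  is_line_int f l -> is_line_int f l' -> l = l'.
Proof.
move=> H H'.
by rewrite -(is_RInt_gen_unique (V := C_R_CompleteNormedModule) f l H)
  -(is_RInt_gen_unique (V := C_R_CompleteNormedModule) f l' H').
Qed.

Lemma is_line_int_ext (f g : R -> C) (l : C) :
  (forall v, f v = g v) -> is_line_int f l -> is_line_int g l.
Proof.
move=> H; apply: (is_RInt_gen_ext (V := C_R_NormedModule)).
by apply: filter_forall => ab v _; exact: H.
Qed.

Lemma is_line_int_plus (f g : R -> C) (l l' : C) :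
  is_line_int f l -> is_line_int g l' -> is_line_int (fun v => f v + g v) (l + l').
Proof. move=> H H'; exact: (is_RInt_gen_plus (V := C_R_NormedModule) f g l l' H H'). Qed.

Lemma is_line_int_minus (f g : R -> C) (l l' : C) :
  is_line_int f l -> is_line_int g l' -> is_line_int (fun v => f v - g v) (l - l').
Proof. move=> H H'; exact: (is_RInt_gen_minus (V := C_R_NormedModule) f g l l' H H'). Qed.

Lemma CRint_scal (c : C) (f : R -> C) (a b : R) (l : C) :
  CRint f a b l -> CRint (fun v => c * f v) a b (c * l).
Proof.
move=> H.
have Hf : is_RInt (fun v => fst (f v)) a b (fst l) by exact: is_RInt_fct_extend_fst H.
have Hs : is_RInt (fun v => snd (f v)) a b (snd l) by exact: is_RInt_fct_extend_snd H.
apply: (is_RInt_fct_extend_pair (U := R_NormedModule) (V := R_NormedModule)).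
- exact: (is_RInt_minus (V := R_NormedModule) _ _ _ _ _ _
    (is_RInt_scal _ _ _ (fst c) _ Hf) (is_RInt_scal _ _ _ (snd c) _ Hs)).
- exact: (is_RInt_plus (V := R_NormedModule) _ _ _ _ _ _
    (is_RInt_scal _ _ _ (fst c) _ Hs) (is_RInt_scal _ _ _ (snd c) _ Hf)).
Qed.

Lemma is_line_int_scal (c : C) (f : R -> C) (l : C) :
  is_line_int f l -> is_line_int (fun v => c * f v) (c * l).
Proof.
move=> H Q HQ.
have Hc := Cmod_ge_0 c.
case: (locally_norm_le_locally (V := C_R_NormedModule) _ Q HQ) => -[e He] HeQ.
have He' : (0 < e / (Cmod c + 1))%R by apply: Rdiv_lt_0_compat; lra.
have Hloc : locally (T := C_R_NormedModule) l (fun k => (Cmod (k - l)%C < e / (Cmod c + 1))%R).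
  apply: (locally_le_locally_norm (V := C_R_NormedModule)).
  exists (mkposreal _ He') => k; rewrite /ball_norm -Cmod_norm; exact.
apply: (filter_imp (F := filter_prod (Rbar_locally m_infty) (Rbar_locally p_infty)) _ _ _ (H _
    Hloc)) => ab [k [Hk Hd]].
exists (c * k); split; first exact: CRint_scal.
suff Hn : (Cmod (c * k - c * l)%C < e)%R.
  by apply: HeQ; rewrite /ball_norm -Cmod_norm; exact: Hn.
have -> : c * k - c * l = c * (k - l) by ring.
rewrite Cmod_mult.
have := Cmod_ge_0 (k - l).
have : (e / (Cmod c + 1) * (Cmod c + 1) = e)%R by field; lra.
nra.
Qed.

Lemma is_RInt_exp_lin (c a b : R) : c <> 0%R ->
  is_RInt (fun v => exp (c * v)) a b ((exp (c * b) - exp (c * a)) / c)%R.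
Proof.
move=> Hc.
have -> : ((exp (c * b) - exp (c * a)) / c = minus (exp (c * b) / c) (exp (c * a) / c))%R.
  rewrite /minus /plus /opp /=; field; exact: Hc.
apply: (is_RInt_derive (fun v => exp (c * v) / c)%R) => v _.
  auto_derive => //; field; exact: Hc.
apply: (ex_derive_continuous (fun v => exp (c * v))); by auto_derive.
Qed.

(** The tail of [M e^{-c|v|}] beyond [N] has mass [M / c e^{-cN}]; for [N = 0] this bounds one half
    of a line integral. *)
Lemma CRint_tail_r (f : R -> C) (M c N a b : R) (l : C) :
  (0 < c)%R -> (0 <= M)%R -> (forall v, (Cmod (f v) <= M * exp (- (c * Rabs v)))%R) ->
  (0 <= N)%R -> (N <= a)%R -> (N <= b)%R ->
  CRint f a b l -> (Cmod l <= M / c * exp (- (c * N)))%R.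
Proof.
move=> Hc HM Hf HN Ha Hb.
have core : forall a b l, (N <= a)%R -> (a <= b)%R -> CRint f a b l ->
    (Cmod l <= M / c * exp (- (c * N)))%R.
  clear a b l Ha Hb => a b l Ha Hab Hl.
  have Hg := is_RInt_scal (V := R_NormedModule) _ _ _ M _ (is_RInt_exp_lin (- c) a b ltac:(lra)).
  have := norm_RInt_le (V := C_R_NormedModule) _ _ a b l _ Hab _ Hl Hg.
  rewrite -Cmod_norm => H; apply: Rle_trans (H _) _.
    move=> v Hv; rewrite -Cmod_norm; apply: Rle_trans (Hf v) _.
    rewrite Rabs_pos_eq; last lra.
    by right; rewrite /scal /= /mult /=; congr (_ * exp _)%R; ring.
  rewrite /scal /= /mult /=.
  have -> : (M * ((exp (- c * b) - exp (- c * a)) / - c) = M / c * (exp (- c * a) - exp (- c * b)))%R.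
    by field; lra.
  apply: Rmult_le_compat_l; first by apply: Rdiv_le_0_compat.
  have := exp_pos (- c * b).
  have : (exp (- c * a) <= exp (- (c * N)))%R.
    case: (Req_dec a N) => [->|Hne]; first by right; congr exp; ring.
    by left; apply: exp_increasing; nra.
  lra.
move=> Hl; case: (Rle_dec a b) => Hab; first exact: (core a b).
rewrite -Cmod_opp; apply: (core b a) => //; first lra.
exact: (is_RInt_swap (V := C_R_NormedModule)).
Qed.

Lemma CRint_reflect (f : R -> C) (s a b : R) (l : C) :
  CRint f a b l -> CRint (fun v => f (s - v)%R) (s - b) (s - a) l.
Proof.
move=> H.
have H1 : CRint f (-1 * (s - a) + s)%R (-1 * (s - b) + s)%R l.
  have -> : (-1 * (s - a) + s = a)%R by ring.
  by have -> : (-1 * (s - b) + s = b)%R by ring.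
have H2 := is_RInt_swap (V := C_R_NormedModule) _ _ _ _
  (is_RInt_scal (V := C_R_NormedModule) _ _ _ (-1)%R _ (is_RInt_comp_lin (V := C_R_NormedModule) f
      _ _ _ _ _ H1)).
have E : opp (scal (-1)%R (l : C_R_NormedModule)) = l.
  transitivity ((- (-1 * fst l), - (-1 * snd l))%R : C); first by [].
  by apply: C_eq => /=; rewrite /Re /Im; ring.
rewrite E in H2.
apply: (is_RInt_ext (V := C_R_NormedModule)) H2 => v _.
have -> : (-1 * v + s = s - v)%R by ring.
transitivity ((-1 * (-1 * fst (f (s - v)%R)), -1 * (-1 * snd (f (s - v)%R)))%R : C); first by [].
by apply: C_eq => /=; rewrite /Re /Im; ring.
Qed.

Lemma CRint_tail_l (f : R -> C) (M c N a b : R) (l : C) :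
  (0 < c)%R -> (0 <= M)%R -> (forall v, (Cmod (f v) <= M * exp (- (c * Rabs v)))%R) ->
  (0 <= N)%R -> (a <= - N)%R -> (b <= - N)%R ->
  CRint f a b l -> (Cmod l <= M / c * exp (- (c * N)))%R.
Proof.
move=> Hc HM Hf HN Ha Hb /(CRint_reflect f 0) H.
apply: (CRint_tail_r _ M c N _ _ l Hc HM _ HN _ _ H); [|lra|lra].
by move=> v; apply: Rle_trans (Hf _) _; rewrite Rminus_0_l Rabs_Ropp; right.
Qed.

Lemma exp_decay (c K eps : R) : (0 < c)%R -> (0 <= K)%R -> (0 < eps)%R ->
  exists N, (0 <= N)%R /\ (K * exp (- (c * N)) < eps)%R.
Proof.
move=> Hc HK He; exists (K / (c * eps))%R.
have Hce : (0 < c * eps)%R by nra.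
split; first by apply: Rdiv_le_0_compat.
have -> : (c * (K / (c * eps)) = K / eps)%R by field; lra.
rewrite exp_Ropp.
have H := exp_ineq1_le (K / eps).
have Hp := exp_pos (K / eps).
apply: (Rmult_lt_reg_r (exp (K / eps))) => //.
have -> : (K * / exp (K / eps) * exp (K / eps) = K)%R by field; lra.
have : (eps * (1 + K / eps) = eps + K)%R by field; lra.
nra.
Qed.

(** Cauchy's criterion, the two tails being exponentially small. *)
Lemma line_int_ex (f : R -> C) (M c : R) :
  (0 < c)%R -> (forall v, Rcontinuous f v) ->
  (forall v, (Cmod (f v) <= M * exp (- (c * Rabs v)))%R) ->
  exists l, is_line_int f l.
Proof.
move=> Hc Hcont Hf.
have HM : (0 <= M)%R.
  have := Hf 0%R; rewrite Rabs_R0 Rmult_0_r Ropp_0 exp_0 Rmult_1_r.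
  exact: Rle_trans (Cmod_ge_0 _).
pose I (ab : R * R) : C_R_CompleteNormedModule := RInt (V := C_R_CompleteNormedModule) f (fst ab)
    (snd ab).
have HI : forall a b, CRint f a b (I (a, b)).
  move=> a b; exact: (RInt_correct (V := C_R_CompleteNormedModule) f a b (CRint_ex f a b Hcont)).
have [l Hl] : exists l : C_R_CompleteNormedModule,
    filterlim I (filter_prod (Rbar_locally m_infty) (Rbar_locally p_infty)) (locally l).
  apply/(filterlim_locally_cauchy (U := C_R_CompleteNormedModule)) => -[eps He].
  have HMc : (0 <= M / c)%R by apply: Rdiv_le_0_compat.
  case: (exp_decay c (2 * (M / c)) eps Hc ltac:(lra) He) => N [HN0 HN].
  exists (fun ab => (fst ab < - N)%R /\ (N < snd ab)%R); split.
    apply: (Filter_prod _ _ _ (fun a => (a < - N)%R) (fun b => (N < b)%R)) => //.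
    - by exists (- N)%R.
    - by exists N.
  move=> [a b] [a' b'] /= [Ha Hb] [Ha' Hb'].
  apply: (norm_compat1 (V := C_R_NormedModule)); rewrite -Cmod_norm.
  have T1 := CRint_tail_l f M c N _ _ _ Hc HM Hf HN0 (Rlt_le _ _ Ha') (Rlt_le _ _ Ha) (HI a' a).
  have T2 := CRint_tail_r f M c N _ _ _ Hc HM Hf HN0 (Rlt_le _ _ Hb) (Rlt_le _ _ Hb') (HI b b').
  have E : I (a', b') = I (a', a) + I (a, b) + I (b, b').
    apply: CRint_unique (HI a' b') _.
    apply: (is_RInt_Chasles (V := C_R_NormedModule)) (HI b b').
    exact: (is_RInt_Chasles (V := C_R_NormedModule)) (HI a' a) (HI a b).
  have -> : minus (I (a', b')) (I (a, b)) = (I (a', a) : C) + I (b, b').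
    rewrite E; move: (I (a', a) : C) (I (a, b) : C) (I (b, b') : C) => i1 i2 i3.
    have R123 : i1 + i2 + i3 - i2 = i1 + i3 by ring.
    exact: R123.
  apply: Rle_lt_trans (Cmod_triangle _ _) _; lra.
exists l => Q HQ.
apply: (filter_imp (F := filter_prod (Rbar_locally m_infty) (Rbar_locally p_infty)) _ _ _ (Hl Q
    HQ)) => -[a b] HQI.
exists (I (a, b)); split => //; exact: HI.
Qed.

Lemma line_int_bound (f : R -> C) (M c : R) (l : C) :
  (0 < c)%R -> (forall v, Rcontinuous f v) ->
  (forall v, (Cmod (f v) <= M * exp (- (c * Rabs v)))%R) ->
  is_line_int f l -> (Cmod l <= 2 * M / c)%R.
Proof.
move=> Hc Hcont Hf /(is_line_int_eps f l Hcont) H.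
have HM : (0 <= M)%R.
  have := Hf 0%R; rewrite Rabs_R0 Rmult_0_r Ropp_0 exp_0 Rmult_1_r.
  exact: Rle_trans (Cmod_ge_0 _).
apply: le_epsilon => eps He; case: (H eps He) => N HN.
set n := (Rmax N 0 + 1)%R.
have Hn1 := Rmax_l N 0; have Hn2 := Rmax_r N 0.
case: (CRint_ex f (- n) 0 Hcont) => k1 H1; case: (CRint_ex f 0 n Hcont) => k2 H2.
have H12 := is_RInt_Chasles (V := C_R_NormedModule) _ _ _ _ _ _ H1 H2.
have Hd : (Cmod (k1 + k2 - l)%C < eps)%R by apply: (HN (- n)%R n) H12; rewrite /n; lra.
have T1 := CRint_tail_l f M c 0 (- n) 0 k1 Hc HM Hf (Rle_refl 0) ltac:(rewrite /n; lra) ltac:(lra) H1.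
have T2 := CRint_tail_r f M c 0 0 n k2 Hc HM Hf (Rle_refl 0) ltac:(lra) ltac:(rewrite /n; lra) H2.
rewrite Rmult_0_r Ropp_0 exp_0 Rmult_1_r in T1 T2.
have -> : l = (k1 + k2) - (k1 + k2 - l) by ring.
apply: Rle_trans (Cmod_triangle _ _) _; rewrite Cmod_opp.
have := Cmod_triangle k1 k2.
have -> : (2 * M / c = M / c + M / c)%R by field; lra.
lra.
Qed.

Lemma is_line_int_reflect (f : R -> C) (s : R) (l : C) :
  is_line_int f l -> is_line_int (fun v => f (s - v)%R) l.
Proof.
move=> H Q HQ.
have := H Q HQ => -[Q1 Q2 [N1 H1] [N2 H2] HQ'].
apply: (Filter_prod _ _ _ (fun a => (a < s - N2)%R) (fun b => (s - N1 < b)%R)).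
- by exists (s - N2)%R.
- by exists (s - N1)%R.
move=> a b Ha Hb.
case: (HQ' (s - b) (s - a))%R => [||k /= [Hk HQk]].
- by apply: H1; lra.
- by apply: H2; lra.
exists k; split => //=.
have := CRint_reflect f s _ _ _ Hk.
have -> : (s - (s - a) = a)%R by ring.
by have -> : (s - (s - b) = b)%R by ring.
Qed.

(** The boundary terms of the integral over [[-n, n]] tend to zero. *)
Lemma line_int_derive (g dg : R -> C) (M c : R) (l : C) :
  (0 < c)%R -> (forall v, path_derive g v (dg v)) -> (forall v, Rcontinuous dg v) ->
  (forall v, (Cmod (g v) <= M * exp (- (c * Rabs v)))%R) ->
  is_line_int dg l -> l = 0.
Proof.
move=> Hc Hg Hcont Hb /(is_line_int_eps dg l Hcont) H.
have HM : (0 <= M)%R.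
  have := Hb 0%R; rewrite Rabs_R0 Rmult_0_r Ropp_0 exp_0 Rmult_1_r.
  exact: Rle_trans (Cmod_ge_0 _).
apply: Cmod_eq_0; apply: Rle_antisym; last exact: Cmod_ge_0.
apply: le_epsilon => eps He; case: (H (eps / 2)%R ltac:(lra)) => N HN.
case: (exp_decay c (2 * M) (eps / 2) Hc ltac:(lra) ltac:(lra)) => N' [HN'0 HN'].
set n := (Rmax N N' + 1)%R.
have Hn1 := Rmax_l N N'; have Hn2 := Rmax_r N N'.
have HR : CRint dg (- n) n (g n - g (- n)%R).
  apply: (is_RInt_derive (V := C_R_CompleteNormedModule)) => v _; [exact: Hg | exact: Hcont].
have Hd := HN (- n)%R n _ ltac:(rewrite /n; lra) ltac:(rewrite /n; lra) HR.
have Hn3 : (0 <= n)%R by rewrite /n; lra.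
have B1 := Hb n; have B2 := Hb (- n)%R.
rewrite Rabs_Ropp Rabs_pos_eq // in B2; rewrite Rabs_pos_eq // in B1.
have Hexp : (exp (- (c * n)) <= exp (- (c * N')))%R.
  by left; apply: exp_increasing; rewrite /n; nra.
rewrite Rplus_0_l.
have -> : l = g n + (- g (- n)%R + - (g n - g (- n)%R - l)) by ring.
have T1 := Cmod_triangle (g n) (- g (- n)%R + - (g n - g (- n)%R - l)).
have T2 := Cmod_triangle (- g (- n)%R) (- (g n - g (- n)%R - l)).
rewrite !Cmod_opp in T2; nra.
Qed.

(** * The recessive solution as an integral *)

Definition kernel (nu y : C) (v : R) : C := Cexp (nu * v - exp v - y * exp (- v)%R).

(** With [y = x^2 / 4] this is [2 (x / 2)^nu K_nu(x)], [K_nu] being the Macdonald function,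
    and at [y = 0] it is Euler's integral for [Gamma nu]. *)
Definition macdonald (nu y : C) : C :=
  @RInt_gen C_R_CompleteNormedModule (kernel nu y) (Rbar_locally m_infty) (Rbar_locally p_infty).

Lemma exp_le_compat (a b : R) : (a <= b)%R -> (exp a <= exp b)%R.
Proof. by case=> [H|->]; [left; exact: exp_increasing | right]. Qed.

(** Completing the square, from [e^v >= v^2 / 4]. *)
Lemma superexp_decay (eta alpha : R) : (0 < eta)%R ->
  exists M, (0 <= M)%R /\
    forall v, (0 <= v)%R -> (exp (alpha * v - eta * exp v) <= M * exp (- v))%R.
Proof.
move=> He; exists (exp ((alpha + 1) * (alpha + 1) / eta)); split; first by left; exact: exp_pos.
move=> v Hv; rewrite -exp_plus; apply: exp_le_compat.
have H1 : (v * v / 4 <= exp v)%R.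
  have -> : (exp v = exp (v / 2) * exp (v / 2))%R by rewrite -exp_plus; congr exp; field.
  have He1 := exp_ineq1_le (v / 2).
  have : ((1 + v / 2) * (1 + v / 2) <= exp (v / 2) * exp (v / 2))%R by apply: Rmult_le_compat; lra.
  nra.
have H2 : (0 <= (eta * v / 2 - (alpha + 1)) * (eta * v / 2 - (alpha + 1)) / eta)%R.
  by apply: Rdiv_le_0_compat => //; exact: Rle_0_sqr.
have H3 : ((eta * v / 2 - (alpha + 1)) * (eta * v / 2 - (alpha + 1)) / eta =
  eta * (v * v / 4) - (alpha + 1) * v + (alpha + 1) * (alpha + 1) / eta)%R by field; lra.
nra.
Qed.

Lemma real_kernel_bound (sigma eta : R) : (0 < eta)%R ->
  exists M, (0 <= M)%R /\
    forall v, (exp (sigma * v - exp v - eta * exp (- v)) <= M * exp (- (1 * Rabs v)))%R.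
Proof.
move=> He.
case: (superexp_decay 1 sigma Rlt_0_1) => M1 [HM1 H1].
case: (superexp_decay eta (- sigma) He) => M2 [HM2 H2].
exists (Rmax M1 M2); split; first exact: Rle_trans HM1 (Rmax_l _ _).
move=> v; rewrite Rmult_1_l; have Hp := exp_pos (- Rabs v).
have Hv := exp_pos v; have Hv' := exp_pos (- v).
case: (Rle_dec 0 v) => Hs.
- rewrite Rabs_pos_eq // in Hp *.
  apply: (Rle_trans _ (exp (sigma * v - 1 * exp v))%R).
    by apply: exp_le_compat; nra.
  apply: Rle_trans (H1 v Hs) _; apply: Rmult_le_compat_r; [lra | exact: Rmax_l].
- rewrite Rabs_left1 in Hp *; try lra.
  apply: (Rle_trans _ (exp (- sigma * - v - eta * exp (- v)))%R).
    by apply: exp_le_compat; nra.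
  apply: Rle_trans (H2 (- v)%R ltac:(lra)) _; apply: Rmult_le_compat_r; [lra | exact: Rmax_r].
Qed.

Lemma euler_kernel_bound (sigma : R) : (0 < sigma)%R ->
  exists M, (0 <= M)%R /\
    forall v, (exp (sigma * v - exp v) <= M * exp (- (Rmin 1 sigma * Rabs v)))%R.
Proof.
move=> Hs.
case: (superexp_decay 1 sigma Rlt_0_1) => M1 [HM1 H1].
exists (Rmax M1 1); split; first exact: Rle_trans HM1 (Rmax_l _ _).
have Hc1 := Rmin_l 1 sigma; have Hc2 := Rmin_r 1 sigma.
move=> v; have Hp := exp_pos (- (Rmin 1 sigma * Rabs v)).
have Hv := exp_pos v.
case: (Rle_dec 0 v) => Hsv.
- rewrite Rabs_pos_eq // in Hp *.
  apply: (Rle_trans _ (exp (sigma * v - 1 * exp v))%R); first by right; congr exp; ring.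
  apply: Rle_trans (H1 v Hsv) _.
  apply: Rmult_le_compat => //; [left; exact: exp_pos | exact: Rmax_l |].
  by apply: exp_le_compat; nra.
- rewrite Rabs_left1 in Hp *; try lra.
  apply: (Rle_trans _ (1 * exp (- (Rmin 1 sigma * - v)))%R).
    by rewrite Rmult_1_l; apply: exp_le_compat; nra.
  apply: Rmult_le_compat_r; [lra | exact: Rmax_r].
Qed.

Lemma Cmod_kernel (nu y : C) (v : R) :
  Cmod (kernel nu y v) = exp (Re nu * v - exp v - Re y * exp (- v)).
Proof.
rewrite /kernel Cmod_Cexp; congr exp; case: nu => a b; case: y => c d /=; ring.
Qed.

Lemma kernel_derive (nu y : C) (v : R) :
  path_derive (kernel nu y) v (kernel nu y v * (nu - exp v + y * exp (- v)%R)).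
Proof.
apply: (path_derive_comp Cexp (fun v : R => nu * v - exp v - y * exp (- v)%R)).
  exact: is_C_derive_Cexp.
apply: path_derive_eq.
  apply: path_derive_minus.
    apply: path_derive_minus.
      apply: (path_derive_ext (fun q => 0 + RtoC q * nu)); first by move=> q; ring.
      exact: path_derive_line.
    apply: (path_derive_RtoC exp); exact: is_derive_exp.
  apply: (path_derive_comp (fun z => y * z) (fun v => RtoC (exp (- v)))).
    apply: is_C_derive_scal; exact: is_C_derive_id.
  apply: (path_derive_RtoC (fun v => exp (- v)) v (- exp (- v))); auto_derive => //; ring.
rewrite RtoC_opp; ring.
Qed.

Lemma kernel_continuous (nu y : C) (v : R) : Rcontinuous (kernel nu y) v.
Proof. exact: path_derive_continuous (kernel_derive nu y v). Qed.

Lemma kernel_scal_continuous (c nu y : C) (v : R) :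
  Rcontinuous (fun v => c * kernel nu y v) v.
Proof.
apply: (path_derive_continuous _ _ (c * (kernel nu y v * (nu - exp v + y * exp (- v)%R)))).
apply: (path_derive_comp (fun z => c * z)); last exact: kernel_derive.
apply: is_C_derive_eq (is_C_derive_scal _ c _ _ (is_C_derive_id _)) _; ring.
Qed.

Lemma macdonald_int (nu y : C) :
  (0 < Re y)%R \/ (y = 0 /\ (0 < Re nu)%R) -> is_line_int (kernel nu y) (macdonald nu y).
Proof.
move=> H.
have [l Hl] : exists l, is_line_int (kernel nu y) l.
  case: H => [Hy|[-> Hnu]].
  - case: (real_kernel_bound (Re nu) (Re y) Hy) => M [_ HM].
    apply: (line_int_ex _ M 1 Rlt_0_1) => v; first exact: kernel_continuous.
    by rewrite Cmod_kernel.
  - case: (euler_kernel_bound (Re nu) Hnu) => M [_ HM].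
    apply: (line_int_ex _ M (Rmin 1 (Re nu))) => [|v|v]; first by apply: Rmin_pos; lra.
      exact: kernel_continuous.
    by rewrite Cmod_kernel /= Rmult_0_l Rminus_0_r.
exact: (@RInt_gen_correct C_R_CompleteNormedModule _ _ _ _ (kernel nu y) (ex_intro _ l Hl)).
Qed.

Lemma kernel_shift (nu y : C) (v : R) : kernel (nu - 1) y v = kernel nu y v * exp (- v)%R.
Proof.
rewrite -Cexp_R /kernel -Cexp_plus; congr Cexp; rewrite RtoC_opp; ring.
Qed.

(** For [|w - y| <= Re y / 2] the second-order Taylor remainder of [e^{-y e^{-v}}] costs a factor
    [e^{-2v}] and half of the decay in [e^{-v}], so that it stays integrable. *)
Lemma is_C_derive_macdonald (nu y : C) :
  (0 < Re y)%R -> is_C_derive (macdonald nu) y (- macdonald (nu - 1) y).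
Proof.
move=> Hy; apply/is_C_derive_eps => eps He.
case: (real_kernel_bound (Re nu - 2) (Re y / 2) ltac:(lra)) => M [HM0 HM].
exists (Rmin (Re y / 2) (eps / (4 * M + 1))); split.
  by apply: Rmin_pos; [lra | apply: Rdiv_lt_0_compat; lra].
move=> w Hw.
have H1 : (Cmod (w - y)%C < Re y / 2)%R by apply: Rlt_le_trans Hw (Rmin_l _ _).
have H2 : (Cmod (w - y)%C < eps / (4 * M + 1))%R by apply: Rlt_le_trans Hw (Rmin_r _ _).
set h := w - y in H1 H2 *.
have Hh := Cmod_ge_0 h.
have Hwy : (0 < Re w)%R.
  have := re_le_Cmod h; have -> : (Re h = Re w - Re y)%R by [].
  move=> Hr; have := Rle_abs (- (Re w - Re y)); rewrite Rabs_Ropp; lra.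
have I1 := macdonald_int nu w (or_introl Hwy).
have I2 := macdonald_int nu y (or_introl Hy).
have I3 := is_line_int_scal h _ _ (macdonald_int (nu - 1) y (or_introl Hy)).
have I4 := is_line_int_plus _ _ _ _ (is_line_int_minus _ _ _ _ I1 I2) I3.
have -> : macdonald nu w - macdonald nu y - h * - macdonald (nu - 1) y =
  macdonald nu w - macdonald nu y + h * macdonald (nu - 1) y by ring.
have HB : (Cmod (macdonald nu w - macdonald nu y + h * macdonald (nu - 1) y)%C
    <= 2 * (2 * (Cmod h * Cmod h) * M) / 1)%R.
  apply: (line_int_bound _ _ 1 _ Rlt_0_1 _ _ I4) => v.
    apply: Rcontinuous_plus.
      apply: Rcontinuous_minus; exact: kernel_continuous.
    exact: kernel_scal_continuous.
  have -> : kernel nu w v - kernel nu y v + h * kernel (nu - 1) y v =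
      kernel nu y v * (Cexp (- (h * exp (- v)%R)) - 1 - (- (h * exp (- v)%R))).
    rewrite kernel_shift.
    have -> : kernel nu w v = kernel nu y v * Cexp (- (h * exp (- v)%R)).
      rewrite /kernel -Cexp_plus; congr Cexp; rewrite /h; ring.
    ring.
  rewrite Cmod_mult.
  have Hev := exp_pos (- v).
  have Hm : Cmod (- (h * exp (- v)%R)) = (Cmod h * exp (- v))%R.
    by rewrite Cmod_opp Cmod_mult Cmod_R Rabs_pos_eq; lra.
  apply: Rle_trans (Rmult_le_compat_l _ _ _ (Cmod_ge_0 _) (Cexp_taylor1 _)) _.
  rewrite Hm Cmod_kernel.
  have E2 : (exp (- v) * exp (- v) = exp (- 2 * v))%R by rewrite -exp_plus; congr exp; ring.
  apply: (Rle_trans _ (2 * (Cmod h * Cmod h) *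
     (exp (Re nu * v - exp v - Re y * exp (- v)) * exp (- 2 * v) * exp (Cmod h * exp (- v))))).
    by right; rewrite -E2; ring.
  rewrite -!exp_plus (Rmult_assoc _ M); apply: Rmult_le_compat_l; first by nra.
  apply: Rle_trans (HM v); apply: exp_le_compat; nra.
apply: Rle_trans HB _.
have : (Cmod h * (4 * M + 1) <= eps)%R.
  apply: (Rmult_le_reg_r (/ (4 * M + 1))); first by apply: Rinv_0_lt_compat; lra.
  rewrite Rmult_assoc Rinv_r; lra.
nra.
Qed.

(** Integration by parts. Together with the derivative this makes [macdonald nu] a solution of
    [y u'' + (1 - nu) u' = u]. *)
Lemma macdonald_recurrence (nu y : C) :
  (0 < Re y)%R ->
  macdonald (nu + 1) y = nu * macdonald nu y + y * macdonald (nu - 1) y.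
Proof.
move=> Hy.
have I1 := macdonald_int (nu + 1) y (or_introl Hy).
have I2 := is_line_int_scal nu _ _ (macdonald_int nu y (or_introl Hy)).
have I3 := is_line_int_scal y _ _ (macdonald_int (nu - 1) y (or_introl Hy)).
have I4 := is_line_int_minus _ _ _ _ (is_line_int_plus _ _ _ _ I2 I3) I1.
set l := nu * macdonald nu y + y * macdonald (nu - 1) y - macdonald (nu + 1) y in I4.
have E : forall v, nu * kernel nu y v + y * kernel (nu - 1) y v - kernel (nu + 1) y v =
    kernel nu y v * (nu - exp v + y * exp (- v)%R).
  move=> v; rewrite kernel_shift.
  have -> : kernel (nu + 1) y v = kernel nu y v * exp v.
    rewrite -(Cexp_R v) /kernel -Cexp_plus; congr Cexp; ring.
  ring.
case: (real_kernel_bound (Re nu) (Re y) Hy) => M [_ HM].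
have H0 : l = 0.
  apply: (line_int_derive (kernel nu y) _ M 1 l Rlt_0_1 _ _ _ I4) => v.
  - rewrite E; exact: kernel_derive.
  - apply: Rcontinuous_minus; last exact: kernel_continuous.
    apply: Rcontinuous_plus.
    + exact: kernel_scal_continuous.
    + exact: kernel_scal_continuous.
  - by rewrite Cmod_kernel.
have -> : macdonald (nu + 1) y = nu * macdonald nu y + y * macdonald (nu - 1) y - l.
  rewrite /l; ring.
rewrite H0; ring.
Qed.

(** The reflection [v -> w - v] exchanges [e^v] and [e^w e^{-v}]; this is [K_{-nu} = K_nu]. *)
Lemma macdonald_sym (nu : C) (w : R) :
  macdonald nu (exp w) = Cexp (nu * w) * macdonald (- nu) (exp w).
Proof.
have Hy : (0 < Re (exp w))%R by exact: exp_pos.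
apply: (is_line_int_unique (kernel nu (exp w))); first exact: macdonald_int (or_introl Hy).
have I1 := macdonald_int (- nu) _ (or_introl Hy).
have I2 := is_line_int_scal (Cexp (nu * w)) _ _ (is_line_int_reflect _ w _ I1).
apply: is_line_int_ext I2 => v.
rewrite /kernel -Cexp_plus; congr Cexp.
rewrite -!RtoC_mult -!exp_plus.
have -> : (w + - (w - v) = v)%R by ring.
have -> : (w + - v = w - v)%R by ring.
rewrite RtoC_minus; ring.
Qed.

(** The kernels differ by the factor [1 - exp (- e^(w - v))], which a small power of [e^w] bounds
    at the cost of lowering [Re nu] slightly. *)
Lemma macdonald_limit_0 (nu : C) : (0 < Re nu)%R ->
  forall eps, (0 < eps)%R -> exists W : R, forall w : R, (w < W)%R ->
    (Cmod (macdonald nu (exp w) - macdonald nu 0)%C < eps)%R.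
Proof.
move=> Hnu eps He.
set d := Rmin 1 (Re nu / 2).
have Hd : (0 < d)%R by apply: Rmin_pos; lra.
have Hd1 : (d <= 1)%R by exact: Rmin_l.
have Hd2 : (d <= Re nu / 2)%R by exact: Rmin_r.
case: (euler_kernel_bound (Re nu - d) ltac:(lra)) => M [HM0 HM].
set c := Rmin 1 (Re nu - d) in HM.
have Hc : (0 < c)%R by apply: Rmin_pos; lra.
have HK : (0 <= 2 * M / c)%R by apply: Rdiv_le_0_compat => //; lra.
case: (exp_decay d (2 * M / c) eps Hd HK He) => N [HN0 HN].
exists (- N)%R => w Hw.
have Hy : (0 < Re (exp w))%R by exact: exp_pos.
have I1 := is_line_int_minus _ _ _ _ (macdonald_int nu _ (or_introl Hy))
   (macdonald_int nu 0 (or_intror (conj eq_refl Hnu))).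
have HB : (Cmod (macdonald nu (exp w) - macdonald nu 0)%C <= 2 * (exp (d * w) * M) / c)%R.
  apply: (line_int_bound _ _ c _ Hc _ _ I1) => v.
    apply: Rcontinuous_minus; exact: kernel_continuous.
  have -> : kernel nu (exp w) v = kernel nu 0 v * exp (- exp (w - v))%R.
    rewrite -(Cexp_R (- exp (w - v))) /kernel -Cexp_plus; congr Cexp.
    rewrite -RtoC_mult -exp_plus RtoC_opp; have -> : (w + - v = w - v)%R by ring.
    ring.
  have -> : kernel nu 0 v * exp (- exp (w - v))%R - kernel nu 0 v
     = kernel nu 0 v * (exp (- exp (w - v)) - 1)%R by rewrite RtoC_minus; ring.
  rewrite Cmod_mult Cmod_R Cmod_kernel.
  (* 1 - exp(-X) is at most both 1 and X, hence at most X^d *)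
  have HX : (Rabs (exp (- exp (w - v)) - 1) <= exp (d * (w - v)))%R.
    have HE := exp_pos (w - v); have HE2 := exp_pos (- exp (w - v)).
    have HE3 := exp_ineq1_le (- exp (w - v)).
    have HE4 : (exp (- exp (w - v)) <= 1)%R by rewrite -exp_0; apply: exp_le_compat; lra.
    rewrite Rabs_left1; last lra.
    case: (Rle_dec 0 (w - v)) => Hs.
    - have := exp_ge_1 (d * (w - v)) ltac:(nra); lra.
    - have := exp_le_compat (w - v) (d * (w - v)) ltac:(nra); lra.
  apply: Rle_trans (Rmult_le_compat_l _ _ _ (Rlt_le _ _ (exp_pos _)) HX) _.
  have -> : (exp (Re nu * v - exp v - Re 0 * exp (- v)) * exp (d * (w - v)) =
     exp (d * w) * exp ((Re nu - d) * v - exp v))%R.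
    rewrite -!exp_plus; congr exp; rewrite /=; ring.
  rewrite Rmult_assoc; apply: Rmult_le_compat_l; [left; exact: exp_pos | exact: HM].
apply: Rle_lt_trans HB _.
have -> : (2 * (exp (d * w) * M) / c = 2 * M / c * exp (d * w))%R by field; lra.
apply: Rle_lt_trans HN; apply: Rmult_le_compat_l => //.
apply: exp_le_compat; nra.
Qed.

(** * The Gaussian integral *)

Definition gauss_primitive (x : R) : R := RInt (fun r => exp (- (r * r))) 0 x.

Lemma gauss_continuous (r : R) : continuous (fun r => exp (- (r * r))) r.
Proof. apply: (ex_derive_continuous (fun r => exp (- (r * r)))); by auto_derive. Qed.

Lemma gauss_primitive_is (x : R) :
  is_RInt (fun r => exp (- (r * r))) 0 x (gauss_primitive x).
Proof. apply: RInt_correct; apply: ex_RInt_continuous => z _; exact: gauss_continuous. Qed.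

Lemma gauss_primitive_derive (x : R) :
  is_derive gauss_primitive x (exp (- (x * x))).
Proof.
apply: (is_derive_RInt (fun r => exp (- (r * r))) gauss_primitive 0).
- by apply: filter_forall => y; exact: gauss_primitive_is.
- exact: gauss_continuous.
Qed.

Lemma gauss_primitive_odd (x : R) : gauss_primitive (- x) = (- gauss_primitive x)%R.
Proof.
apply: is_RInt_unique.
have H : is_RInt (fun r => exp (- (r * r))) (- 0) (- - x) (gauss_primitive x).
  rewrite Ropp_0 Ropp_involutive; exact: gauss_primitive_is.
have := is_RInt_opp _ _ _ _ (is_RInt_comp_opp _ _ _ _ H).
rewrite /opp /=; apply: is_RInt_ext => r _; rewrite /opp /= Ropp_involutive.
by congr exp; ring.
Qed.

(** The square of [gauss_primitive x] is the integral of [exp (- r^2 - s^2)] over the square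
    [[0, x]^2], and [gauss_companion x] is the integral over the rest of the quarter plane: twice
    the part below the diagonal, in the coordinates [(r, r t)] with [x < r] and [0 < t < 1]. *)
Definition gauss_companion (x : R) : R :=
  RInt (fun t => exp (- (x * x * (1 + t * t))) / (1 + t * t))%R 0 1.

Lemma one_plus_sqr_pos (t : R) : (0 < 1 + t * t)%R.
Proof. nra. Qed.

Lemma gauss_companion_continuous (x t : R) :
  continuous (fun t => exp (- (x * x * (1 + t * t))) / (1 + t * t))%R t.
Proof.
apply: (ex_derive_continuous (fun t => exp (- (x * x * (1 + t * t))) / (1 + t * t))%R).
auto_derive; have := one_plus_sqr_pos t; lra.
Qed.

(** Differentiation under the integral sign and the substitution [r = x t]. *)
Lemma gauss_companion_derive (x : R) :
  is_derive gauss_companion x (- (2 * exp (- (x * x)) * gauss_primitive x))%R.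
Proof.
pose k x t := (exp (- (x * x * (1 + t * t))) / (1 + t * t))%R.
have Hk : forall x t, is_derive (fun u => k u t) x (- (2 * x) * exp (- (x * x * (1 + t * t))))%R.
  move=> u t; have Ht := one_plus_sqr_pos t.
  rewrite /k; auto_derive; first lra.
  field; lra.
have HD : forall u t, Derive (fun u => k u t) u = (- (2 * u) * exp (- (u * u * (1 + t * t))))%R.
  move=> u t; exact: is_derive_unique (Hk u t).
have := is_derive_RInt_param k 0 1 x.
have -> : RInt (fun t => Derive (fun u => k u t) x) 0 1 = (- (2 * exp (- (x * x)) * gauss_primitive
    x))%R.
  apply: is_RInt_unique.
  have H : is_RInt (fun r => exp (- (r * r))) (x * 0 + 0)%R (x * 1 + 0)%R (gauss_primitive x).
    rewrite Rmult_0_r !Rplus_0_r Rmult_1_r; exact: gauss_primitive_is.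
  have := is_RInt_scal _ _ _ (- (2 * exp (- (x * x))))%R _ (is_RInt_comp_lin _ _ _ _ _ _ H).
  have -> : scal (- (2 * exp (- (x * x))))%R (gauss_primitive x) =
     (- (2 * exp (- (x * x)) * gauss_primitive x))%R by rewrite /scal /= /mult /=; ring.
  apply: is_RInt_ext => t _; rewrite HD /scal /= /mult /=.
  have -> : (exp (- (x * x * (1 + t * t))) = exp (- (x * x)) * exp (- ((x * t + 0) * (x * t + 0))))%R.
    by rewrite -exp_plus; congr exp; ring.
  ring.
apply.
- apply: filter_forall => u t _; eexists; exact: Hk.
- move=> t _.
  apply: (continuity_2d_pt_ext (fun u v => - (2 * u) * exp (- (u * u * (1 + v * v))))%R).
    by move=> u v; rewrite HD.
  apply/continuity_2d_pt_filterlim.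
  have C1 : continuous (fun q : R * R => fst q) (x, t) by exact: continuous_fst.
  have C2 : continuous (fun q : R * R => snd q) (x, t) by exact: continuous_snd.
  have Cm : forall f g : R * R -> R, continuous f (x, t) -> continuous g (x, t) ->
      continuous (fun q => f q * g q)%R (x, t) by move=> f g; exact: (continuous_mult (K := R_AbsRing)).
  apply: (Cm (fun q => - (2 * fst q))%R (fun q => exp (- (fst q * fst q * (1 + snd q * snd q))))%R).
    apply: (continuous_opp (V := R_NormedModule)); apply: Cm => //; exact: continuous_const.
  apply: (continuous_comp (fun q : R * R => - (fst q * fst q * (1 + snd q * snd q)))%R exp).
    apply: (continuous_opp (V := R_NormedModule)); apply: (Cm (fun q => fst q * fst q)%R); first
        exact: Cm.
    apply: (continuous_plus (V := R_NormedModule)); [exact: continuous_const | exact: Cm].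
  exact: continuous_exp.
- apply: filter_forall => u; apply: ex_RInt_continuous => t _; exact: gauss_companion_continuous.
Qed.

(** The derivatives of the two terms cancel, and at [0] the sum is [atan 1]. *)
Lemma gauss_identity (x : R) :
  (gauss_primitive x * gauss_primitive x + gauss_companion x = PI / 4)%R.
Proof.
pose H x := (gauss_primitive x * gauss_primitive x + gauss_companion x)%R.
have HD : forall u, is_derive H u 0%R.
  move=> u; have G := gauss_primitive_derive u.
  have := is_derive_plus _ _ _ _ _ (is_derive_mult _ _ _ _ _ G G Rmult_comm) (gauss_companion_derive u).
  by congr is_derive; rewrite /plus /mult /=; ring.
have -> : (gauss_primitive x * gauss_primitive x + gauss_companion x = H x)%R by [].
have -> : H x = H 0%R.
  case: (MVT_gen H 0 x (fun _ => 0%R)) => [u _|u _|u [_ Hu]]; first exact: HD.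
    apply/continuity_pt_filterlim; apply: (ex_derive_continuous H); eexists; exact: HD.
  lra.
rewrite /H /gauss_primitive RInt_point /zero /= Rmult_0_l Rplus_0_l.
apply: is_RInt_unique.
have -> : (PI / 4 = minus (atan 1) (atan 0))%R.
  by rewrite atan_1 atan_0 /minus /plus /opp /= Ropp_0 Rplus_0_r.
apply: (is_RInt_ext (fun t => / (1 + t * t))%R).
  by move=> t _; rewrite !Rmult_0_l Ropp_0 exp_0 /Rdiv Rmult_1_l.
apply: (is_RInt_derive atan) => t _.
  have := is_derive_atan t; rewrite /Rsqr; congr is_derive.
apply: (ex_derive_continuous (fun t => / (1 + t * t))%R); auto_derive.
have := one_plus_sqr_pos t; lra.
Qed.

Lemma sqrt_PI_pos : (0 < sqrt PI)%R.
Proof. exact: sqrt_lt_R0 PI_RGT_0. Qed.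

(** The companion is at most [exp (- x^2)], and a difference of squares is factored. *)
Lemma gauss_primitive_limit (x : R) : (0 <= x)%R ->
  (Rabs (gauss_primitive x - sqrt PI / 2) <= exp (- (x * x)) / (sqrt PI / 2))%R.
Proof.
move=> Hx.
have HG : (0 <= gauss_primitive x)%R.
  apply: (RInt_ge_0 _ _ _ Hx); first by eexists; exact: gauss_primitive_is.
  by move=> r _; left; exact: exp_pos.
have HC : (0 <= gauss_companion x <= exp (- (x * x)))%R.
  have HE : ex_RInt (fun t => exp (- (x * x * (1 + t * t))) / (1 + t * t))%R 0 1.
    apply: ex_RInt_continuous => t _; exact: gauss_companion_continuous.
  split.
    apply: RInt_ge_0 => //; first lra.
    move=> t _; left; apply: Rdiv_lt_0_compat; [exact: exp_pos | exact: one_plus_sqr_pos].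
  have -> : exp (- (x * x)) = RInt (fun _ => exp (- (x * x))) 0 1.
    by rewrite RInt_const /scal /= /mult /=; ring.
  apply: RInt_le => //; [lra | exact: ex_RInt_const |].
  move=> t _; have Ht := one_plus_sqr_pos t.
  apply: (Rmult_le_reg_r (1 + t * t)) => //.
  have -> : (exp (- (x * x * (1 + t * t))) / (1 + t * t) * (1 + t * t) = exp (- (x * x * (1 + t *
      t))))%R.
    field; lra.
  have : (exp (- (x * x * (1 + t * t))) <= exp (- (x * x)))%R by apply: exp_le_compat; nra.
  have := exp_pos (- (x * x)); nra.
have HI := gauss_identity x; have Hp := sqrt_PI_pos.
have HS : (sqrt PI * sqrt PI = PI)%R by apply: sqrt_sqrt; left; exact: PI_RGT_0.
set g := gauss_primitive x in HG HI *.
have Hprod : (Rabs (g - sqrt PI / 2) * (g + sqrt PI / 2) <= exp (- (x * x)))%R.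
  rewrite -(Rabs_pos_eq (g + sqrt PI / 2)); last lra.
  rewrite -Rabs_mult; apply: Rabs_le; split; nra.
apply: (Rmult_le_reg_r (sqrt PI / 2)); first lra.
have -> : (exp (- (x * x)) / (sqrt PI / 2) * (sqrt PI / 2) = exp (- (x * x)))%R by field; lra.
have := Rabs_pos (g - sqrt PI / 2); nra.
Qed.

(** * Behaviour of the recessive solution at infinity *)

(** [2 sinh(u/2)], whose square is [2 cosh u - 2]. *)
Definition half_sinh (u : R) : R := (exp (u / 2) - exp (- (u / 2)))%R.

Definition half_cosh (u : R) : R := ((exp (u / 2) + exp (- (u / 2))) / 2)%R.

Lemma half_sinh_derive (u : R) : is_derive half_sinh u (half_cosh u).
Proof. rewrite /half_sinh /half_cosh; auto_derive => //; rewrite /Rdiv; field. Qed.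

Lemma half_sinh_sqr (u : R) : (half_sinh u * half_sinh u = exp u + exp (- u) - 2)%R.
Proof.
have E1 : (exp u = exp (u / 2) * exp (u / 2))%R by rewrite -exp_plus; congr exp; field.
have E2 : (exp (- u) = exp (- (u / 2)) * exp (- (u / 2)))%R by rewrite -exp_plus; congr exp; field.
have E3 : (exp (u / 2) * exp (- (u / 2)) = 1)%R by rewrite -exp_plus Rplus_opp_r exp_0.
rewrite /half_sinh E1 E2; nra.
Qed.

Lemma half_sinh_ge (u : R) : (0 <= u)%R -> (u <= half_sinh u)%R.
Proof.
move=> Hu.
case: (MVT_gen (fun v => half_sinh v - v)%R 0 u (fun v => half_cosh v - 1)%R) => [v _|v _|v [_ Hv]].
- apply: (is_derive_minus half_sinh (fun v => v)); [exact: half_sinh_derive | exact: is_derive_id].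
- apply/continuity_pt_filterlim; apply: (ex_derive_continuous (fun v => half_sinh v - v)%R).
  eexists; apply: (is_derive_minus half_sinh (fun v => v)); [exact: half_sinh_derive | exact:
      is_derive_id].
have H0 : half_sinh 0 = 0%R by rewrite /half_sinh; have -> : (0 / 2 = 0)%R by [field]; rewrite
    Ropp_0; ring.
have : (1 <= half_cosh v)%R.
  rewrite /half_cosh; have := exp_ineq1_le (v / 2); have := exp_ineq1_le (- (v / 2)); lra.
move: Hv; rewrite H0; nra.
Qed.

Lemma half_sinh_opp (u : R) : half_sinh (- u) = (- half_sinh u)%R.
Proof.
rewrite /half_sinh; have -> : (- u / 2 = - (u / 2))%R by field.
rewrite Ropp_involutive; ring.
Qed.

Lemma half_sinh_sqr_ge (u : R) : (u * u <= half_sinh u * half_sinh u)%R.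
Proof.
case: (Rle_dec 0 u) => Hu; first by have := half_sinh_ge u Hu; nra.
have := half_sinh_ge (- u) ltac:(lra); rewrite half_sinh_opp; nra.
Qed.

Lemma Rcontinuous_RtoC (g : R -> R) (u : R) :
  ex_derive g u -> Rcontinuous (fun u => RtoC (g u)) u.
Proof. case=> l Hl; apply: (path_derive_continuous _ _ (RtoC l)); exact: path_derive_RtoC. Qed.

(** The substitution [r = sqrt z * half_sinh u] in the Gaussian integral. *)
Lemma gauss_half_cosh_int (z : R) : (0 < z)%R ->
  is_line_int (fun u => RtoC (half_cosh u * exp (- (z * (half_sinh u * half_sinh u)))))
              (RtoC (sqrt PI / sqrt z)).
Proof.
move=> Hz.
have Hs : (0 < sqrt z)%R by exact: sqrt_lt_R0.
have Hss : (sqrt z * sqrt z = z)%R by apply: sqrt_sqrt; lra.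
pose F u := (gauss_primitive (sqrt z * half_sinh u) / sqrt z)%R.
have HF : forall u, is_derive F u (half_cosh u * exp (- (z * (half_sinh u * half_sinh u))))%R.
  move=> u.
  have H1 := is_derive_scal _ _ (sqrt z) _ (half_sinh_derive u).
  have H2 := is_derive_comp gauss_primitive _ u _ _ (gauss_primitive_derive (sqrt z * half_sinh u)) H1.
  have := is_derive_scal _ _ (/ sqrt z) _ H2.
  move=> H3; apply: (is_derive_ext (fun v => / sqrt z * gauss_primitive (sqrt z * half_sinh v))%R).
    by move=> v; rewrite /F /Rdiv Rmult_comm.
  move: H3; congr is_derive; rewrite /scal /= /mult /=.
  have -> : (sqrt z * half_sinh u * (sqrt z * half_sinh u) = z * (half_sinh u * half_sinh u))%R.
    by rewrite -[in RHS]Hss; ring.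
  field; lra.
apply/is_line_int_eps.
  move=> u; apply: Rcontinuous_RtoC; rewrite /half_cosh /half_sinh; by auto_derive.
move=> eps He.
have Hp := sqrt_PI_pos.
case: (exp_decay (sqrt z) (2 / (sqrt PI / 2) / sqrt z) eps Hs _ He) => [|N [HN0 HN]].
  by left; apply: Rdiv_lt_0_compat => //; apply: Rdiv_lt_0_compat; lra.
(* beyond 1 / sqrt z the bound exp(- z u^2) is better than exp(- sqrt z u) *)
set N' := Rmax N (/ sqrt z).
have HN1 : (N <= N')%R by exact: Rmax_l.
have HN2 : (/ sqrt z <= N')%R by exact: Rmax_r.
have Hi : (0 < / sqrt z)%R by exact: Rinv_0_lt_compat.
have tail : forall u, (N' < u)%R -> (Rabs (F u - sqrt PI / 2 / sqrt z) < eps / 2)%R.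
  move=> u Hu.
  have Hh := half_sinh_ge u ltac:(lra).
  have Hsu : (1 <= sqrt z * u)%R.
    have : (sqrt z * / sqrt z = 1)%R by field; lra.
    nra.
  have Hsh : (sqrt z * u <= sqrt z * half_sinh u)%R by nra.
  have G := gauss_primitive_limit (sqrt z * half_sinh u) ltac:(nra).
  have -> : (F u - sqrt PI / 2 / sqrt z = (gauss_primitive (sqrt z * half_sinh u) - sqrt PI / 2) *
      / sqrt z)%R.
    by rewrite /F; field; lra.
  rewrite Rabs_mult (Rabs_pos_eq (/ sqrt z)); last lra.
  apply: Rle_lt_trans (Rmult_le_compat_r _ _ _ (Rlt_le _ _ Hi) G) _.
  have HE : (exp (- (sqrt z * half_sinh u * (sqrt z * half_sinh u))) <= exp (- (sqrt z * N)))%R.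
    apply: exp_le_compat; nra.
  apply: (Rle_lt_trans _ (exp (- (sqrt z * N)) / (sqrt PI / 2) * / sqrt z)).
    apply: Rmult_le_compat_r; first lra.
    by apply: Rmult_le_compat_r => //; left; apply: Rinv_0_lt_compat; lra.
  have -> : (exp (- (sqrt z * N)) / (sqrt PI / 2) * / sqrt z =
    (2 / (sqrt PI / 2) / sqrt z * exp (- (sqrt z * N))) / 2)%R by field; lra.
  lra.
have Fodd : forall u, F (- u)%R = (- F u)%R.
  move=> u; rewrite /F half_sinh_opp.
  rewrite Ropp_mult_distr_r_reverse gauss_primitive_odd; field; lra.
exists N' => a b k Ha Hb Hk.
have HR : CRint (fun u => RtoC (half_cosh u * exp (- (z * (half_sinh u * half_sinh u))))) a b
     (RtoC (F b) - RtoC (F a)).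
  apply: (is_RInt_derive (V := C_R_CompleteNormedModule) (fun u => RtoC (F u))) => u _.
    exact: (path_derive_RtoC F).
  apply: Rcontinuous_RtoC; rewrite /half_cosh /half_sinh; by auto_derive.
rewrite (CRint_unique _ _ _ _ _ Hk HR) -!RtoC_minus Cmod_R.
have T1 := tail b Hb; have T2 := tail (- a)%R ltac:(lra).
rewrite Fodd in T2.
have -> : (F b - F a - sqrt PI / sqrt z = (F b - sqrt PI / 2 / sqrt z) + (- F a - sqrt PI / 2 /
    sqrt z))%R by field; lra.
apply: Rle_lt_trans (Rabs_triang _ _) _; lra.
Qed.

Lemma Cexp_taylor0 (q : C) : (Cmod (Cexp q - 1)%C <= Cmod q * exp (3 * Cmod q))%R.
Proof.
have -> : Cexp q - 1 = (Cexp q - 1 - q) + q by ring.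
apply: Rle_trans (Cmod_triangle _ _) _.
have H := Cexp_taylor1 q; have Hq := Cmod_ge_0 q.
set n := Cmod q in H Hq *.
have H1 := exp_ge_1 n Hq; have H2 := exp_ineq1_le (2 * n).
have -> : (exp (3 * n) = exp n * exp (2 * n))%R by rewrite -exp_plus; congr exp; ring.
have H3 : (exp n * (1 + 2 * n) <= exp n * exp (2 * n))%R by apply: Rmult_le_compat_l; lra.
have H4 : (n * (exp n * (1 + 2 * n)) <= n * (exp n * exp (2 * n)))%R by apply: Rmult_le_compat_l.
nra.
Qed.

(** Laplace's method. The shift [v = ln z + u] brings the saddle point to [u = 0] and turns the
    kernel into [z^nu e^{-2z} e^{nu u} exp (- z (half_sinh u)^2)]. Replacing [e^{nu u}] by
    [half_cosh u] gives the integral known exactly from [gauss_half_cosh_int], and changes the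
    integrand by [O(|u| e^{n|u|} e^{- z u^2})], whose integral is [O(1 / z)]. *)
Lemma macdonald_asymptotic (nu : C) :
  exists K, forall z : R, (1 <= z)%R ->
    (Cmod (Cexp (- (nu * ln z)) * exp (2 * z) * sqrt z * macdonald nu (z * z)%R - sqrt PI)%C
     <= K / sqrt z)%R.
Proof.
set n := (3 * Cmod nu + 1)%R.
have Hnu := Cmod_ge_0 nu.
have Hn : (1 <= n)%R by rewrite /n; lra.
set K := exp ((n + 2) * (n + 2) / 4).
have HK : (0 < K)%R by exact: exp_pos.
exists (2 * (n * K))%R => z Hz.
have Hz0 : (0 < z)%R by lra.
have Hs : (1 <= sqrt z)%R by rewrite -sqrt_1; apply: sqrt_le_1; lra.
have Hss : (sqrt z * sqrt z = z)%R by apply: sqrt_sqrt; lra.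
have Hy : (0 < Re (RtoC (z * z)))%R by rewrite /=; nra.
have Hez : exp (ln z) = z by exact: exp_ln.
have I1 := is_line_int_reflect _ 0 _ (is_line_int_reflect _ (ln z) _ (macdonald_int nu _ (or_introl
    Hy))).
have I2 := is_line_int_scal (Cexp (- (nu * ln z)) * exp (2 * z)) _ _ I1.
have I3 := is_line_int_minus _ _ _ _ I2 (gauss_half_cosh_int z Hz0).
set A := Cexp (- (nu * ln z)) * exp (2 * z) in I2 I3 *.
have E : forall u : R, A * kernel nu (z * z)%R (ln z - (0 - u)) =
   Cexp (nu * u) * exp (- (z * (half_sinh u * half_sinh u)))%R.
  move=> u; rewrite /A -(Cexp_R (2 * z)) -(Cexp_R (- (z * _))) /kernel -!Cexp_plus; congr Cexp.
  have -> : (ln z - (0 - u) = ln z + u)%R by ring.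
  rewrite exp_plus Hez half_sinh_sqr.
  rewrite !RtoC_opp !RtoC_mult !RtoC_minus !RtoC_plus.
  have -> : RtoC z * RtoC z * RtoC (exp (- (ln z + u))) = RtoC z * RtoC (exp (- u)).
    rewrite -!RtoC_mult; congr RtoC.
    rewrite Ropp_plus_distr exp_plus exp_Ropp Hez; field; lra.
  ring.
have HB : (Cmod (A * macdonald nu (z * z)%R - RtoC (sqrt PI / sqrt z))%C <= 2 * (n * K / sqrt z) /
    sqrt z)%R.
  apply: (line_int_bound _ _ (sqrt z) _ _ _ _ I3) => [|u|u]; first lra.
    apply: Rcontinuous_minus.
      apply: (@continuous_ext R_UniformSpace C_R_NormedModule (fun u => Cexp (nu * u) * RtoC (exp
          (- (z * (half_sinh u * half_sinh u)))))).
        by move=> q; rewrite E.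
      have P1 : path_derive (fun u => nu * u - RtoC (z * (half_sinh u * half_sinh u))%R) u
          (nu - RtoC (z * (2 * half_cosh u * half_sinh u))).
        apply: path_derive_minus.
          apply: (path_derive_ext (fun q => 0 + RtoC q * nu)); first by move=> q; ring.
          exact: path_derive_line.
        apply: (path_derive_RtoC (fun u => z * (half_sinh u * half_sinh u))%R).
        rewrite /half_sinh /half_cosh; auto_derive => //; rewrite /Rdiv; field.
      have P2 := path_derive_comp Cexp _ u _ _ (is_C_derive_Cexp _) P1.
      apply: (path_derive_continuous _ _ _ (path_derive_ext _ _ _ _ _ P2)) => q.
      rewrite -(Cexp_R (- (z * _))) -Cexp_plus; congr Cexp; rewrite RtoC_opp; ring.
    apply: Rcontinuous_RtoC; rewrite /half_cosh /half_sinh; by auto_derive.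
  rewrite E.
  have -> : Cexp (nu * u) * exp (- (z * (half_sinh u * half_sinh u)))%R -
      RtoC (half_cosh u * exp (- (z * (half_sinh u * half_sinh u)))) =
     ((Cexp (nu * u) - 1) - (half_cosh u - 1)%R) * exp (- (z * (half_sinh u * half_sinh u)))%R.
    rewrite RtoC_mult RtoC_minus; ring.
  rewrite Cmod_mult Cmod_R (Rabs_pos_eq (exp _)); last by left; exact: exp_pos.
  set a := Rabs u.
  have Ha : (0 <= a)%R by exact: Rabs_pos.
  have Huu : (u * u = a * a)%R by rewrite /a -Rabs_mult Rabs_pos_eq //; nra.
  have B1 : (Cmod (Cexp (nu * u) - 1)%C <= Cmod nu * a * exp (n * a))%R.
    apply: Rle_trans (Cexp_taylor0 _) _; rewrite Cmod_mult Cmod_R -/a.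
    apply: Rmult_le_compat_l; first by nra.
    apply: exp_le_compat; rewrite /n; nra.
  have B2 : (Rabs (half_cosh u - 1) <= a * exp (n * a))%R.
    have -> : (half_cosh u - 1 = ((exp (u / 2) - 1) + (exp (- (u / 2)) - 1)) / 2)%R by rewrite
        /half_cosh; field.
    rewrite Rabs_div; last lra.
    rewrite (Rabs_pos_eq 2); last lra.
    have T1 := exp_taylor0 (u / 2); have T2 := exp_taylor0 (- (u / 2)).
    have T3 := Rabs_triang (exp (u / 2) - 1) (exp (- (u / 2)) - 1).
    rewrite Rabs_Ropp in T2.
    have Hh : (Rabs (u / 2) = a / 2)%R by rewrite /a Rabs_div; [rewrite (Rabs_pos_eq 2); lra | lra].
    rewrite Hh in T1 T2.
    have HE : (exp (a / 2) <= exp (n * a))%R by apply: exp_le_compat; nra.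
    have := exp_pos (a / 2); nra.
  have B3 : (Cmod (Cexp (nu * u) - 1 - (half_cosh u - 1)%R)%C <= n * a * exp (n * a))%R.
    apply: Rle_trans (Cmod_triangle _ _) _; rewrite Cmod_opp Cmod_R.
    have He := exp_pos (n * a); set e := exp (n * a) in He B1 B2 *.
    have Hna : (0 <= Cmod nu * a * e)%R by apply: Rmult_le_pos; [nra | lra].
    have -> : (n * a * e = 3 * (Cmod nu * a * e) + a * e)%R by rewrite /n; ring.
    lra.
  (* in the scaled variable q the bound reads q e^(n q) e^(- q^2) / sqrt z *)
  set q := (sqrt z * a)%R.
  have Hq : (a <= q)%R by rewrite /q; nra.
  have B4 : (exp (- (z * (half_sinh u * half_sinh u))) <= exp (- (q * q)))%R.
    apply: exp_le_compat; have := half_sinh_sqr_ge u; rewrite Huu /q => Hh.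
    have -> : (sqrt z * a * (sqrt z * a) = z * (a * a))%R by rewrite -[in RHS]Hss; ring.
    nra.
  apply: Rle_trans (Rmult_le_compat _ _ _ _ (Cmod_ge_0 _) (Rlt_le _ _ (exp_pos _)) B3 B4) _.
  have B5 : (q * exp (n * a) * exp (- (q * q)) <= K * exp (- q))%R.
    apply: (Rle_trans _ (exp q * exp (n * q) * exp (- (q * q)))).
      apply: Rmult_le_compat_r; first by left; exact: exp_pos.
      apply: Rmult_le_compat; [lra | left; exact: exp_pos | have := exp_ineq1_le q; lra |].
      by apply: exp_le_compat; nra.
    rewrite /K -!exp_plus; apply: exp_le_compat.
    have := pow2_ge_0 (q - (n + 2) / 2); nra.
  have -> : (n * a * exp (n * a) * exp (- (q * q)) = n / sqrt z * (q * exp (n * a) * exp (- (q * q))))%R.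
    by rewrite /q; field; lra.
  have -> : (n * K / sqrt z * exp (- (sqrt z * a)) = n / sqrt z * (K * exp (- q)))%R by rewrite /q;
      field; lra.
  apply: Rmult_le_compat_l B5; apply: Rdiv_le_0_compat; lra.
have -> : A * sqrt z * macdonald nu (z * z)%R - sqrt PI =
   sqrt z * (A * macdonald nu (z * z)%R - RtoC (sqrt PI / sqrt z)).
  rewrite RtoC_div; last lra.
  field; apply: RtoC_neq_0; lra.
rewrite Cmod_mult Cmod_R Rabs_pos_eq; last lra.
apply: Rle_trans (Rmult_le_compat_l _ _ _ _ HB) _; first lra.
right; field; lra.
Qed.

(** * The Gamma function *)

(** The substitution [u = e^v]. *)
Lemma Gamma_integral_macdonald (nu : C) : (0 < Re nu)%R ->
  Gamma_integral nu = macdonald nu 0.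
Proof.
move=> Hnu.
refine (@is_RInt_gen_unique C_R_CompleteNormedModule (at_right 0) (Rbar_locally p_infty) _ _
  (fun u : R => Cexp ((nu - 1) * ln u) * exp (- u)%R) (macdonald nu 0) _).
move=> Q HQ.
have := macdonald_int nu 0 (or_intror (conj eq_refl Hnu)) Q HQ => -[Q1 Q2 [N1 H1] [N2 H2] HQ'].
apply: (Filter_prod _ _ _ (fun a => (0 < a < exp N1)%R) (fun b => (0 < b)%R /\ (exp N2 < b)%R)).
- exists (mkposreal _ (exp_pos N1)) => a Ha Ha0; split => //.
  move: Ha; rewrite /ball /= /AbsRing_ball /abs /minus /plus /opp /= Ropp_0 Rplus_0_r Rabs_pos_eq; lra.
- exists (exp N2) => b Hb; split => //; have := exp_pos N2; lra.
move=> a b [Ha Ha1] [Hb Hb1].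
have Hla : (ln a < N1)%R by rewrite -(ln_exp N1); exact: ln_increasing.
have Hlb : (N2 < ln b)%R by rewrite -(ln_exp N2); apply: ln_increasing => //; exact: exp_pos.
case: (HQ' (ln a) (ln b) (H1 _ Hla) (H2 _ Hlb)) => k [/= Hk HQk].
exists k; split => //=.
have Hpos : forall x, (Rmin a b <= x)%R -> (0 < x)%R.
  move=> x; have : (0 < Rmin a b)%R by exact: Rmin_pos.
  lra.
have HC := is_RInt_comp (V := C_R_CompleteNormedModule) (kernel nu 0) ln Rinv a b.
have HU := is_RInt_unique (V := C_R_CompleteNormedModule) _ _ _ _ Hk.
rewrite HU in HC.
apply: (is_RInt_ext (V := C_R_NormedModule)) (HC _ _) => [x Hx|x _|x Hx].
- have Hx0 : (0 < x)%R by apply: Hpos; lra.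
  have E : kernel nu 0 (ln x) = Cexp ((nu - 1) * ln x) * exp (- x)%R * x.
    rewrite -{4}(exp_ln x Hx0) -!Cexp_R /kernel -!Cexp_plus; congr Cexp.
    rewrite exp_ln // RtoC_opp; ring.
  rewrite E.
  have E2 : forall w : C, scal (/ x)%R (w : C_R_NormedModule) = RtoC (/ x) * w.
    by move=> w; apply: C_eq; rewrite /scal /= /scal /= /mult /=; rewrite /Re /Im; ring.
  rewrite E2.
  have E3 : RtoC (/ x) * (Cexp ((nu - 1) * ln x) * exp (- x)%R * x) =
      Cexp ((nu - 1) * ln x) * exp (- x)%R.
    rewrite RtoC_inv; last lra.
    field; apply: RtoC_neq_0; lra.
  exact: E3.
- exact: kernel_continuous.
- have Hx0 : (0 < x)%R by apply: Hpos; lra.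
  split; first exact: is_derive_ln.
  apply: (ex_derive_continuous Rinv); auto_derive; lra.
Qed.

Lemma Gamma_pos (nu : C) : (0 < Re nu)%R -> Gamma nu = macdonald nu 0.
Proof.
move=> Hnu; rewrite -Gamma_integral_macdonald // /Gamma.
have [_ H] := archimed (- Re nu).
have Hup : (up (- Re nu) < 1)%Z by apply: lt_IZR; lra.
by have -> : Z.to_nat (up (- Re nu)) = 0%nat by lia.
Qed.

Lemma Gamma_step (nu : C) : (Re nu <= 0)%R -> Gamma nu = Gamma (nu + 1) / nu.
Proof.
move=> Hnu; rewrite /Gamma.
have [H1 H2] := archimed (- Re nu).
have Hup : (0 < up (- Re nu))%Z by apply: lt_IZR; lra.
have -> : Re (nu + 1) = (Re nu + 1)%R by [].
have -> : up (- (Re nu + 1)) = (up (- Re nu) - 1)%Z.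
  by symmetry; apply: tech_up; rewrite minus_IZR; lra.
by have -> : Z.to_nat (up (- Re nu)) = S (Z.to_nat (up (- Re nu) - 1)) by lia.
Qed.

(** * Limits of complex-valued functions along a filter *)

Definition Clim {F : (R -> Prop) -> Prop} (f : R -> C) (l : C) : Prop :=
  forall eps, (0 < eps)%R -> F (fun r => (Cmod (f r - l)%C < eps)%R).

Arguments Clim F f l : clear implicits.

Lemma Clim_ext (F : (R -> Prop) -> Prop) (FF : Filter F) (f g : R -> C) (l : C) :
  F (fun r => f r = g r) -> Clim F f l -> Clim F g l.
Proof. by move=> H Hf eps He; apply: filter_imp (filter_and _ _ H (Hf eps He)) => r [<-]. Qed.

Lemma Clim_plus (F : (R -> Prop) -> Prop) (FF : Filter F) (f g : R -> C) (l l' : C) :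
  Clim F f l -> Clim F g l' -> Clim F (fun r => f r + g r) (l + l').
Proof.
move=> Hf Hg eps He; have He2 : (0 < eps / 2)%R by lra.
apply: filter_imp (filter_and _ _ (Hf _ He2) (Hg _ He2)) => r [H1 H2].
have -> : f r + g r - (l + l') = (f r - l) + (g r - l') by ring.
apply: Rle_lt_trans (Cmod_triangle _ _) _; lra.
Qed.

Lemma Clim_comp (F : (R -> Prop) -> Prop) (FF : Filter F) (f : C -> C) (g : R -> C) (l df : C) :
  Clim F g l -> is_C_derive f l df -> Clim F (fun r => f (g r)) (f l).
Proof.
move=> Hg /is_C_derive_continuous Hf eps He; case: (Hf eps He) => d [Hd H].
by apply: filter_imp (Hg d Hd) => r; exact: H.
Qed.

Lemma Clim_scal (F : (R -> Prop) -> Prop) (FF : Filter F) (f : R -> C) (c l : C) :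
  Clim F f l -> Clim F (fun r => c * f r) (c * l).
Proof.
move=> Hf; apply: (Clim_comp F FF (fun z => c * z) f l _ Hf).
exact: is_C_derive_scal _ _ _ _ (is_C_derive_id l).
Qed.

Lemma Clim_mult (F : (R -> Prop) -> Prop) (FF : Filter F) (f g : R -> C) (l l' : C) :
  Clim F f l -> Clim F g l' -> Clim F (fun r => f r * g r) (l * l').
Proof.
move=> Hf Hg eps He.
have Hl := Cmod_ge_0 l; have Hl' := Cmod_ge_0 l'.
set d := Rmin 1 (eps / (2 * (1 + Cmod l + Cmod l')))%R.
have Hd : (0 < d)%R by apply: Rmin_pos; [lra | apply: Rdiv_lt_0_compat; lra].
have Hd1 : (d <= 1)%R by exact: Rmin_l.
have Hd2 : (d * (2 * (1 + Cmod l + Cmod l')) <= eps)%R.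
  apply: (Rmult_le_reg_r (/ (2 * (1 + Cmod l + Cmod l')))); first by apply: Rinv_0_lt_compat; lra.
  rewrite Rmult_assoc Rinv_r; last lra.
  rewrite Rmult_1_r; exact: Rmin_r.
apply: filter_imp (filter_and _ _ (Hf d Hd) (Hg d Hd)) => r [H1 H2].
have -> : f r * g r - l * l' = (f r - l) * (g r - l') + l * (g r - l') + (f r - l) * l' by ring.
apply: Rle_lt_trans (Cmod_triangle _ _) _.
have T := Cmod_triangle ((f r - l) * (g r - l')) (l * (g r - l')).
rewrite !Cmod_mult in T *.
have P1 := Cmod_ge_0 (f r - l); have P2 := Cmod_ge_0 (g r - l').
set x := Cmod (f r - l) in H1 P1 T *; set y := Cmod (g r - l') in H2 P2 T *.
have : (x * y <= d * 1)%R by apply: Rmult_le_compat; lra.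
nra.
Qed.

Lemma Clim_unique (F : (R -> Prop) -> Prop) (FF : ProperFilter F) (f : R -> C) (l l' : C) :
  Clim F f l -> Clim F f l' -> l = l'.
Proof.
move=> H H'.
have E : l - l' = 0.
  apply: Cmod_eq_0; apply: Rle_antisym; last exact: Cmod_ge_0.
  apply: le_epsilon => eps He; rewrite Rplus_0_l.
  have He2 : (0 < eps / 2)%R by lra.
  case: (filter_ex _ (filter_and _ _ (H _ He2) (H' _ He2))) => r [H1 H2].
  have -> : l - l' = (f r - l') - (f r - l) by ring.
  apply: Rle_trans (Cmod_triangle _ _) _; rewrite Cmod_opp; lra.
have -> : l = (l - l') + l' by ring.
rewrite E; ring.
Qed.

Lemma Clim_Cexp_minf (c : C) : (0 < Re c)%R ->
  Clim (Rbar_locally m_infty) (fun w => Cexp (c * RtoC w)) 0.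
Proof.
move=> Hc eps He.
case: (exp_decay (Re c) 1 eps Hc ltac:(lra) He) => N [_ HN].
exists (- N)%R => w Hw.
have -> : Cexp (c * w) - 0 = Cexp (c * w) by ring.
rewrite Cmod_Cexp.
have -> : Re (c * w) = (Re c * w)%R by case: (c) => a b /=; ring.
apply: Rle_lt_trans HN; rewrite Rmult_1_l; apply: exp_le_compat; nra.
Qed.

(** * The connection formula *)

Lemma is_C_derive_vanishing (f : C -> C) (r : R) (l : C) :
  is_C_derive f (RtoC r) l -> (forall q : R, f (RtoC q) = 0) -> l = 0.
Proof.
move=> /is_C_derive_eps H Hz.
apply: Cmod_eq_0; apply: Rle_antisym; last exact: Cmod_ge_0.
apply: le_epsilon => eps He; rewrite Rplus_0_l.
case: (H eps He) => d [Hd Hd'].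
have := Hd' (RtoC (r + d / 2)).
rewrite !Hz RtoC_plus.
have -> : RtoC r + RtoC (d / 2) - RtoC r = RtoC (d / 2) by ring.
have -> : 0 - 0 - RtoC (d / 2) * l = - (RtoC (d / 2) * l) by ring.
rewrite Cmod_opp Cmod_mult Cmod_R Rabs_pos_eq; last lra.
move=> H1; have := H1 ltac:(lra); nra.
Qed.

Definition nonintegral (nu : C) : Prop := forall n : Z, nu <> IZR n.

Lemma nonintegral_opp (nu : C) : nonintegral nu -> nonintegral (- nu).
Proof.
move=> H n E; apply: (H (- n)%Z); rewrite opp_IZR RtoC_opp -E; ring.
Qed.

Lemma nonintegral_plus (nu : C) (k : Z) : nonintegral nu -> nonintegral (nu + IZR k).
Proof.
move=> H n E; apply: (H (n - k)%Z); rewrite minus_IZR RtoC_minus -E; ring.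
Qed.

Lemma nonintegral_nonresonant (nu : C) : nonintegral nu -> nonresonant nu.
Proof.
move=> H k E; apply: (H (- (1 + Z.of_nat k))%Z).
rewrite opp_IZR plus_IZR -INR_IZR_INZ RtoC_opp RtoC_plus.
have -> : nu = (nu + 1 + INR k) - (1 + INR k) by ring.
rewrite E; ring.
Qed.

Lemma nonintegral_neq_0 (nu : C) : nonintegral nu -> nu <> 0.
Proof. by move=> H; apply: (H 0%Z). Qed.

(** On the half-line [y > 0] the solutions regular and irregular at the origin are
    [clifford (- nu) y] and [y^nu clifford nu y]; writing [y = Cexp w] with [w] real fixes the
    determination of [y^nu]. *)
Definition connected (nu a b : C) : Prop := forall w : R,
  macdonald nu (Cexp w) = b * clifford (- nu) (Cexp w) + a * Cexp (nu * w) * clifford nu (Cexp w).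

Lemma macdonald_solves (m : nat) (p : C) (t : R) : (1 <= m)%nat ->
  solves_at m ((p ^ 2 - 1) / 4) (lift m (- p) (macdonald (p / INR m)))
    (dlift m (- p) (macdonald (p / INR m)) (fun y => - macdonald (p / INR m - 1) y)) t.
Proof.
move=> Hm; have Hm0 := INR_neq_0_C m Hm.
have -> : p ^ 2 = (- p) ^ 2 by ring.
have Hmp : (0 < INR m)%R by apply: lt_0_INR; lia.
have Hy : (0 < Re (clifford_var m t))%R.
  rewrite /clifford_var -RtoC_mult Cexp_R -RtoC_pow -RtoC_div /=.
    apply: Rdiv_lt_0_compat; [exact: exp_pos | nra].
  nra.
have H := macdonald_recurrence (p / INR m - 1) _ Hy.
apply: (lift_solves m (- p) (- - macdonald (p / INR m - 1 - 1) (clifford_var m t))) => //.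
- exact: is_C_derive_macdonald.
- apply: is_C_derive_opp; exact: is_C_derive_macdonald.
have -> : macdonald (p / INR m) (clifford_var m t) = macdonald (p / INR m - 1 + 1) (clifford_var m t).
  by congr macdonald; ring.
rewrite H; field; exact: Hm0.
Qed.

(** In degree [1] one has [y = x], and Cramer's rule applies to [lift 1 (- nu)]. *)
Lemma connected_ex (nu : C) : nonintegral nu -> exists a b, connected nu a b.
Proof.
move=> Hnu.
have Hp := nonintegral_nonresonant nu Hnu.
have Hn := nonintegral_nonresonant _ (nonintegral_opp nu Hnu).
have Hnu0 := nonintegral_neq_0 nu Hnu.
have E1 : forall z : C, z / INR 1 = z by move=> z /=; field.
have V1 : forall w : R, clifford_var 1 w = Cexp w.
  move=> w; rewrite /clifford_var [INR 1]/=; have -> : 1 * RtoC w = w by ring.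
  field.
pose f1 := frob 1 nu; pose df1 := dfrob 1 nu; pose f2 := frob 1 (- nu); pose df2 := dfrob 1 (- nu).
pose U := lift 1 (- nu) (macdonald (nu / INR 1)).
pose dU := dlift 1 (- nu) (macdonald (nu / INR 1)) (fun y => - macdonald (nu / INR 1 - 1) y).
have S1 : forall t, solves_at 1 ((nu ^ 2 - 1) / 4) f1 df1 t.
  by move=> t; apply: frob_solves => //; rewrite E1.
have S2 : forall t, solves_at 1 ((nu ^ 2 - 1) / 4) f2 df2 t.
  move=> t; have -> : nu ^ 2 = (- nu) ^ 2 by ring.
  by apply: frob_solves => //; rewrite E1.
have SU : forall t : R, solves_at 1 ((nu ^ 2 - 1) / 4) U dU t by move=> t; exact: macdonald_solves.
have W12 : forall t, wronskian f1 df1 f2 df2 t = - nu.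
  by move=> t; apply: frob_wronskian => //; rewrite E1.
exists (wronskian U dU f2 df2 0 / - nu), (wronskian f1 df1 U dU 0 / - nu) => w.
have := cramer f1 df1 f2 df2 U dU w; rewrite W12.
rewrite (wronskian_const_R 1 ((nu ^ 2 - 1) / 4) U dU f2 df2 w 0) // (wronskian_const_R 1 ((nu ^ 2 -
    1) / 4) f1 df1 U dU w 0) //.
set A := wronskian U dU f2 df2 0; set B := wronskian f1 df1 U dU 0.
rewrite /U /f1 /f2 /frob /lift !E1 V1.
have -> : Cexp (s_exp nu * w) = Cexp (s_exp (- nu) * w) * Cexp (nu * w).
  rewrite -Cexp_plus; congr Cexp; rewrite /s_exp; field.
have He := Cexp_neq_0 (s_exp (- nu) * w); set e := Cexp (s_exp (- nu) * w) in He *.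
move=> H.
have -> : macdonald nu (Cexp w) = (- nu * (e * macdonald nu (Cexp w))) / (- nu * e) by field; split.
rewrite H; field; by split.
Qed.

(** The combination and its derivative vanish, and the Wronskian [- nu] does not. *)
Lemma clifford_zero_combination (nu a b : C) : nonintegral nu ->
  (forall w : R, b * clifford (- nu) (Cexp w) + a * Cexp (nu * w) * clifford nu (Cexp w) = 0) ->
  a = 0 /\ b = 0.
Proof.
move=> Hnu Hz.
have Hp := nonintegral_nonresonant nu Hnu.
have Hn := nonintegral_nonresonant _ (nonintegral_opp nu Hnu).
have Hnu0 := nonintegral_neq_0 nu Hnu.
have E1 : forall z : C, z / INR 1 = z by move=> z /=; field.
have V1 : forall w : R, clifford_var 1 w = Cexp w.
  move=> w; rewrite /clifford_var [INR 1]/=; have -> : 1 * RtoC w = w by ring.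
  field.
have S1 := frob_solves 1 nu 0 (Nat.le_refl 1) ltac:(rewrite E1; exact: Hp).
have S2 := frob_solves 1 (- nu) 0 (Nat.le_refl 1) ltac:(rewrite E1; exact: Hn).
have Esq : (- nu) ^ 2 = nu ^ 2 by ring.
rewrite Esq in S2.
have W12 := frob_wronskian 1 nu 0 (Nat.le_refl 1) ltac:(rewrite E1; exact: Hp) ltac:(rewrite E1;
    exact: Hn).
have Z : forall q : R, a * frob 1 nu q + b * frob 1 (- nu) q = 0.
  move=> q; rewrite /frob /lift !E1 V1.
  have -> : Cexp (s_exp nu * q) = Cexp (s_exp (- nu) * q) * Cexp (nu * q).
    rewrite -Cexp_plus; congr Cexp; rewrite /s_exp; field.
  transitivity (Cexp (s_exp (- nu) * q) *
    (b * clifford (- nu) (Cexp q) + a * Cexp (nu * q) * clifford nu (Cexp q))); first by ring.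
  rewrite Hz; ring.
have [D _] := solves_at_lin 1 _ a b _ _ _ _ _ S1 S2.
have Z' := is_C_derive_vanishing _ 0 _ D Z.
rewrite Cexp_0 Cmult_1_l in Z'.
have Z0 := Z 0%R.
move: W12 Z0 Z'; rewrite /wronskian.
set f := frob 1 nu 0; set f' := dfrob 1 nu 0; set g := frob 1 (- nu) 0; set g' := dfrob 1 (- nu) 0.
move=> W12 Z0 Z'.
split.
- have -> : a = ((a * f + b * g) * g' - (a * f' + b * g') * g) / (f * g' - f' * g).
    field; rewrite W12 => E; apply: Hnu0; rewrite -[nu]Copp_involutive E; ring.
  rewrite Z0 Z' W12; field; exact: Hnu0.
- have -> : b = ((a * f' + b * g') * f - (a * f + b * g) * f') / (f * g' - f' * g).
    field; rewrite W12 => E; apply: Hnu0; rewrite -[nu]Copp_involutive E; ring.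
  rewrite Z0 Z' W12; field; exact: Hnu0.
Qed.

Lemma connected_unique (nu a b a' b' : C) : nonintegral nu ->
  connected nu a b -> connected nu a' b' -> a = a' /\ b = b'.
Proof.
move=> Hnu H H'.
case: (clifford_zero_combination nu (a - a') (b - b') Hnu) => [w|E1 E2].
  transitivity (macdonald nu (Cexp w) - macdonald nu (Cexp w)); last ring.
  rewrite {1}H H'; ring.
split; [have -> : a = (a - a') + a' by ring | have -> : b = (b - b') + b' by ring];
  rewrite ?E1 ?E2; ring.
Qed.

Lemma Clim_Cexp_0 : Clim (Rbar_locally m_infty) (fun w => Cexp (RtoC w)) 0.
Proof.
apply: (Clim_ext _ _ (fun w => Cexp (1 * RtoC w))).
  by apply: filter_forall => w; congr Cexp; ring.
apply: Clim_Cexp_minf => /=; lra.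
Qed.

(** As [y -> 0] the second term tends to zero and [macdonald nu y] to [Gamma nu]. *)
Lemma connected_pos (nu a b : C) : (0 < Re nu)%R -> connected nu a b -> b = Gamma nu.
Proof.
move=> Hnu H; rewrite Gamma_pos //.
apply: (Clim_unique (Rbar_locally m_infty) _ (fun w => macdonald nu (Cexp (RtoC w)))).
- have -> : b = b * clifford (- nu) 0 + a * 0 * clifford nu 0 by rewrite clifford_0; ring.
  apply: (Clim_ext _ _ (fun w => b * clifford (- nu) (Cexp (RtoC w)) +
      a * Cexp (nu * RtoC w) * clifford nu (Cexp (RtoC w)))).
    by apply: filter_forall => w; rewrite H.
  apply: Clim_plus.
    apply: Clim_scal; exact: Clim_comp Clim_Cexp_0 (is_C_derive_clifford _ _).
  apply: Clim_mult; last exact: Clim_comp Clim_Cexp_0 (is_C_derive_clifford _ _).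
  apply: Clim_scal; exact: Clim_Cexp_minf.
- move=> eps He; case: (macdonald_limit_0 nu Hnu eps He) => W HW; exists W => w Hw.
  rewrite Cexp_R; exact: HW.
Qed.

(** Differentiation with respect to [y] lowers the index on both sides; [b] is transformed as
    [Gamma nu] by the functional equation. *)
Lemma connected_pred (nu a b : C) : nonintegral nu -> connected nu a b ->
  connected (nu - 1) (- (nu * a)) (b / (nu - 1)).
Proof.
move=> Hnu H w.
have Hnu0 := nonintegral_neq_0 nu Hnu.
have Hm1 : nonintegral (nu - 1).
  have -> : nu - 1 = nu + IZR (-1) by ring.
  exact: nonintegral_plus.
have Hm0 := nonintegral_neq_0 _ Hm1.
have Hp1 : nu + 1 <> 0 by exact: (nonintegral_neq_0 _ (nonintegral_plus nu 1 Hnu)).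
have Hy : (0 < Re (Cexp w))%R by rewrite Cexp_R; exact: exp_pos.
have De := is_C_derive_Cexp w.
have D1 := is_C_derive_comp _ _ _ _ _ (is_C_derive_macdonald nu _ Hy) De.
have D2 := is_C_derive_scal _ b _ _ (is_C_derive_comp _ _ _ _ _ (is_C_derive_clifford (- nu) (Cexp
    w)) De).
have D3 := is_C_derive_mult _ _ _ _ _ (is_C_derive_scal _ a _ _ (is_C_derive_Cexp_lin nu w))
   (is_C_derive_comp _ _ _ _ _ (is_C_derive_clifford nu (Cexp w)) De).
have D := is_C_derive_minus _ _ _ _ _ D1 (is_C_derive_plus _ _ _ _ _ D2 D3).
have Z0 : forall q : R, macdonald nu (Cexp q) - (b * clifford (- nu) (Cexp q) +
    a * Cexp (nu * q) * clifford nu (Cexp q)) = 0 by move=> q; rewrite H; ring.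
have Z := is_C_derive_vanishing _ w _ D Z0.
have HC := clifford_contiguity (nu - 1) (Cexp w) (nonintegral_nonresonant _ Hm1).
have Ea : nu - 1 + 1 = nu by ring.
rewrite !Ea in HC.
have -> : - (nu - 1) = - nu + 1 by ring.
have -> : Cexp ((nu - 1) * w) = Cexp (nu * w) / Cexp w.
  rewrite /Cdiv -Cexp_opp -Cexp_plus; congr Cexp; ring.
rewrite HC; move: Z.
have He := Cexp_neq_0 w; set e := Cexp w in He *.
have Hq : - nu + 1 <> 0.
  by move=> E; apply: Hm0; rewrite -[nu - 1]Copp_involutive; have -> : - (nu - 1) = - nu + 1 by
      [ring]; rewrite E; ring.
move=> Z.
have -> : macdonald (nu - 1) e = - (- macdonald (nu - 1) e * e) / e by field.
set rhs := b * (/ (- nu + 1) * clifford (- nu + 1) e * e) +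
  (a * (nu * Cexp (nu * w)) * clifford nu e +
   a * Cexp (nu * w) * (/ (nu + 1) * clifford (nu + 1) e * e)).
have {}Z : - macdonald (nu - 1) e * e - rhs = 0 by exact: Z.
have -> : - macdonald (nu - 1) e * e = (- macdonald (nu - 1) e * e - rhs) + rhs by ring.
rewrite Z /rhs.
field; by repeat split.
Qed.

Lemma connected_sym (nu a b : C) : connected nu a b -> connected (- nu) b a.
Proof.
move=> H w; rewrite Cexp_R macdonald_sym Copp_involutive -Cexp_R H.
have He : Cexp (nu * w) * Cexp (- nu * w) = 1.
  rewrite -Cexp_plus -[RHS]Cexp_0; congr Cexp; ring.
transitivity (b * Cexp (- nu * w) * clifford (- nu) (Cexp w) +
  a * (Cexp (nu * w) * Cexp (- nu * w)) * clifford nu (Cexp w)); first by ring.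
rewrite He; ring.
Qed.

(** Both [Gamma] and, by [connected_pred], the coefficient [b] are continued to the left one unit
    at a time. *)
Lemma connected_Gamma_right (n : nat) (nu a b : C) :
  (- INR n < Re nu)%R -> nonintegral nu -> connected nu a b -> b = Gamma nu.
Proof.
elim: n nu a b => [|n IH] nu a b Hn Hnu H.
  by apply: connected_pos H; move: Hn; rewrite /= Ropp_0.
case: (Rlt_dec 0 (Re nu)) => Hpos; first exact: connected_pos H.
have Hnu1 : nonintegral (nu + 1) by exact: (nonintegral_plus nu 1).
case: (connected_ex _ Hnu1) => a' [b' H'].
have Hb' : b' = Gamma (nu + 1).
  apply: (IH _ a') => //; rewrite S_INR in Hn.
  have -> : Re (nu + 1) = (Re nu + 1)%R by [].
  lra.
have H2 := connected_pred _ _ _ Hnu1 H'.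
have E : nu + 1 - 1 = nu by ring.
rewrite !E in H2.
case: (connected_unique nu _ _ _ _ Hnu H H2) => _ ->.
by rewrite Hb' [RHS]Gamma_step //; lra.
Qed.

(** The symmetry [nu -> - nu] deduces the left coefficient from the right one. *)
Lemma macdonald_connection (nu : C) : nonintegral nu ->
  connected nu (Gamma (- nu)) (Gamma nu).
Proof.
move=> Hnu.
have HG : forall nu a b, nonintegral nu -> connected nu a b -> b = Gamma nu.
  move=> {Hnu} nu' a b; case: (nfloor_ex (Rabs (Re nu')) (Rabs_pos _)) => n [_ Hn].
  apply: (connected_Gamma_right (S n)); rewrite S_INR.
  have := Rle_abs (- Re nu'); rewrite Rabs_Ropp; lra.
case: (connected_ex nu Hnu) => a [b H].
rewrite -(HG _ _ _ Hnu H) -(HG _ _ _ (nonintegral_opp _ Hnu) (connected_sym _ _ _ H)).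
exact: H.
Qed.

(** * The equation for [a' = 0] *)

Lemma coord_last_only (m : nat) (am : C) (j : nat) : (1 <= j <= m)%nat ->
  coord (last_only m am) j = if Nat.eqb j m then am else RtoC 0.
Proof.
move=> Hj; rewrite /coord /last_only /mk_Cvec coeff_Tn_bij; last lia.
by have -> : S (j - 1) = j by lia.
Qed.

Lemma Pm_last_only (m : nat) (am x : C) : (1 <= m)%nat ->
  Pm (last_only m am) x = x ^ m + am.
Proof.
move=> Hm; rewrite /Pm /Csum; congr (_ + _).
case: m Hm => [|m] Hm; first lia.
rewrite sum_n_Sm; last lia.
rewrite (sum_n_m_ext_loc _ (fun _ => zero)); last first.
  move=> k Hk; rewrite coord_last_only; last lia.
  have -> : Nat.eqb k (S m) = false by apply/Nat.eqb_neq; lia.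
  by rewrite Cmult_0_l.
rewrite sum_n_m_const_zero coord_last_only; last lia.
rewrite Nat.eqb_refl Nat.sub_diag /plus /zero /=; ring.
Qed.

Lemma act_last_only (m : nat) (am tau : C) : (1 <= m)%nat -> tau ^ m = 1 ->
  act tau (last_only m am) = last_only m am.
Proof.
move=> Hm Ht; rewrite /act {2}/last_only /mk_Cvec; apply/mk_Tn_ext => i Hi.
rewrite coord_last_only; last lia.
case: (Nat.eqb_spec (S i) m) => [->|_]; [rewrite Ht; ring | ring].
Qed.

Lemma solution_last_only (m : nat) (am : C) (F : C -> C) : (1 <= m)%nat ->
  is_solution (last_only m am) F -> exists dF, forall t, solves_at m am F dF t.
Proof.
move=> Hm [dF H]; exists dF => t; case: (H t) => H1 H2; split => //.
by rewrite Pm_last_only // in H2.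
Qed.

Lemma Cmod_sqr_le (u v : C) (x : R) :
  (Cmod u <= x)%R -> (Cmod v <= x)%R -> (Cmod (u * v) <= x * x)%R.
Proof.
by move=> Hu Hv; rewrite Cmod_mult; apply: Rmult_le_compat => //; exact: Cmod_ge_0.
Qed.

(** For [a' = 0] the square of the expansion is [1 + a_m x^(-m)], so that no intermediate
    power occurs in the square root: a first nonzero coefficient of index [0 < k < m] would give
    the square a nonzero coefficient of the same index. *)
Lemma sqrt_expansion_gap (m : nat) (am : C) (b : nat -> C) : (1 <= m)%nat ->
  is_sqrt_expansion (last_only m am) b ->
  forall k, (1 <= k < m)%nat -> b k = 0.
Proof.
move=> Hm [Hb0 [T HT]].
pose r0 := exp (- (T + 1)).
have Hr0 : (0 < r0)%R by exact: exp_pos.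
have Hser : forall t : R, (T < t)%R -> exists B,
    Cseries (fun k => b k * RtoC (exp (- t)) ^ k) B /\ B * B = 1 + am * RtoC (exp (- t)) ^ m.
  move=> t Ht; case: (HT (RtoC t) Ht) => w [Hw Hs].
  rewrite Pm_last_only // in Hw.
  exists (Cexp (- ((INR m / 2 - 1) * t)) * w); split.
    apply: Cseries_ext (Cseries_scal (Cexp (- ((INR m / 2 - 1) * t))) _ _ Hs) => k.
    rewrite -Cexp_R Cexp_pow.
    transitivity (b k * (Cexp (- ((INR m / 2 - 1) * t)) * Cexp ((INR m / 2 - INR k - 1) * t)));
        first by ring.
    rewrite -Cexp_plus; congr (_ * Cexp _); rewrite RtoC_opp; ring.
  set e := Cexp (- ((INR m / 2 - 1) * t)).
  have He : e * e = Cexp t ^ 2 / Cexp t ^ m.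
    have E2 : RtoC (INR 2) = 2 by rewrite /= RtoC_plus; ring.
    rewrite [RHS]/Cdiv !Cexp_pow -Cexp_opp -!Cexp_plus E2; congr Cexp; field.
  transitivity (e * e * (w * w)); first by ring.
  rewrite He Hw.
  have -> : RtoC (exp (- t)) = / Cexp t by rewrite -Cexp_R RtoC_opp Cexp_opp.
  have Hne := Cexp_neq_0 t.
  rewrite Cpow_inv //; field; split => //; exact: Cpow_nz.
case: (Hser (T + 1)%R ltac:(lra)) => B0 [HB0 _].
case: (pseries_remainder b r0 B0 Hr0 HB0) => M [HM0 HM].
move=> k; elim/(well_founded_ind Wf_nat.lt_wf): k => k IH Hk.
set L := (Cmod am + 2 * M * (/ r0) ^ S k + (Cmod (b k) + M * (/ r0) ^ S k) * (Cmod (b k) + M * (/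
    r0) ^ S k))%R.
have Hi : (0 < / r0)%R by exact: Rinv_0_lt_compat.
have Hik : (0 < (/ r0) ^ S k)%R by apply: pow_lt.
have HL : (0 <= L)%R.
  have H1 := Cmod_ge_0 am; have H2 := Rle_0_sqr (Cmod (b k) + M * (/ r0) ^ S k).
  have H3 : (0 <= M * (/ r0) ^ S k)%R by apply: Rmult_le_pos; lra.
  rewrite /L; rewrite /Rsqr in H2; lra.
have key : forall xi, (0 < xi)%R -> (xi <= r0 / 2)%R -> (xi <= 1)%R -> (2 * Cmod (b k) <= L * xi)%R.
  move=> xi Hxi Hx1 Hx2.
  have Ht : (T < - ln xi)%R.
    have : (ln xi < ln r0)%R by apply: ln_increasing; lra.
    rewrite /r0 ln_exp; lra.
  case: (Hser _ Ht) => B [HB HBB].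
  rewrite Ropp_involutive exp_ln // in HB HBB.
  have Hxm : Cmod (RtoC xi) = xi by rewrite Cmod_R Rabs_pos_eq; lra.
  have HR := HM k (RtoC xi) B ltac:(rewrite Hxm; lra) HB
    (fun j Hj => IH j ltac:(lia) ltac:(lia)) ltac:(lia).
  rewrite Hb0 Hxm in HR.
  set d := B - 1 - b k * RtoC xi ^ k in HR.
  have Hxk : (0 < xi ^ k)%R by exact: pow_lt.
  have Hd : (Cmod d <= M * (/ r0) ^ S k * xi ^ S k)%R.
    apply: Rle_trans HR _; right; rewrite /Rdiv Rpow_mult_distr; ring.
  have E : 2 * (b k * RtoC xi ^ k) = am * RtoC xi ^ m + (- (2 * d) + - ((b k * RtoC xi ^ k + d) *
      (b k * RtoC xi ^ k + d))).
    have -> : am * RtoC xi ^ m = B * B - 1 by rewrite HBB; ring.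
    rewrite /d; ring.
  have Hle : (2 * (Cmod (b k) * xi ^ k) <= L * xi ^ S k)%R.
    have -> : (2 * (Cmod (b k) * xi ^ k) = Cmod (2 * (b k * RtoC xi ^ k))%C)%R.
      by rewrite !Cmod_mult Cmod_pow Hxm Cmod_R Rabs_pos_eq //; lra.
    rewrite E; apply: Rle_trans (Cmod_triangle _ _) _.
    have T1 := Cmod_triangle (- (2 * d)) (- ((b k * RtoC xi ^ k + d) * (b k * RtoC xi ^ k + d))).
    have A1 : (Cmod (am * RtoC xi ^ m)%C <= Cmod am * xi ^ S k)%R.
      rewrite Cmod_mult Cmod_pow Hxm; apply: Rmult_le_compat_l; first exact: Cmod_ge_0.
      have -> : m = (S k + (m - S k))%nat by lia.
      rewrite pow_add -[X in (_ <= X)%R]Rmult_1_r; apply: Rmult_le_compat_l.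
        left; exact: pow_lt.
      rewrite -(pow1 (m - S k)); apply: pow_incr; lra.
    have A2 : (Cmod (- (2 * d))%C <= 2 * M * (/ r0) ^ S k * xi ^ S k)%R.
      rewrite Cmod_opp Cmod_mult Cmod_R Rabs_pos_eq; lra.
    have A0 : (Cmod (b k * RtoC xi ^ k + d)%C <= (Cmod (b k) + M * (/ r0) ^ S k) * xi ^ k)%R.
      apply: Rle_trans (Cmod_triangle _ _) _; rewrite Cmod_mult Cmod_pow Hxm.
      have : (xi ^ S k <= xi ^ k)%R by rewrite /=; nra.
      have : (0 <= M * (/ r0) ^ S k)%R by nra.
      nra.
    have A3 : (Cmod (- ((b k * RtoC xi ^ k + d) * (b k * RtoC xi ^ k + d)))%C <=
        (Cmod (b k) + M * (/ r0) ^ S k) * (Cmod (b k) + M * (/ r0) ^ S k) * xi ^ S k)%R.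
      rewrite Cmod_opp; apply: Rle_trans (Cmod_sqr_le _ _ _ A0 A0) _.
      have Hkk : (xi ^ k * xi ^ k <= xi ^ S k)%R.
        rewrite /=; apply: Rmult_le_compat_r; first lra.
        case: k Hk IH L Hik HL Hxk {HR d Hd E T1 A1 A2 A0} => [|k] Hk *; first lia.
        rewrite /=; have : (xi ^ k <= 1)%R by rewrite -(pow1 k); apply: pow_incr; lra.
        nra.
      have Hq := Rle_0_sqr (Cmod (b k) + M * (/ r0) ^ S k); rewrite /Rsqr in Hq.
      set q := ((Cmod (b k) + M * (/ r0) ^ S k) * (Cmod (b k) + M * (/ r0) ^ S k))%R in Hq *.
      apply: (Rle_trans _ (q * (xi ^ k * xi ^ k))); first by right; rewrite /q; ring.
      exact: Rmult_le_compat_l.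
    rewrite /L; lra.
  apply: (Rmult_le_reg_r (xi ^ k)) => //.
  have -> : (L * xi * xi ^ k = L * xi ^ S k)%R by rewrite /=; ring.
  lra.
apply: Cmod_eq_0; apply: Rle_antisym; last exact: Cmod_ge_0.
apply: le_epsilon => eps He; rewrite Rplus_0_l.
set xi := Rmin (Rmin (r0 / 2) 1) (eps / (L + 1)).
have Hxi : (0 < xi)%R.
  by apply: Rmin_pos; [apply: Rmin_pos; lra | apply: Rdiv_lt_0_compat; lra].
have X1 : (xi <= Rmin (r0 / 2) 1)%R by exact: Rmin_l.
have X2 : (xi <= eps / (L + 1))%R by exact: Rmin_r.
have X3 := Rmin_l (r0 / 2) 1; have X4 := Rmin_r (r0 / 2) 1.
have := key xi Hxi ltac:(lra) ltac:(lra).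
have : ((L + 1) * xi <= eps)%R.
  apply: (Rmult_le_reg_r (/ (L + 1))); first by apply: Rinv_0_lt_compat; lra.
  have -> : ((L + 1) * xi * / (L + 1) = xi)%R by field; lra.
  exact: X2.
nra.
Qed.

(** The leading behaviour [x^r e^{-S}] for [a' = 0]. *)
Definition lead (m : nat) (t : C) : C :=
  Cexp ((1 / 2 - INR m / 4) * t) * Cexp (- (2 / INR m * Cexp (INR m / 2 * t))).

Lemma lead_neq_0 (m : nat) (t : C) : lead m t <> 0.
Proof. apply: Cmult_neq_0; exact: Cexp_neq_0. Qed.

Lemma lead_last_only (m : nat) (am : C) (b : nat -> C) (t : C) : (1 <= m)%nat ->
  is_sqrt_expansion (last_only m am) b ->
  Cexp (r_exp m b * t) * Cexp (- S_exp m b t) = lead m t.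
Proof.
move=> Hm Hb; have Hgap := sqrt_expansion_gap m am b Hm Hb.
rewrite /lead; congr (Cexp _ * Cexp (- _)).
- congr (_ * _); rewrite /r_exp; case E : (Nat.even m) => //.
  case/Nat.even_spec: E => q Hq.
  have Hq2 : (m / 2 = q)%nat by rewrite Hq Nat.mul_comm Nat.div_mul.
  rewrite Hq2 Hgap; [ring | lia].
- rewrite /S_exp /Csum (sum_n_m_ext_loc _ (fun _ => zero)).
    rewrite sum_n_m_const_zero /zero /=; ring.
  move=> k Hk.
  have Hk2 : (k <= (m - 1) / 2)%nat by lia.
  have := Nat.Div0.mul_div_le (m - 1) 2 => Hd.
  rewrite Hgap; last lia.
  rewrite /Cdiv; rewrite /zero /=; ring.
Qed.

(** * The recessive solution for a general degree *)

Lemma Clim_p_infty_decay (F : R -> C) (l : C) (c K T : R) : (0 < c)%R ->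
  (forall t, (T < t)%R -> (Cmod (F t - l)%C <= K * exp (- (c * t)))%R) ->
  Clim (Rbar_locally p_infty) F l.
Proof.
move=> Hc H eps He.
case: (exp_decay c (Rabs K) eps Hc (Rabs_pos _) He) => N [_ HN].
exists (Rmax T N) => t Ht.
have H1 := Rmax_l T N; have H2 := Rmax_r T N.
apply: Rle_lt_trans (H t _) _; first lra.
apply: Rle_lt_trans HN.
apply: Rle_trans (_ : (Rabs K * exp (- (c * t)) <= _)%R).
  apply: Rmult_le_compat_r; [left; exact: exp_pos | exact: Rle_abs].
apply: Rmult_le_compat_l; first exact: Rabs_pos.
apply: exp_le_compat; nra.
Qed.

(** The constant normalizes the behaviour at infinity to [x^r e^{-S}]. *)
Definition recessive (m : nat) (p t : C) : C :=
  Cexp (p / INR m * ln (INR m)) / sqrt (INR m * PI)%R *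
  lift m (- p) (macdonald (p / INR m)) t.

Lemma sqrt_mPI (m : nat) : (1 <= m)%nat ->
  RtoC (sqrt (INR m * PI)) = RtoC (sqrt (INR m)) * RtoC (sqrt PI) /\
  RtoC (sqrt (INR m)) <> 0 /\ RtoC (sqrt PI) <> 0.
Proof.
move=> Hm; have Hmp : (0 < INR m)%R by apply: lt_0_INR; lia.
split; first by rewrite sqrt_mult; [rewrite RtoC_mult | lra | have := PI_RGT_0; lra].
split; apply: RtoC_neq_0; have := sqrt_PI_pos; have := sqrt_lt_R0 _ Hmp; lra.
Qed.

Lemma recessive_limit (m : nat) (p : C) : (1 <= m)%nat ->
  Clim (Rbar_locally p_infty) (fun t => recessive m p (RtoC t) / lead m (RtoC t)) 1.
Proof.
move=> Hm; have Hmp : (0 < INR m)%R by apply: lt_0_INR; lia.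
have Hm0 := INR_neq_0_C m Hm.
case: (sqrt_mPI m Hm) => Hs [Hs1 Hs2].
set M := INR m in Hmp Hm0 Hs Hs1 *.
have HM1 : (1 <= M)%R by apply: (le_INR 1 m).
case: (macdonald_asymptotic (p / M)) => K HK.
pose z t := (exp (M * t / 2) / M)%R.
have Hz : forall t, (0 < z t)%R by move=> t; apply: Rdiv_lt_0_compat => //; exact: exp_pos.
have Hsz : forall t, sqrt (z t) = (exp (M * t / 4) / sqrt M)%R.
  move=> t; rewrite /z sqrt_div_alt //; congr (_ / _)%R.
  have -> : (exp (M * t / 2) = exp (M * t / 4) * exp (M * t / 4))%R.
    by rewrite -exp_plus; congr exp; field.
  apply: sqrt_square; left; exact: exp_pos.
have E : forall t : R, recessive m p t / lead m t = / sqrt PI *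
    (Cexp (- (p / M * ln (z t))) * exp (2 * z t) * sqrt (z t) * macdonald (p / M) (z t * z t)%R).
  move=> t.
  have Hln : ln (z t) = (M * t / 2 - ln M)%R.
    rewrite /z ln_div //; last exact: exp_pos.
    by rewrite ln_exp.
  have Hsq : RtoC (sqrt (z t)) = Cexp (M / 4 * t) / sqrt M.
    rewrite Hsz RtoC_div; last by have := sqrt_lt_R0 _ Hmp; lra.
    rewrite -Cexp_R; congr (Cexp _ / _).
    rewrite RtoC_div; last lra.
    rewrite RtoC_mult; field.
  have Hv : clifford_var m t = RtoC (z t * z t).
    rewrite /clifford_var -/M /z RtoC_mult RtoC_div; last lra.
    rewrite -Cexp_R RtoC_div; last lra.
    rewrite RtoC_mult.
    have -> : Cexp (M * t) = Cexp (M * t / 2) * Cexp (M * t / 2) by rewrite -Cexp_plus; congr Cexp;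
        field.
    field; exact: Hm0.
  have H2z : RtoC (exp (2 * z t)) = Cexp (2 / M * Cexp (M / 2 * t)).
    rewrite -Cexp_R; congr Cexp; rewrite /z RtoC_mult RtoC_div; last lra.
    rewrite -Cexp_R RtoC_div; last lra.
    rewrite RtoC_mult.
    have -> : RtoC M * RtoC t / 2 = M / 2 * t by field.
    field; exact: Hm0.
  rewrite /recessive /lift /lead -/M Hs Hsq H2z Hv Hln.
  set J := macdonald _ _.
  have -> : Cexp (- (p / M * (M * t / 2 - ln M)%R)) = Cexp (p / M * ln M) * Cexp (- (p / 2) * t).
    rewrite -Cexp_plus; congr Cexp.
    rewrite RtoC_minus RtoC_div; last lra.
    rewrite RtoC_mult; field; exact: Hm0.
  have -> : Cexp (s_exp (- p) * t) = Cexp (1 / 2 * t) * Cexp (- (p / 2) * t).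
    rewrite -Cexp_plus; congr Cexp; rewrite /s_exp; field.
  have -> : Cexp ((1 / 2 - M / 4) * t) = Cexp (1 / 2 * t) / Cexp (M / 4 * t).
    rewrite /Cdiv -Cexp_opp -Cexp_plus; congr Cexp; rewrite /Cdiv; ring.
  rewrite (Cexp_opp (2 / M * _)).
  have N1 := Cexp_neq_0 (1 / 2 * t); have N2 := Cexp_neq_0 (M / 4 * t).
  have N3 := Cexp_neq_0 (2 / M * Cexp (M / 2 * t)).
  field; by repeat split.
have Hlim : Clim (Rbar_locally p_infty) (fun t : R =>
    Cexp (- (p / M * ln (z t))) * exp (2 * z t) * sqrt (z t) * macdonald (p / M) (z t * z t)%R)
        (sqrt PI).
  apply: (Clim_p_infty_decay _ _ (M / 4) (Rabs K * sqrt M) (2 * ln M)); first lra.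
  move=> t Ht.
  have Hz1 : (1 <= z t)%R.
    apply: (Rmult_le_reg_r M) => //.
    have -> : (z t * M = exp (M * t / 2))%R by rewrite /z; field; lra.
    rewrite Rmult_1_l -{1}(exp_ln M Hmp); apply: exp_le_compat.
    have : (0 <= ln M)%R by rewrite -ln_1; apply: ln_le; lra.
    nra.
  apply: Rle_trans (HK _ Hz1) _.
  have HsM := sqrt_lt_R0 _ Hmp.
  have He := exp_pos (M * t / 4).
  have -> : (K / sqrt (z t) = K * (sqrt M * exp (- (M / 4 * t))))%R.
    have -> : (- (M / 4 * t) = - (M * t / 4))%R by field.
    rewrite Hsz exp_Ropp; field; lra.
  rewrite Rmult_assoc; apply: Rmult_le_compat_r; last exact: Rle_abs.
  apply: Rmult_le_pos; [lra | left; exact: exp_pos].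
have -> : RtoC 1 = / sqrt PI * sqrt PI by field.
apply: (Clim_ext _ _ _ _ _ _ (Clim_scal _ _ _ (/ sqrt PI) _ Hlim)).
by apply: filter_forall => t; rewrite E.
Qed.

(** The coefficient of [x^{s(-p)}] in [recessive m p]; that of [x^{s(p)}] is obtained by
    [p -> -p]. *)
Definition recessive_coef (m : nat) (p : C) : C :=
  Cexp (p / INR m * ln (INR m)) / sqrt (INR m * PI)%R * Gamma (p / INR m).

Lemma recessive_frob (m : nat) (p : C) (t : R) : (1 <= m)%nat -> nonintegral (p / INR m) ->
  recessive m p t = recessive_coef m (- p) * frob m p t + recessive_coef m p * frob m (- p) t.
Proof.
move=> Hm Hnu; have Hmp : (0 < INR m)%R by apply: lt_0_INR; lia.
have Hm0 := INR_neq_0_C m Hm.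
have Hneg : - p / INR m = - (p / INR m) by rewrite /Cdiv; ring.
rewrite /recessive /recessive_coef /frob /lift !Hneg.
have Hs : RtoC (sqrt (INR m * PI)) <> 0.
  by case: (sqrt_mPI m Hm) => -> [H1 H2]; apply: Cmult_neq_0.
set nu := p / INR m in Hnu *.
have Hp : p = INR m * nu by rewrite /nu; field; exact: Hm0.
have Hv : clifford_var m t = Cexp (RtoC (INR m * t - 2 * ln (INR m))).
  rewrite /clifford_var RtoC_minus !RtoC_mult.
  have -> : RtoC (INR m) ^ 2 = Cexp (2 * ln (INR m)).
    have -> : 2 * RtoC (ln (INR m)) = ln (INR m) + ln (INR m) by ring.
    rewrite Cexp_plus Cexp_R exp_ln //; ring.
  rewrite /Cdiv -Cexp_opp -Cexp_plus; congr Cexp; ring.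
rewrite Hv (macdonald_connection nu Hnu).
set w := (INR m * t - 2 * ln (INR m))%R.
have -> : Cexp (s_exp p * t) = Cexp (s_exp (- p) * t) * (Cexp (nu * ln (INR m)) * Cexp (nu * ln
    (INR m))) * Cexp (nu * w).
  rewrite -!Cexp_plus; congr Cexp; rewrite /w RtoC_minus !RtoC_mult /s_exp Hp; field.
have -> : Cexp (- nu * ln (INR m)) = / Cexp (nu * ln (INR m)).
  rewrite -Cexp_opp; congr Cexp; ring.
have He := Cexp_neq_0 (nu * ln (INR m)).
field; by split.
Qed.

(** * Rotation of the independent variable *)

(** The logarithm of [omega]. *)
Definition turn (m : nat) : C := 2 * Ci * PI / INR m.

Lemma Cexp_m_turn (m : nat) : (1 <= m)%nat -> Cexp (INR m * turn m) = 1.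
Proof.
move=> Hm; have Hm0 := INR_neq_0_C m Hm.
rewrite -Cexp_2PI; congr Cexp; rewrite /turn; field; exact: Hm0.
Qed.

Lemma omega_turn (m : nat) (c : C) : omega m c = Cexp (c * turn m).
Proof. rewrite /omega /turn; congr Cexp; rewrite /Cdiv; ring. Qed.

Lemma Cexp_IZR (z : C) (k : Z) : Cexp z = 1 -> Cexp (IZR k * z) = 1.
Proof.
move=> Hz.
have HN : forall n : nat, Cexp (INR n * z) = 1 by move=> n; rewrite -Cexp_pow Hz Cpow_1_l.
case: k => [|q|q].
- by have -> : RtoC 0 * z = 0 by [ring]; rewrite Cexp_0.
- by rewrite -(Znat.positive_nat_Z q) -INR_IZR_INZ.
- have -> : RtoC (IZR (Z.neg q)) * z = - (INR (Pos.to_nat q) * z).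
    rewrite -Pos2Z.opp_pos opp_IZR -(Znat.positive_nat_Z q) -INR_IZR_INZ RtoC_opp; ring.
  rewrite Cexp_opp HN; field.
Qed.

Lemma Phi_last_only (m : nat) (Phi0 : C -> Cvec m -> C) (k : Z) (t am : C) : (1 <= m)%nat ->
  Phi Phi0 k t (last_only m am) = Phi0 (t + IZR k * turn m) (last_only m am).
Proof.
move=> Hm; rewrite /Phi act_last_only //.
  congr Phi0; rewrite /turn /Cdiv; ring.
rewrite omega_turn Cexp_pow.
have -> : INR m * (IZR k * turn m) = IZR k * (INR m * turn m) by ring.
apply: Cexp_IZR; exact: Cexp_m_turn.
Qed.

Lemma is_C_derive_translate (f : C -> C) (h t l : C) :
  is_C_derive f (t + h) l -> is_C_derive (fun z => f (z + h)) t l.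
Proof.
move=> H; apply: is_C_derive_eq.
  apply: (is_C_derive_comp f (fun z => z + h) t l _ H).
  exact: is_C_derive_plus (is_C_derive_id t) (is_C_derive_const h t).
ring.
Qed.

Lemma solves_at_turn (m : nat) (am : C) (F dF : C -> C) (t : C) : (1 <= m)%nat ->
  solves_at m am F dF (t + turn m) ->
  solves_at m am (fun z => F (z + turn m)) (fun z => Cexp (turn m) * dF (z + turn m)) t.
Proof.
move=> Hm [H1 H2].
have HE : Cexp (t + turn m) ^ m = Cexp t ^ m.
  rewrite !Cexp_pow.
  have -> : INR m * (t + turn m) = INR m * t + INR m * turn m by ring.
  rewrite Cexp_plus Cexp_m_turn //; ring.
split.
- apply: is_C_derive_eq (is_C_derive_translate _ _ _ _ H1) _.
  rewrite Cexp_plus; ring.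
- apply: is_C_derive_eq (is_C_derive_scal _ _ _ _ (is_C_derive_translate _ _ _ _ H2)) _.
  rewrite HE Cexp_plus /=; field; split; exact: Cexp_neq_0.
Qed.

Lemma clifford_var_turn (m : nat) (t : C) : (1 <= m)%nat ->
  clifford_var m (t + turn m) = clifford_var m t.
Proof.
move=> Hm; rewrite /clifford_var; congr (_ / _).
have -> : INR m * (t + turn m) = INR m * t + INR m * turn m by ring.
rewrite Cexp_plus Cexp_m_turn //; ring.
Qed.

Lemma frob_turn (m : nat) (p t : C) : (1 <= m)%nat ->
  frob m p (t + turn m) = Cexp (s_exp p * turn m) * frob m p t.
Proof.
move=> Hm; rewrite /frob /lift clifford_var_turn //.
have -> : s_exp p * (t + turn m) = s_exp p * turn m + s_exp p * t by ring.
rewrite Cexp_plus; ring.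
Qed.

Lemma dfrob_turn (m : nat) (p t : C) : (1 <= m)%nat ->
  Cexp (turn m) * dfrob m p (t + turn m) = Cexp (s_exp p * turn m) * dfrob m p t.
Proof.
move=> Hm; rewrite /dfrob /dlift clifford_var_turn //.
have -> : Cexp (s_exp p * turn m) = Cexp (turn m) * Cexp ((s_exp p - 1) * turn m).
  rewrite -Cexp_plus; congr Cexp; ring.
have -> : (s_exp p - 1) * (t + turn m) = (s_exp p - 1) * turn m + (s_exp p - 1) * t by ring.
rewrite (Cexp_plus (_ * turn m)); ring.
Qed.

(** ** Independence of a recessive solution and its rotation *)

Lemma is_C_derive_inv (f : C -> C) (z df : C) : f z <> 0 -> is_C_derive f z df ->
  is_C_derive (fun w => / f w) z (- df / (f z * f z)).
Proof.
move=> Hz Hf.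
have H : is_C_derive Cinv (f z) (- / (f z * f z)).
  move: Hz; set v := f z => Hv.
  have Hm : (0 < Cmod v)%R by apply/Cmod_gt_0.
  apply/is_C_derive_eps => eps He.
  set n := Cmod v in Hm.
  exists (Rmin (n / 2) (eps * (n * n * n) / 2)); split.
    apply: Rmin_pos; first lra.
    have : (0 < n * n * n)%R by apply: Rmult_lt_0_compat => //; nra.
    nra.
  move=> w Hw.
  have H1 : (Cmod (w - v)%C < n / 2)%R by apply: Rlt_le_trans Hw (Rmin_l _ _).
  have H2 : (Cmod (w - v)%C < eps * (n * n * n) / 2)%R by apply: Rlt_le_trans Hw (Rmin_r _ _).
  have Hw2 : (n / 2 <= Cmod w)%R.
    have := Cmod_triangle w (- (w - v)); have -> : w + - (w - v) = v by ring.
    rewrite Cmod_opp -/n; lra.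
  have Hw0 : w <> 0 by apply/Cmod_gt_0; lra.
  have -> : / w - / v - (w - v) * (- / (v * v)) = (w - v) * (w - v) / (v * v * w).
    by field; split.
  rewrite Cmod_div; last by repeat apply: Cmult_neq_0.
  rewrite !Cmod_mult -/n.
  set d := Cmod (w - v) in H1 H2 *.
  have Hd : (0 <= d)%R by exact: Cmod_ge_0.
  have Hnn : (0 < n * n)%R by nra.
  apply: (Rmult_le_reg_r (n * n * Cmod w)); first by apply: Rmult_lt_0_compat; lra.
  have -> : (d * d / (n * n * Cmod w) * (n * n * Cmod w) = d * d)%R by field; lra.
  apply: (Rle_trans _ (eps * d * (n * n * (n / 2)))); first nra.
  apply: Rmult_le_compat_l; first nra.
  apply: Rmult_le_compat_l; lra.
apply: is_C_derive_eq (is_C_derive_comp _ _ _ _ _ H Hf) _.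
field; exact: Hz.
Qed.

(** The exponent [S] changes sign under the rotation by [omega]. *)
Lemma lead_turn (m : nat) (t : C) : (1 <= m)%nat ->
  lead m (t + turn m) =
  Cexp ((1 / 2 - INR m / 4) * turn m) * Cexp ((1 / 2 - INR m / 4) * t)
  * Cexp (2 / INR m * Cexp (INR m / 2 * t)).
Proof.
move=> Hm; have Hm0 := INR_neq_0_C m Hm.
rewrite /lead.
have -> : INR m / 2 * (t + turn m) = INR m / 2 * t + Ci * PI by rewrite /turn; field; exact: Hm0.
rewrite (Cexp_plus _ (Ci * PI)) Cexp_PI.
have -> : - (2 / INR m * (Cexp (INR m / 2 * t) * - (1))) = 2 / INR m * Cexp (INR m / 2 * t) by ring.
rewrite -!Cexp_plus; congr Cexp; ring.
Qed.

Lemma lead_ratio_limit (m : nat) : (1 <= m)%nat ->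
  Clim (Rbar_locally p_infty) (fun t => lead m (RtoC t) / lead m (RtoC t + turn m)) 0.
Proof.
move=> Hm; have Hmp : (0 < INR m)%R by apply: lt_0_INR; lia.
have Hm0 := INR_neq_0_C m Hm.
set rho := (1 / 2 - INR m / 4).
have E : forall t : R, lead m t / lead m (t + turn m) =
    / Cexp (rho * turn m) * RtoC (exp (- (4 / INR m * exp (INR m / 2 * t)))).
  move=> t; rewrite lead_turn // /lead -/rho.
  have -> : RtoC (exp (- (4 / INR m * exp (INR m / 2 * t)))) =
     / Cexp (2 / INR m * Cexp (INR m / 2 * t)) * / Cexp (2 / INR m * Cexp (INR m / 2 * t)).
    rewrite -!Cexp_opp -Cexp_plus -Cexp_R; congr Cexp.
    rewrite RtoC_opp RtoC_mult RtoC_div; last lra.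
    rewrite -Cexp_R RtoC_mult RtoC_div; last lra.
    field; exact: Hm0.
  rewrite Cexp_opp.
  have N1 := Cexp_neq_0 (rho * turn m); have N2 := Cexp_neq_0 (rho * t).
  have N3 := Cexp_neq_0 (2 / INR m * Cexp (INR m / 2 * t)).
  field; by repeat split.
apply: (Clim_p_infty_decay _ _ 2 (Cmod (/ Cexp (rho * turn m))) 0); first lra.
move=> t Ht; rewrite E.
have -> : / Cexp (rho * turn m) * RtoC (exp (- (4 / INR m * exp (INR m / 2 * t)))) - 0 =
  / Cexp (rho * turn m) * RtoC (exp (- (4 / INR m * exp (INR m / 2 * t)))) by ring.
rewrite Cmod_mult Cmod_R Rabs_pos_eq; last by left; exact: exp_pos.
apply: Rmult_le_compat_l; first exact: Cmod_ge_0.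
apply: exp_le_compat.
have H1 := exp_ineq1_le (INR m / 2 * t).
have H2 : (0 < 4 / INR m)%R by apply: Rdiv_lt_0_compat; lra.
have H3 : (4 / INR m * (1 + INR m / 2 * t) <= 4 / INR m * exp (INR m / 2 * t))%R by apply:
    Rmult_le_compat_l; lra.
have H4 : (4 / INR m * (1 + INR m / 2 * t) = 4 / INR m + 2 * t)%R by field; lra.
lra.
Qed.

Definition rotated (m : nat) (F : C -> C) (t : C) : C := F (t + turn m).

(** The factor [omega] comes from the derivation with respect to [x]. *)
Definition drotated (m : nat) (dF : C -> C) (t : C) : C := Cexp (turn m) * dF (t + turn m).

Lemma rotated_solves (m : nat) (am : C) (F dF : C -> C) : (1 <= m)%nat ->
  (forall t, solves_at m am F dF t) ->
  forall t, solves_at m am (rotated m F) (drotated m dF) t.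
Proof. move=> Hm HF t; exact: solves_at_turn. Qed.

(** If the Wronskian vanished, the quotient of [rotated m F] by [F] would be constant near
    infinity on the real axis, whereas [F] decays there and [rotated m F] grows. *)
Lemma rotated_independent (m : nat) (am : C) (F dF : C -> C) (t : C) : (1 <= m)%nat ->
  (forall z, solves_at m am F dF z) ->
  Clim (Rbar_locally p_infty) (fun r => F (RtoC r) / lead m (RtoC r)) 1 ->
  Clim (Rbar_locally p_infty) (fun r => rotated m F (RtoC r) / lead m (RtoC r + turn m)) 1 ->
  wronskian F dF (rotated m F) (drotated m dF) t <> 0.
Proof.
move=> hm HF limF limF1.
have HR := rotated_solves m am F dF hm HF.
rewrite (wronskian_const m am _ _ _ _ t 0 HF HR) => W0.
have W : forall z, wronskian F dF (rotated m F) (drotated m dF) z = 0.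
  by move=> z; rewrite (wronskian_const m am _ _ _ _ z 0 HF HR).
case: (limF (/ 2)%R ltac:(lra)) => T HT.
have Hne : forall r : R, (T < r)%R -> F r <> 0.
  move=> r Hr E0; have := HT r Hr; rewrite E0.
  have -> : 0 / lead m r - 1 = - (1) by field; exact: lead_neq_0.
  rewrite Cmod_m1; lra.
set c := rotated m F (RtoC (T + 1)) / F (RtoC (T + 1)).
have Hc : forall r : R, (T < r)%R -> rotated m F r = c * F r.
  move=> r Hr; have HFr := Hne r Hr.
  have -> : rotated m F r = rotated m F r * / F r * F r by field.
  congr (_ * _); rewrite /c /Cdiv.
  apply: (path_derive_zero (fun q => rotated m F (RtoC q) * / F (RtoC q))) => q Hq.
  have HTq : (T < q)%R.
    have : (T < Rmin r (T + 1))%R by apply: Rmin_glb_lt; lra.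
    lra.
  have HFq := Hne q HTq.
  apply: (is_C_derive_path (fun z => rotated m F z * / F z)); apply: is_C_derive_eq.
    apply: is_C_derive_mult; first exact: (proj1 (HR q)).
    apply: is_C_derive_inv HFq _; exact: (proj1 (HF q)).
  transitivity (Cexp q * wronskian F dF (rotated m F) (drotated m dF) q / (F q * F q)).
    rewrite /wronskian; field; exact: HFq.
  rewrite W; field; exact: HFq.
have L : Clim (Rbar_locally p_infty)
    (fun r => c * (F (RtoC r) / lead m (RtoC r) * (lead m (RtoC r) / lead m (RtoC r + turn m)))) (c
        * (1 * 0)).
  apply: Clim_scal; apply: Clim_mult => //; exact: lead_ratio_limit.
have L' : Clim (Rbar_locally p_infty)
    (fun r => rotated m F (RtoC r) / lead m (RtoC r + turn m)) (c * (1 * 0)).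
  apply: Clim_ext L; exists T => r Hr.
  rewrite (Hc r Hr).
  field; split; exact: lead_neq_0.
have H1 : RtoC 1 = c * (1 * 0) by exact: (Clim_unique (Rbar_locally p_infty) _ _ _ _ limF1 L').
have H2 : c * (1 * 0) = RtoC 0 by ring.
rewrite H2 in H1; have := RtoC_inj _ _ H1; lra.
Qed.

(** In [U = al * F + be * rotated m F], division by the growing function gives [be = 0], and
    then division by the decaying one gives [al = 1]. *)
Lemma recessive_unique (m : nat) (am : C) (F dF U dU : C -> C) : (1 <= m)%nat ->
  (forall t, solves_at m am F dF t) ->
  Clim (Rbar_locally p_infty) (fun r => F (RtoC r) / lead m (RtoC r)) 1 ->
  Clim (Rbar_locally p_infty) (fun r => rotated m F (RtoC r) / lead m (RtoC r + turn m)) 1 ->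
  (forall t : R, solves_at m am U dU t) ->
  Clim (Rbar_locally p_infty) (fun t => U (RtoC t) / lead m (RtoC t)) 1 ->
  forall t : R, U t = F t.
Proof.
move=> hm HF limF limF1 HU limU.
set w := wronskian F dF (rotated m F) (drotated m dF) 0.
have Hw : w <> 0 by exact: rotated_independent limF1.
set al := wronskian U dU (rotated m F) (drotated m dF) 0 / w; set be := wronskian F dF U dU 0 / w.
have HFR : forall r : R, solves_at m am F dF r by move=> r; exact: HF.
have HRR : forall r : R, solves_at m am (rotated m F) (drotated m dF) r by move=> r; exact:
    rotated_solves.
have E : forall t : R, U t = al * F t + be * rotated m F t.
  move=> t.
  have := cramer F dF (rotated m F) (drotated m dF) U dU t.
  rewrite (wronskian_const_R m am F dF (rotated m F) (drotated m dF) t 0 HFR HRR).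
  rewrite (wronskian_const_R m am U dU (rotated m F) (drotated m dF) t 0 HU HRR).
  rewrite (wronskian_const_R m am F dF U dU t 0 HFR HU) -/w => H.
  have -> : U t = w * U t / w by field.
  rewrite H /al /be; field; exact: Hw.
have Hlr := lead_ratio_limit m hm.
have Hbe : be = 0.
  apply: (Clim_unique (Rbar_locally p_infty) _
    (fun t => U (RtoC t) / lead m (RtoC t) * (lead m (RtoC t) / lead m (RtoC t + turn m)))).
    have -> : be = al * (1 * 0) + be * 1 by ring.
    apply: (Clim_ext _ _ (fun t => al * (F (RtoC t) / lead m (RtoC t) * (lead m (RtoC t) / lead m
        (RtoC t + turn m)))
       + be * (rotated m F (RtoC t) / lead m (RtoC t + turn m)))).
      apply: filter_forall => t; rewrite E; field; split; exact: lead_neq_0.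
    apply: Clim_plus; apply: Clim_scal => //; exact: Clim_mult.
  have -> : RtoC 0 = 1 * 0 by ring.
  exact: Clim_mult.
have Hal : al = 1.
  apply: (Clim_unique (Rbar_locally p_infty) _ (fun t => U (RtoC t) / lead m (RtoC t))) => //.
  have -> : al = al * 1 by ring.
  apply: (Clim_ext (Rbar_locally p_infty) _ (fun t => al * (F (RtoC t) / lead m (RtoC t)))); last
      exact: Clim_scal.
  apply: (filter_forall (F := Rbar_locally p_infty)) => t; rewrite E Hbe; field; exact: lead_neq_0.
move=> t; rewrite E Hbe Hal; ring.
Qed.

(** * The solution [Phi_0] *)

Lemma turn_Ci (m : nat) : (1 <= m)%nat -> turn m = Ci * RtoC (2 * PI / INR m).
Proof.
move=> Hm; have Hm0 := INR_neq_0_C m Hm; have Hmp : (0 < INR m)%R by apply: lt_0_INR; lia.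
rewrite /turn RtoC_div; last lra.
rewrite RtoC_mult; field; exact: Hm0.
Qed.

(** The width [5/2 pi / m] of the sector lies between [2 pi / m], the argument that occurs for
    [Phi_1], and the bound [3 pi / m]. *)
Lemma Phi0_limit (m : nat) (Phi0 : C -> Cvec m -> C) (am : C) (theta : R) :
  (1 <= m)%nat -> is_Phi0 m Phi0 -> (Rabs theta <= 2 * PI / INR m)%R ->
  Clim (Rbar_locally p_infty)
    (fun t => Phi0 (RtoC t + Ci * RtoC theta) (last_only m am) / lead m (RtoC t + Ci * RtoC theta)) 1.
Proof.
move=> Hm [_ [_ [b [phi [Hb [Hphi HA]]]]]] Hth.
have Hmp : (0 < INR m)%R by apply: lt_0_INR; lia.
have HPI := PI_RGT_0.
set a := last_only m am.
have Hal : (5 / 2 * PI / INR m < 3 * PI / INR m)%R.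
  by apply: Rmult_lt_compat_r; [exact: Rinv_0_lt_compat | lra].
case: (HA 0%nat _ Hal a) => delta [T [K [Hdelta H]]].
have Hdist : Cvec_dist a a = 0%R.
  rewrite /Cvec_dist (sum_n_m_ext _ (fun _ => zero)).
    by rewrite sum_n_m_const_zero.
  move=> j; have -> : coord a j - coord a j = 0 by ring.
  by rewrite Cmod_0.
have Hth2 : (Rabs theta <= 5 / 2 * PI / INR m)%R.
  apply: Rle_trans Hth _; apply: Rmult_le_compat_r; first by left; exact: Rinv_0_lt_compat.
  lra.
have Hstep : (/ 2 <= phi_step m)%R by rewrite /phi_step; case: (Nat.even m); lra.
apply: (Clim_p_infty_decay _ _ (phi_step m) K T); first lra.
move=> t Ht.
set t' := RtoC t + Ci * RtoC theta.
have Hre : Re t' = t by rewrite /t' /=; ring.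
have Him : Im t' = theta by rewrite /t' /=; ring.
have := H a t'; rewrite Hdist Hre Him => H1.
have {}H1 := H1 Hdelta Hth2 Ht.
rewrite (lead_last_only m am) // in H1.
rewrite /Csum sum_n_n Hphi in H1.
have E1 : - (phi_step m * INR 0 * t') = 0 by rewrite /=; ring.
rewrite E1 Cexp_0 Cmult_1_l Cmod_Cexp in H1.
have E2 : Re (- (phi_step m * INR 1 * t')) = (- (phi_step m * t))%R.
  rewrite [INR 1]/= -[in RHS]Hre; case: (t') => x y /=; ring.
by rewrite E2 in H1.
Qed.

(** ** Coefficients with respect to a fundamental system *)

Lemma independent_of_wronskian (m : nat) (am x y : C) (F dF G dG : C -> C) :
  (forall t, solves_at m am F dF t) -> (forall t, solves_at m am G dG t) ->
  wronskian F dF G dG 0 <> 0 ->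
  (forall t : R, x * F t + y * G t = 0) -> x = 0 /\ y = 0.
Proof.
move=> HF HG HW HZ.
have [D _] := solves_at_lin m am x y F dF G dG 0 (HF 0) (HG 0).
have Z' := is_C_derive_vanishing _ 0 _ D HZ.
rewrite Cexp_0 Cmult_1_l in Z'.
have Z := HZ 0%R.
split.
- have -> : x = ((x * F 0 + y * G 0) * dG 0 - (x * dF 0 + y * dG 0) * G 0) / wronskian F dF G dG 0.
    rewrite /wronskian; field; exact: HW.
  rewrite Z Z'; field; exact: HW.
- have -> : y = ((x * dF 0 + y * dG 0) * F 0 - (x * F 0 + y * G 0) * dF 0) / wronskian F dF G dG 0.
    rewrite /wronskian; field; exact: HW.
  rewrite Z Z'; field; exact: HW.
Qed.

(** The Wronskians of the difference of the two sides with [F] and [G] are constant and vanish on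
    the real axis. *)
Lemma real_identity_extends (m : nat) (am x y : C) (F dF G dG H dH : C -> C) :
  (forall t, solves_at m am F dF t) -> (forall t, solves_at m am G dG t) ->
  (forall t, solves_at m am H dH t) -> wronskian F dF G dG 0 <> 0 ->
  (forall t : R, H t = x * F t + y * G t) -> forall t, H t = x * F t + y * G t.
Proof.
move=> HF HG HH HW HR t.
pose L z := x * F z + y * G z; pose dL z := x * dF z + y * dG z.
have HL : forall z, solves_at m am L dL z by move=> z; exact: solves_at_lin.
pose D z := 1 * H z + - (1) * L z; pose dD z := 1 * dH z + - (1) * dL z.
have HD : forall z, solves_at m am D dD z by move=> z; exact: solves_at_lin.
have Z : forall q : R, D q = 0 by move=> q; rewrite /D HR /L; ring.
have Z' := is_C_derive_vanishing D 0 _ (proj1 (HD 0)) Z.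
rewrite Cexp_0 Cmult_1_l in Z'.
have W1 : wronskian D dD G dG t = 0.
  by rewrite (wronskian_const m am D dD G dG t 0 HD HG) /wronskian Z' (Z 0%R); ring.
have W2 : wronskian F dF D dD t = 0.
  by rewrite (wronskian_const m am F dF D dD t 0 HF HD) /wronskian Z' (Z 0%R); ring.
have := cramer F dF G dG D dD t.
rewrite W1 W2 (wronskian_const m am F dF G dG t 0 HF HG) => HC.
have HDt : D t = 0.
  have -> : D t = wronskian F dF G dG 0 * D t / wronskian F dF G dG 0 by field.
  rewrite HC; field; exact: HW.
have -> : H t = D t + L t by rewrite /D; ring.
rewrite HDt /L; ring.
Qed.

(** ** Monodromy *)

Lemma clifford_var_limit (m : nat) : (1 <= m)%nat ->
  Clim (Rbar_locally m_infty) (fun t => clifford_var m (RtoC t)) 0.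
Proof.
move=> Hm; have Hmp : (0 < INR m)%R by apply: lt_0_INR; lia.
have -> : RtoC 0 = / INR m ^ 2 * 0 by ring.
apply: (Clim_ext (Rbar_locally m_infty) _ (fun t => / INR m ^ 2 * Cexp (INR m * RtoC t))).
  by apply: filter_forall => t; rewrite /clifford_var /Cdiv; ring.
apply: Clim_scal; exact: Clim_Cexp_minf.
Qed.

Lemma clifford_limit (m : nat) (nu : C) : (1 <= m)%nat ->
  Clim (Rbar_locally m_infty) (fun t => clifford nu (clifford_var m (RtoC t))) 1.
Proof.
move=> Hm; rewrite -(clifford_0 nu).
exact: Clim_comp (clifford_var_limit m Hm) (is_C_derive_clifford _ _).
Qed.

Lemma frob_neq_0 (m : nat) (p : C) : (1 <= m)%nat -> exists t, frob m p t <> 0.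
Proof.
move=> Hm.
case: (clifford_limit m (p / INR m) Hm (/ 2)%R ltac:(lra)) => T HT.
exists (RtoC (T - 1)); rewrite /frob /lift; apply: Cmult_neq_0; first exact: Cexp_neq_0.
move=> E; have := HT (T - 1)%R ltac:(lra).
rewrite E; have -> : 0 - 1 = - (1) by ring.
rewrite Cmod_m1; lra.
Qed.

(** The rotation acts on the plane of solutions with determinant [omega], and [frob m p] is an
    eigenvector; this determines the other eigenvalue, hence the characteristic polynomial,
    which annihilates every solution. Only one exponent has to be nonresonant, so that integral
    values of [p / m] are covered. *)
Lemma rotation_cayley_hamilton (m : nat) (p : C) (F dF : C -> C) : (1 <= m)%nat ->
  nonresonant (p / INR m) ->
  (forall t, solves_at m ((p ^ 2 - 1) / 4) F dF t) ->
  wronskian F dF (rotated m F) (drotated m dF) 0 <> 0 ->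
  forall t, F t = (Cexp ((s_exp p - 1) * turn m) + Cexp (- (s_exp p * turn m))) * F (t + turn m)
                  - Cexp (- turn m) * F (t + turn m + turn m).
Proof.
move=> Hm Hnu HF HW.
pose f := frob m p; pose df := dfrob m p.
have Hf : forall t, solves_at m ((p ^ 2 - 1) / 4) f df t by move=> t; exact: frob_solves.
have HR := rotated_solves m _ F dF Hm HF.
set lam := Cexp (s_exp p * turn m); set om := Cexp (turn m).
have Hlam : lam <> 0 by exact: Cexp_neq_0.
have Hom : om <> 0 by exact: Cexp_neq_0.
set w := wronskian F dF _ _ 0 in HW.
pose kappa := wronskian f df F dF 0.
have W1 : forall t, wronskian f df F dF t = kappa.
  by move=> t; exact: (wronskian_const _ _ _ _ _ _ t 0 Hf HF).
have W2 : forall t, wronskian f df (rotated m F) (drotated m dF) t = om / lam * kappa.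
  move=> t; rewrite -(W1 (t + turn m)) /wronskian /rotated /drotated.
  have E1 : f (t + turn m) = lam * f t by exact: frob_turn.
  have E2 : om * df (t + turn m) = lam * df t by exact: dfrob_turn.
  have -> : df (t + turn m) = lam * df t / om by rewrite -E2; field.
  rewrite E1 -/om; field; by split.
have Hc : forall t, w * f t = kappa * (om / lam * F t - F (t + turn m)).
  move=> t; have := cramer F dF (rotated m F) (drotated m dF) f df t.
  rewrite W2 (wronskian_const _ _ F dF _ _ t 0 HF HR) -/w => ->.
  have -> : wronskian F dF f df t = - kappa by rewrite -(W1 t) /wronskian; ring.
  rewrite /rotated; ring.
have Hkap : kappa <> 0.
  move=> E; case: (frob_neq_0 m p Hm) => t0 H0; apply: H0.
  have -> : frob m p t0 = w * f t0 / w by rewrite /f; field.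
  rewrite Hc E; field; by split.
have HG : forall t, om / lam * F t - F (t + turn m) = w / kappa * f t.
  move=> t.
  have -> : om / lam * F t - F (t + turn m) = kappa * (om / lam * F t - F (t + turn m)) / kappa.
    field; by split.
  rewrite -Hc; field; exact: Hkap.
move=> t.
have E : om / lam * F (t + turn m) - F (t + turn m + turn m) = lam * (om / lam * F t - F (t + turn m)).
  rewrite !HG /f frob_turn // -/lam; ring.
rewrite (Cexp_opp (s_exp p * turn m)) (Cexp_opp (turn m)) -/lam -/om.
have -> : Cexp ((s_exp p - 1) * turn m) = lam / om.
  rewrite /Cdiv /lam /om -Cexp_opp -Cexp_plus; congr Cexp; ring.
have -> : F (t + turn m + turn m) = om / lam * F (t + turn m) - lam * (om / lam * F t - F (t + turn m)).
  rewrite -E; ring.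
field; by split.
Qed.

Lemma Cexp_eq_1 (z : C) : Cexp z = 1 -> exists k : Z, z = 2 * Ci * PI * IZR k.
Proof.
case: z => x y E.
have Hm := Cmod_Cexp (x, y); rewrite E Cmod_1 /= in Hm.
have Hx : x = 0%R by rewrite -(ln_exp x) -Hm ln_1.
move: E; rewrite Hx /Cexp /= exp_0 !Rmult_1_l => E.
have Hc : cos y = 1%R by exact: (f_equal fst E).
have Hs : sin y = 0%R by exact: (f_equal snd E).
case: (sin_eq_0_0 y Hs) => k Hk.
case: (Z.Even_or_Odd k) => -[j Hj]; last first.
  have : cos y = (-1)%R.
    rewrite Hk Hj plus_IZR mult_IZR.
    have -> : ((2 * IZR j + 1) * PI = PI + 2 * IZR j * PI)%R by ring.
    rewrite -cos_PI.
    case: (Z.le_ge_cases 0 j) => Hj0.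
      by rewrite -(Z2Nat.id j Hj0) -INR_IZR_INZ cos_period.
    have -> : IZR j = (- INR (Z.to_nat (- j)))%R.
      by rewrite INR_IZR_INZ Z2Nat.id; [rewrite opp_IZR; ring | lia].
    rewrite -(cos_period _ (Z.to_nat (- j))); congr cos; ring.
  lra.
exists j; rewrite Hk Hj mult_IZR; apply: C_eq => /=; ring.
Qed.

Lemma frob_turn_distinct (m : nat) (p : C) : (1 <= m)%nat -> nonintegral (p / INR m) ->
  Cexp (s_exp p * turn m) <> Cexp (s_exp (- p) * turn m).
Proof.
move=> Hm Hnu E; have Hm0 := INR_neq_0_C m Hm.
have H1 : Cexp (p * turn m) = 1.
  have -> : p * turn m = s_exp p * turn m + - (s_exp (- p) * turn m) by rewrite /s_exp; field.
  rewrite Cexp_plus Cexp_opp E; field; exact: Cexp_neq_0.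
case: (Cexp_eq_1 _ H1) => k Hk.
have HPI : RtoC PI <> 0 by apply: RtoC_neq_0; have := PI_RGT_0; lra.
have HCi : Ci <> 0 by move=> E0; have := Cmod_Ci; rewrite E0 Cmod_0; lra.
apply: (Hnu k).
have -> : p / INR m = p * turn m / (2 * Ci * PI) by rewrite /turn; field; repeat split.
rewrite Hk; field; by split.
Qed.

(** ** The solutions at the origin *)

Lemma pow_n_Cpow (x : C) (k : nat) : @pow_n C_Ring x k = x ^ k.
Proof. by elim: k => [//|k IH]; rewrite Cpow_S -IH. Qed.

Lemma Cseries_of_pseries (A : nat -> C) (x l : C) :
  @is_pseries C_AbsRing C_NormedModule A x l -> Cseries (fun k => A k * x ^ k) l.
Proof.
move=> H; apply: Cseries_ext H => k.
by rewrite -(pow_n_Cpow x k) Cmult_comm.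
Qed.

Lemma pseries_limit (A : nat -> C) (g : C -> C) :
  (forall x, Cseries (fun k => A k * x ^ k) (g x)) ->
  Clim (Rbar_locally m_infty) (fun t => g (Cexp (RtoC t))) (A 0%nat).
Proof.
move=> HA.
case: (pseries_remainder A 1 (g 1) Rlt_0_1 (HA 1)) => M [HM0 HM].
have HA1 := Cmod_ge_0 (A 1%nat).
move=> eps He.
case: (exp_decay 1 (M + Cmod (A 1%nat)) eps Rlt_0_1 ltac:(lra) He) => N [HN0 HN].
exists (- (N + 1))%R => t Ht.
have Ht1 : (t < -1)%R by lra.
have Hm : Cmod (Cexp (RtoC t)) = exp t by rewrite Cmod_Cexp.
have Hp := exp_pos t.
have Hsmall : (exp t <= 1 / 2)%R.
  have H1 := exp_ineq1_le (- t).
  have H2 : (exp t * exp (- t) = 1)%R by rewrite -exp_plus Rplus_opp_r exp_0.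
  nra.
have H := HM 1%nat (Cexp t) _ ltac:(rewrite Hm; exact: Hsmall) (HA _) ltac:(move=> k; lia) ltac:(lia).
rewrite Hm Rdiv_1_r in H.
have -> : g (Cexp t) - A 0%nat = (g (Cexp t) - A 0%nat - A 1%nat * Cexp t ^ 1) + A 1%nat * Cexp t
    by rewrite Cpow_1_r; ring.
apply: Rle_lt_trans (Cmod_triangle _ _) _; rewrite Cmod_mult Hm.
apply: Rle_lt_trans HN; rewrite Rmult_1_l.
have H3 : (exp t <= exp (- N))%R by apply: exp_le_compat; lra.
have H4 : (exp t ^ 2 <= exp t)%R by rewrite /=; nra.
nra.
Qed.

(** The rotation multiplies both functions by the same number and [frob m (- p)] by another one;
    hence they are proportional, and their values at [x = 0] agree. *)
Lemma f_sol_frob (m : nat) (g1 : C -> C -> C) (p : C) : (1 <= m)%nat -> is_g1 m g1 ->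
  nonintegral (p / INR m) -> forall t, f_sol g1 t p = frob m p t.
Proof.
move=> Hm Hg Hnu.
have Hm0 := INR_neq_0_C m Hm.
have Hint : ~ integral_ratio m p by case=> n Hn; exact: (Hnu n).
case: (Hg p Hint) => -[A [HA0 [HAm HA]]] Hsol.
have HAs : forall x, Cseries (fun k => A k * x ^ k) (g1 x p).
  move=> x; apply: Cseries_of_pseries; exact: HA.
case: (solution_last_only m _ _ Hm Hsol) => dfg Hfg.
pose fg t := f_sol g1 t p.
pose f1 := frob m p; pose df1 := dfrob m p; pose f2 := frob m (- p); pose df2 := dfrob m (- p).
have Hneg : - p / INR m = - (p / INR m) by rewrite /Cdiv; ring.
have Hn1 := nonintegral_nonresonant _ Hnu.
have Hn2 := nonintegral_nonresonant _ (nonintegral_opp _ Hnu).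
rewrite -Hneg in Hn2.
have H1 : forall t, solves_at m ((p ^ 2 - 1) / 4) f1 df1 t by move=> t; exact: frob_solves.
have Esq : p ^ 2 = (- p) ^ 2 by ring.
have H2 : forall t, solves_at m ((p ^ 2 - 1) / 4) f2 df2 t.
  by move=> t; rewrite Esq; exact: frob_solves.
have Hp0 : p <> 0.
  move=> E; apply: (Hnu 0%Z); rewrite E; field; exact: Hm0.
have W12 : forall t, wronskian f1 df1 f2 df2 t = - p by move=> t; exact: frob_wronskian.
set mu1 := wronskian fg dfg f2 df2 0 / - p; set mu2 := wronskian f1 df1 fg dfg 0 / - p.
have Hlin : forall t, fg t = mu1 * f1 t + mu2 * f2 t.
  move=> t; have := cramer f1 df1 f2 df2 fg dfg t; rewrite W12.
  rewrite (wronskian_const _ _ fg dfg f2 df2 t 0 Hfg H2) (wronskian_const _ _ f1 df1 fg dfg t 0 H1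
      Hfg) => H.
  have -> : fg t = - p * fg t / - p by field.
  rewrite H /mu1 /mu2; field; exact: Hp0.
(* g1 is a power series in x^m, so fg has the same multiplier as f1 *)
have Hg1 : forall t, g1 (Cexp (t + turn m)) p = g1 (Cexp t) p.
  move=> t; apply: (Cseries_unique _ _ _ (HAs _)); apply: Cseries_ext (HAs (Cexp t)) => k.
  case: (Nat.eq_dec (Nat.modulo k m) 0) => Hk; last first.
    by rewrite HAm; [ring | move/Nat.Lcm0.mod_divide].
  case/Nat.Lcm0.mod_divide: Hk => q Hq; congr (_ * _).
  rewrite !Cexp_pow.
  have -> : INR k * (t + turn m) = INR k * t + INR q * (INR m * turn m).
    rewrite Hq mult_INR RtoC_mult; ring.
  by rewrite Cexp_plus -(Cexp_pow (INR m * turn m)) Cexp_m_turn // Cpow_1_l Cmult_1_r.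
have Hfgt : forall t, fg (t + turn m) = Cexp (s_exp p * turn m) * fg t.
  move=> t; rewrite /fg /f_sol Hg1.
  have -> : s_exp p * (t + turn m) = s_exp p * turn m + s_exp p * t by ring.
  rewrite Cexp_plus; ring.
have Hmu2 : mu2 = 0.
  case: (frob_neq_0 m (- p) Hm) => t0 Ht0.
  have E := Hfgt t0; rewrite !Hlin /f1 /f2 !frob_turn // in E.
  have Hd := frob_turn_distinct m p Hm Hnu.
  set l1 := Cexp (s_exp p * turn m) in E Hd; set l2 := Cexp (s_exp (- p) * turn m) in E Hd.
  have Hd' : l2 - l1 <> 0 by move=> E0; apply: Hd; have -> : l2 = (l2 - l1) + l1 by [ring]; rewrite
      E0; ring.
  have -> : mu2 = ((mu1 * (l1 * frob m p t0) + mu2 * (l2 * frob m (- p) t0))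
      - l1 * (mu1 * frob m p t0 + mu2 * frob m (- p) t0)) / ((l2 - l1) * frob m (- p) t0).
    field; by split.
  rewrite E; field; by split.
have Hmu1 : mu1 = 1.
  have L : Clim (Rbar_locally m_infty)
      (fun t => mu1 * clifford (p / INR m) (clifford_var m (RtoC t))) (mu1 * 1).
    apply: Clim_scal; exact: clifford_limit.
  have L' := pseries_limit A (fun x => g1 x p) HAs; rewrite HA0 in L'.
  have E : RtoC 1 = mu1 * 1.
    apply: (Clim_unique (Rbar_locally m_infty) _ _ _ _ L').
    apply: (Clim_ext (Rbar_locally m_infty) _ _ _ _ _ L).
    apply: filter_forall => t.
    have := Hlin (RtoC t); rewrite Hmu2 /fg /f_sol /f1 /frob /lift => E.
    have He := Cexp_neq_0 (s_exp p * t); set e := Cexp (s_exp p * t) in E He.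
    have -> : g1 (Cexp t) p = e * g1 (Cexp t) p / e by field.
    rewrite E; field; exact: He.
  by rewrite E; ring.
move=> t; rewrite -/(fg t) Hlin Hmu1 Hmu2 /f1; ring.
Qed.

(** * Connection matrices *)

Lemma matrix_characterization (M : @matrix C 2 2) (a b c d : C) (u v u' v' : C -> C) :
  (forall t, u t = a * u' t + b * v' t) -> (forall t, v t = c * u' t + d * v' t) ->
  (forall x y, (forall t : R, x * u' t + y * v' t = 0) -> x = 0 /\ y = 0) ->
  (forall t, col2 (u t) (v t) = @Mmult C_Ring 2 2 1 M (col2 (u' t) (v' t))) <->
  M = mat2 a b c d.
Proof.
move=> Hu Hv Hind.
have E : forall a b c d x y : C, @Mmult C_Ring 2 2 1 (mat2 a b c d) (col2 x y)
   = col2 (a * x + b * y) (c * x + d * y).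
  move=> a' b' c' d' x y; rewrite /Mmult /col2; apply/mk_matrix_ext => i j Hi Hj.
  rewrite sum_Sn sum_O.
  have -> : j = 0%nat by lia.
  by case: i Hi => [|[|i]] Hi; [ | | lia].
split; last by move=> -> t; rewrite E -Hu -Hv.
case: M => -[a' [b' []]] [[c' [d' []]] []] H.
have H' : forall t, col2 (u t) (v t) = col2 (a' * u' t + b' * v' t) (c' * u' t + d' * v' t).
  by move=> t; rewrite H -E.
have Hr1 : forall t, u t = a' * u' t + b' * v' t.
  by move=> t; have := f_equal (fun P => coeff_mat (RtoC 0) P 0 0) (H' t).
have Hr2 : forall t, v t = c' * u' t + d' * v' t.
  by move=> t; have := f_equal (fun P => coeff_mat (RtoC 0) P 1 0) (H' t).
have cancel : forall x y x' y' : C, (forall t : R, x * u' t + y * v' t = x' * u' t + y' * v' t) ->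
    x = x' /\ y = y'.
  move=> x y x' y' HE; case: (Hind (x - x') (y - y')) => [t|E1 E2].
    transitivity ((x * u' t + y * v' t) - (x' * u' t + y' * v' t)); first by ring.
    rewrite HE; ring.
  split; [have -> : x = (x - x') + x' by ring | have -> : y = (y - y') + y' by ring];
    rewrite ?E1 ?E2; ring.
case: (cancel a' b' a b) => [t|-> ->]; first by rewrite -Hr1 Hu.
case: (cancel c' d' c d) => [t|-> ->]; first by rewrite -Hr2 Hv.
by [].
Qed.

(** The real axis and the ray [arg x = 2 pi / m] of the asymptotics of [Phi_0]. *)
Lemma Phi0_data (m : nat) (Phi0 : C -> Cvec m -> C) (am : C) : (1 <= m)%nat -> is_Phi0 m Phi0 ->
  let F t := Phi0 t (last_only m am) in
  exists dF, (forall t, solves_at m am F dF t) /\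
    Clim (Rbar_locally p_infty) (fun t => F (RtoC t) / lead m (RtoC t)) 1 /\
    Clim (Rbar_locally p_infty) (fun t => rotated m F (RtoC t) / lead m (RtoC t + turn m)) 1.
Proof.
move=> Hm H F.
have Hmp : (0 < INR m)%R by apply: lt_0_INR; lia.
have HPI := PI_RGT_0.
have Hpos : (0 < 2 * PI / INR m)%R by apply: Rdiv_lt_0_compat; lra.
case: (solution_last_only m am F Hm (proj1 H _)) => dF HdF; exists dF; split => //; split.
- have L := Phi0_limit m Phi0 am 0 Hm H ltac:(rewrite Rabs_R0; lra).
  apply: (Clim_ext (Rbar_locally p_infty) _ _ _ _ _ L).
  apply: filter_forall => t.
  by have -> : t + Ci * 0 = t by ring.
- have L := Phi0_limit m Phi0 am (2 * PI / INR m) Hm H ltac:(rewrite Rabs_pos_eq; lra).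
  apply: (Clim_ext (Rbar_locally p_infty) _ _ _ _ _ L).
  by apply: filter_forall => t; rewrite /rotated turn_Ci.
Qed.

Lemma S0_characterization (m : nat) (Phi0 : C -> Cvec m -> C) (am p : C) (M : @matrix C 2 2) :
  (1 <= m)%nat -> is_Phi0 m Phi0 -> p ^ 2 = 1 + 4 * am ->
  is_S0 Phi0 (last_only m am) M <->
  M = mat2 (2 * Cexp (- (Ci * PI / INR m)) * Ccos (PI * (p / INR m)))
           (- Cexp (- (2 * Ci * PI / INR m))) (RtoC 1) (RtoC 0).
Proof.
move=> Hm HPhi; have Hm0 := INR_neq_0_C m Hm.
have Hmp : (0 < INR m)%R by apply: lt_0_INR; lia.
have cos_even : forall q : C, Ccos (PI * (- q / INR m)) = Ccos (PI * (q / INR m)).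
  move=> q; rewrite /Ccos.
  have -> : Ci * (PI * (- q / INR m)) = - (Ci * (PI * (q / INR m))) by rewrite /Cdiv; ring.
  rewrite Copp_involutive Cplus_comm; reflexivity.
wlog Hre : p / (0 <= Re p)%R.
  move=> H Hp; case: (Rle_dec 0 (Re p)) => Hs; first exact: H.
  rewrite -cos_even; apply: (H (- p)).
    have -> : Re (- p) = (- Re p)%R by [].
    lra.
  rewrite -Hp; ring.
move=> Hp.
have Hnr : nonresonant (p / INR m).
  move=> k E; have : Re (p / INR m + 1 + INR k) = 0%R by rewrite E.
  have -> : p / INR m = RtoC (/ INR m) * p by rewrite RtoC_inv; [rewrite /Cdiv; ring | lra].
  have := Rinv_0_lt_compat _ Hmp; have := pos_INR k.
  case: (p) Hre => x y /= Hx Hk Hi.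
  have : (0 <= / INR m * x)%R by apply: Rmult_le_pos; lra.
  lra.
case: (Phi0_data m Phi0 am Hm HPhi) => dF [HF [L1 L2]].
set F := (fun t => Phi0 t _) in HF L1 L2.
have HW := rotated_independent m am F dF 0 Hm HF L1 L2.
have HR := rotated_solves m am F dF Hm HF.
have Ham : am = (p ^ 2 - 1) / 4 by rewrite Hp; field.
have HCH := rotation_cayley_hamilton m p F dF Hm Hnr ltac:(rewrite -Ham; exact: HF) HW.
apply: (matrix_characterization M _ _ _ _ (fun t => Phi Phi0 (-1) t (last_only m am))
  (fun t => Phi Phi0 0 t (last_only m am)) (fun t => Phi Phi0 0 t (last_only m am))
  (fun t => Phi Phi0 1 t (last_only m am))) => [t|t|x y].
- rewrite !Phi_last_only // -!/(F _).
  have -> : F (t + IZR (-1) * turn m) = F (t - turn m) by congr F; ring.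
  have -> : t + 0 * turn m = t by ring.
  have -> : t + 1 * turn m = t + turn m by ring.
  rewrite (HCH (t - turn m)).
  have -> : t - turn m + turn m = t by ring.
  have -> : Cexp (- (2 * Ci * PI / INR m)) = Cexp (- turn m) by [].
  rewrite /Ccos.
  have E : Cexp ((s_exp p - 1) * turn m) + Cexp (- (s_exp p * turn m)) =
     2 * Cexp (- (Ci * PI / INR m)) *
     ((Cexp (Ci * (PI * (p / INR m))) + Cexp (- (Ci * (PI * (p / INR m))))) / 2).
    have -> : Cexp ((s_exp p - 1) * turn m) = Cexp (- (Ci * PI / INR m)) * Cexp (Ci * (PI * (p /
        INR m))).
      rewrite -Cexp_plus; congr Cexp; rewrite /s_exp /turn; field; exact: Hm0.
    have -> : Cexp (- (s_exp p * turn m)) = Cexp (- (Ci * PI / INR m)) * Cexp (- (Ci * (PI * (p /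
        INR m)))).
      rewrite -Cexp_plus; congr Cexp; rewrite /s_exp /turn; field; exact: Hm0.
    field.
  rewrite E; ring.
- ring.
- move=> HZ; apply: (independent_of_wronskian m am x y F dF _ _ HF HR HW) => t.
  rewrite -[RHS](HZ t) !Phi_last_only // -!/(F _) /rotated.
  have -> : t + 0 * turn m = t by ring.
  by have -> : t + 1 * turn m = t + turn m by ring.
Qed.

(** On the real axis [Phi_0] is the integral [recessive m p] by uniqueness of the recessive
    solution; the connection formula extends from there to the covering. *)
Lemma Phi0_frob (m : nat) (Phi0 : C -> Cvec m -> C) (p : C) : (1 <= m)%nat -> is_Phi0 m Phi0 ->
  nonintegral (p / INR m) -> forall t,
  Phi0 t (a_of_p m p) = recessive_coef m (- p) * frob m p t + recessive_coef m p * frob m (- p) t.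
Proof.
move=> Hm HPhi Hnu.
have Hm0 := INR_neq_0_C m Hm.
case: (Phi0_data m Phi0 ((p ^ 2 - 1) / 4) Hm HPhi) => dF [HF [L1 L2]].
set F := (fun t => Phi0 t _) in HF L1 L2.
have Hneg : - p / INR m = - (p / INR m) by rewrite /Cdiv; ring.
have Hn1 := nonintegral_nonresonant _ Hnu.
have Hn2 := nonintegral_nonresonant _ (nonintegral_opp _ Hnu).
rewrite -Hneg in Hn2.
have H1 : forall t, solves_at m ((p ^ 2 - 1) / 4) (frob m p) (dfrob m p) t.
  by move=> t; exact: frob_solves.
have Esq : p ^ 2 = (- p) ^ 2 by ring.
have H2 : forall t, solves_at m ((p ^ 2 - 1) / 4) (frob m (- p)) (dfrob m (- p)) t.
  by move=> t; rewrite Esq; exact: frob_solves.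
apply: (real_identity_extends m _ _ _ _ _ _ _ F dF H1 H2 HF).
  rewrite frob_wronskian // => E; apply: (Hnu 0%Z).
  rewrite -[p]Copp_involutive E; field; exact: Hm0.
move=> t; rewrite -recessive_frob //; symmetry.
set k := Cexp (p / INR m * ln (INR m)) / sqrt (INR m * PI)%R.
pose dU t := k * dlift m (- p) (macdonald (p / INR m)) (fun y => - macdonald (p / INR m - 1) y) t +
    0 * dF t.
have HU : forall t : R, solves_at m ((p ^ 2 - 1) / 4)
    (fun t => k * lift m (- p) (macdonald (p / INR m)) t + 0 * F t) dU t.
  move=> t'; apply: solves_at_lin; [exact: macdonald_solves | exact: HF].
rewrite -(recessive_unique m _ F dF _ dU Hm HF L1 L2 HU).
  rewrite /recessive -/k; ring.
apply: (Clim_ext (Rbar_locally p_infty) _ _ _ _ _ (recessive_limit m p Hm)).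
apply: filter_forall => t'; rewrite /recessive -/k; congr (_ / _); ring.
Qed.

(** Thus [e^beta = m^(p/m) omega^(p/2)]: the first factor comes from [y = x^m / m^2] in the
    connection formula, and the second one cancels [omega^(s(-p) - 1/2)] in the second row. *)
Definition beta (m : nat) (p : C) : C := p / INR m * (ln (INR m) + Ci * PI).

Lemma M0_characterization (m : nat) (Phi0 : C -> Cvec m -> C) (g1 : C -> C -> C) (p : C)
    (M : @matrix C 2 2) :
  (1 <= m)%nat -> is_Phi0 m Phi0 -> is_g1 m g1 -> nonintegral (p / INR m) ->
  is_M0 Phi0 g1 p M <->
  M = mat2
    (Cexp (beta m (- p)) * (omega m (- (1 / 2)) / sqrt (INR m * PI)%R) * Gamma (- (p / INR m)))
    (Cexp (beta m p) * (omega m (- (1 / 2)) / sqrt (INR m * PI)%R) * Gamma (p / INR m))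
    (omega m (s_exp p) * Cexp (beta m (- p)) * (omega m (- (1 / 2)) / sqrt (INR m * PI)%R)
       * Gamma (- (p / INR m)))
    (omega m (s_exp (- p)) * Cexp (beta m p) * (omega m (- (1 / 2)) / sqrt (INR m * PI)%R)
       * Gamma (p / INR m)).
Proof.
move=> Hm HPhi Hg Hnu; have Hm0 := INR_neq_0_C m Hm.
have Hneg : - p / INR m = - (p / INR m) by rewrite /Cdiv; ring.
have Hnun : nonintegral (- p / INR m) by rewrite Hneg; exact: nonintegral_opp.
have Hn1 := nonintegral_nonresonant _ Hnu.
have Hn2 := nonintegral_nonresonant _ Hnun.
have Hf1 := f_sol_frob m g1 p Hm Hg Hnu.
have Hf2 := f_sol_frob m g1 (- p) Hm Hg Hnun.
have Esq : p ^ 2 = (- p) ^ 2 by ring.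
have HF := Phi0_frob m Phi0 p Hm HPhi Hnu.
have Hs : RtoC (sqrt (INR m * PI)) <> 0.
  by case: (sqrt_mPI m Hm) => -> [H1 H2]; apply: Cmult_neq_0.
have Hback : forall q t, frob m q (t - turn m) = Cexp (- (s_exp q * turn m)) * frob m q t.
  move=> q t; have -> : frob m q t = frob m q (t - turn m + turn m) by congr frob; ring.
  rewrite frob_turn // Cexp_opp; field; exact: Cexp_neq_0.
have B1 : forall q : C, Cexp (beta m q) * omega m (- (1 / 2)) =
    Cexp (q / INR m * ln (INR m)) * Cexp (- (s_exp (- q) * turn m)).
  move=> q; rewrite omega_turn -!Cexp_plus; congr Cexp.
  rewrite /beta /s_exp /turn; field; exact: Hm0.
have B2 : forall q : C, omega m (s_exp (- q)) * Cexp (beta m q) * omega m (- (1 / 2)) =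
    Cexp (q / INR m * ln (INR m)).
  move=> q; rewrite !omega_turn -!Cexp_plus; congr Cexp.
  rewrite /beta /s_exp /turn; field; exact: Hm0.
apply: (matrix_characterization M _ _ _ _ (fun t => Phi Phi0 (-1) t (a_of_p m p))
  (fun t => Phi Phi0 0 t (a_of_p m p)) (fun t => f_sol g1 t p) (fun t => f_sol g1 t (- p))) => [t|t|x y].
- rewrite /a_of_p Phi_last_only // -/(a_of_p m p) HF Hf1 Hf2.
  have -> : t + IZR (-1) * turn m = t - turn m by ring.
  rewrite !Hback /recessive_coef !Hneg.
  have E1 := B1 p; have E2 := B1 (- p); rewrite Copp_involutive Hneg in E2.
  transitivity ((Cexp (- (p / INR m) * ln (INR m)) * Cexp (- (s_exp p * turn m))) / sqrt (INR m *
      PI)%R * Gamma (- (p / INR m)) * frob m p t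
    + (Cexp (p / INR m * ln (INR m)) * Cexp (- (s_exp (- p) * turn m))) / sqrt (INR m * PI)%R *
        Gamma (p / INR m) * frob m (- p) t).
    rewrite /Cdiv; ring.
  rewrite -E1 -E2 /Cdiv; ring.
- rewrite /a_of_p Phi_last_only // -/(a_of_p m p) HF Hf1 Hf2.
  have -> : t + 0 * turn m = t by ring.
  rewrite /recessive_coef !Hneg.
  have E1 := B2 p; have E2 := B2 (- p); rewrite Copp_involutive Hneg in E2.
  rewrite -E1 -E2 /Cdiv; ring.
- move=> HZ.
  apply: (independent_of_wronskian m ((p ^ 2 - 1) / 4) x y (frob m p) (dfrob m p) (frob m (- p))
      (dfrob m (- p))).
  + by move=> t; exact: frob_solves.
  + by move=> t; rewrite Esq; exact: frob_solves.
  + rewrite frob_wronskian // => E; apply: (Hnu 0%Z).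
    rewrite -[p]Copp_involutive E; field; exact: Hm0.
  + by move=> t; rewrite -Hf1 -Hf2.
Qed.

Lemma exp_beta (m k : nat) : (1 <= m)%nat ->
  Cexp (beta m (INR k * INR m)) = (INR m) ^ k \/ Cexp (beta m (INR k * INR m)) = - (INR m) ^ k.
Proof.
move=> Hm; have Hm0 := INR_neq_0_C m Hm; have Hmp : (0 < INR m)%R by apply: lt_0_INR; lia.
have -> : beta m (INR k * INR m) = INR k * ln (INR m) + INR k * (Ci * PI).
  rewrite /beta; field; exact: Hm0.
rewrite Cexp_plus -!Cexp_pow Cexp_R exp_ln // Cexp_PI.
have : (- (1)) ^ k = RtoC 1 \/ (- (1)) ^ k = - RtoC 1.
  elim: k => [|k [IH|IH]]; first by left.
  - by right; rewrite Cpow_S IH; ring.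
  - by left; rewrite Cpow_S IH; ring.
by case=> ->; [left | right]; ring.
Qed.

Theorem proposition7p1 (m : nat) (hm : (1 <= m)%nat)
    (Phi0 : C -> Cvec m -> C) (hPhi0 : is_Phi0 m Phi0) :
  (forall am p : C, p ^ 2 = 1 + 4 * am ->
     forall M : @matrix C 2 2,
       is_S0 Phi0 (last_only m am) M <->
       M = mat2 (2 * Cexp (- (Ci * PI / INR m)) * Ccos (PI * (p / INR m)))
                (- Cexp (- (2 * Ci * PI / INR m)))
                (RtoC 1) (RtoC 0)) /\
  (exists beta : C -> C,
     (forall p : C, beta (- p) = - beta p) /\
     (forall p : C, C_differentiable beta p) /\
     (forall k : nat, (1 <= k)%nat ->
        Cexp (beta (INR k * INR m)) = (INR m) ^ k \/
        Cexp (beta (INR k * INR m)) = - (INR m) ^ k) /\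
     forall g1 : C -> C -> C, is_g1 m g1 ->
     forall p : C, ~ integral_ratio m p ->
     forall M : @matrix C 2 2,
       is_M0 Phi0 g1 p M <->
       M = mat2
         (Cexp (beta (- p)) * (omega m (- (1 / 2)) / sqrt (INR m * PI)%R)
            * Gamma (- (p / INR m)))
         (Cexp (beta p) * (omega m (- (1 / 2)) / sqrt (INR m * PI)%R)
            * Gamma (p / INR m))
         (omega m (s_exp p) * Cexp (beta (- p))
            * (omega m (- (1 / 2)) / sqrt (INR m * PI)%R)
            * Gamma (- (p / INR m)))
         (omega m (s_exp (- p)) * Cexp (beta p)
            * (omega m (- (1 / 2)) / sqrt (INR m * PI)%R)
            * Gamma (p / INR m))).
Proof.
split=> [am p Hp M|]; first exact: S0_characterization.
exists (beta m); split; last split; last split.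
- by move=> p; rewrite /beta /Cdiv; ring.
- move=> p; exists (/ INR m * (ln (INR m) + Ci * PI)).
  apply: (is_C_derive_eq _ _ _ _ (is_C_derive_ext _ _ _ _ _
    (is_C_derive_scal _ (/ INR m * (ln (INR m) + Ci * PI)) _ _ (is_C_derive_id p)))); last ring.
  by move=> q; rewrite /beta /Cdiv; ring.
- move=> k _; exact: exp_beta.
- move=> g1 Hg1 p Hp M; apply: M0_characterization => // n Hn; apply: Hp; by exists n.
Qed.
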